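(* Let $d\ge2$ and $s\in(0,d)$. If $\mu$ is a reflectionless measure for the $s$-dimensional Riesz transform on $\mathbb{R}^d$, then $\operatorname{supp}(\mu)$ is nowhere dense in $\mathbb{R}^d$.
   Context: The $s$-dimensional Riesz transform is the Calder\'on--Zygmund operator with kernel $K(x)=x/|x|^{s+1}$ on $\mathbb{R}^d$, and $K_\delta(x)=x/\max(\delta,|x|)^{s+1}$. A measure is a nonnegative locally finite Borel measure; $\langle f,g\rangle_\mu=\int f\cdot g\,d\mu$; $\operatorname{supp}(\mu)$ is the closed support. $\mu$ is $\Lambda$-nice if $\mu(B(x,r))\le\Lambda r^s$ for every ball. $T_{\mu,\delta}f(x)=\int K_\delta(x-y)f(y)d\mu(y)$. $\mu$ is $\Lambda$-good if $\Lambda$-nice and $\|T_{\mu,\delta}\|_{L^2(\mu)\to L^2(\mu)}\le\Lambda$ for all $\delta>0$; then $\langle T_\mu f,g\rangle_\mu:=\lim_{\delta\to0}\langle T_{\mu,\delta}f,g\rangle_\mu$ defines a bounded operator on $L^2(\mu)$. For $\Lambda$-good $\mu$ and compactly supported Lipschitz $\psi$ with $\int\psi d\mu=0$, choose a ball $B\supset\operatorname{supp}\psi$, $z\in B$, $\varphi\in L^2(\mu)$ with $\varphi\equiv1$ on $2B$, $0\le\varphi\le1$, and set $\langle T_\mu(1),\psi\rangle_\mu=\langle T_\mu(\varphi),\psi\rangle_\mu+\int\psi(x)\int(1-\varphi(y))[K(x-y)-K(z-y)]d\mu(y)d\mu(x)$ (independent of choices). $\mu$ is reflectionless if it is $\Lambda$-good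 for some $\Lambda>0$ and $\langle T_\mu(1),\psi\rangle_\mu=0$ for all such $\psi$. *)

(* Defs.v *)
From HB Require Import structures.
From mathcomp Require Import all_boot all_order all_algebra.
From mathcomp Require Import all_classical all_reals all_analysis.
Set Implicit Arguments. Unset Strict Implicit. Unset Printing Implicit Defensive.
Import Order.TTheory GRing.Theory Num.Theory.
Import numFieldNormedType.Exports.
Local Open Scope classical_set_scope.
Local Open Scope ring_scope.

(* R^d is modelled as row vectors 'rV[R]_d; its topology (from the max norm)
   is the Euclidean topology.  The measurable structure is the Borel
   sigma-algebra, i.e. the sigma-algebra generated by the open sets. *)
Notation Rd R d := (g_sigma_algebraType (@open 'rV[R]_d)).

Section Riesz.
Context {R : realType} {d : nat}.

Definition dotp (x y : 'rV[R]_d) : R := \sum_(i < d) x ord0 i * y ord0 i.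
Definition enorm (x : 'rV[R]_d) : R := Num.sqrt (dotp x x).
Definition eball (c : 'rV[R]_d) (r : R) : set 'rV[R]_d :=
  [set x | enorm (x - c) < r].

Definition Kr (s : R) (x : 'rV[R]_d) : 'rV[R]_d :=
  (enorm x `^ (s + 1))^-1 *: x.
Definition Kd (s delta : R) (x : 'rV[R]_d) : 'rV[R]_d :=
  (Num.max delta (enorm x) `^ (s + 1))^-1 *: x.

Definition Rdm := Rd R d.

Definition vint (mu : {measure set Rdm -> \bar R}) (F : Rdm -> 'rV[R]_d)
  : 'rV[R]_d := \row_(i < d) Rintegral mu setT (fun y => F y ord0 i).

Definition locally_finite (mu : {measure set Rdm -> \bar R}) : Prop :=
  forall (x : 'rV[R]_d) (r : R), (mu (eball x r) < +oo)%E.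

Definition L2 (mu : {measure set Rdm -> \bar R}) (f : Rdm -> R) : Prop :=
  measurable_fun setT f /\ (\int[mu]_x ((f x) ^+ 2)%:E < +oo)%E.

Definition Tmd (s : R) (mu : {measure set Rdm -> \bar R}) (delta : R)
  (f : Rdm -> R) (x : 'rV[R]_d) : 'rV[R]_d :=
  vint mu (fun y => f y *: Kd s delta (x - (y : 'rV[R]_d))).

Definition nice (s Lam : R) (mu : {measure set Rdm -> \bar R}) : Prop :=
  forall (x : 'rV[R]_d) (r : R), 0 < r -> (mu (eball x r) <= (Lam * r `^ s)%:E)%E.

Definition good (s Lam : R) (mu : {measure set Rdm -> \bar R}) : Prop :=
  nice s Lam mu /\
  forall delta : R, 0 < delta -> forall f : Rdm -> R, L2 mu f ->
    (\int[mu]_x ((enorm (Tmd s mu delta f x)) ^+ 2)%:E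
      <= (Lam ^+ 2)%:E * \int[mu]_x ((f x) ^+ 2)%:E)%E.

Definition pairTd (s : R) (mu : {measure set Rdm -> \bar R}) (delta : R)
  (f : Rdm -> R) (g : Rdm -> 'rV[R]_d) : R :=
  Rintegral mu setT (fun x => dotp (Tmd s mu delta f x) (g x)).
Definition pairT (s : R) (mu : {measure set Rdm -> \bar R})
  (f : Rdm -> R) (g : Rdm -> 'rV[R]_d) : R :=
  lim (pairTd s mu delta f g @[delta --> 0^'+]).

Definition lipschitz_fun (psi : 'rV[R]_d -> 'rV[R]_d) : Prop :=
  exists L : R, forall x y, enorm (psi x - psi y) <= L * enorm (x - y).

Definition supp_fun (psi : 'rV[R]_d -> 'rV[R]_d) : set 'rV[R]_d :=
  closure [set x | psi x != 0].

(* <T_mu(1), psi>_mu for the choices B = ball(c,r), z, phi *)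
Definition pairT1 (s : R) (mu : {measure set Rdm -> \bar R})
  (phi : Rdm -> R) (z : 'rV[R]_d) (psi : Rdm -> 'rV[R]_d) : R :=
  pairT s mu phi psi +
  Rintegral mu setT (fun x => dotp (psi x)
     (vint mu (fun y => (1 - phi y) *:
         (Kr s ((x : 'rV[R]_d) - y) - Kr s (z - (y : 'rV[R]_d)))))).

Definition reflectionless (s : R) (mu : {measure set Rdm -> \bar R}) : Prop :=
  (exists Lam : R, 0 < Lam /\ good s Lam mu) /\
  forall psi : 'rV[R]_d -> 'rV[R]_d,
    lipschitz_fun psi -> compact (supp_fun psi) -> vint mu psi = 0 ->
    forall (c : 'rV[R]_d) (r : R) (z : 'rV[R]_d) (phi : Rdm -> R),
      0 < r -> supp_fun psi `<=` eball c r -> eball c r z ->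
      L2 mu phi -> (forall x, 0 <= phi x <= 1) ->
      (forall x, eball c (2 * r) x -> phi x = 1) ->
      pairT1 s mu phi z psi = 0.

Definition supp (mu : {measure set Rdm -> \bar R}) : set 'rV[R]_d :=
  [set x | forall r : R, 0 < r -> (0 < mu (eball x r))%E].

Definition nowhere_dense (A : set 'rV[R]_d) : Prop :=
  interior (closure A) = set0.

End Riesz.

(* Main.v *)
Require Import Defs.
From HB Require Import structures.
From mathcomp Require Import all_boot all_order all_algebra.
From mathcomp Require Import all_classical all_reals all_analysis.
From mathcomp Require Import measurable_realfun.
From mathcomp Require Import ring lra.
Import Order.TTheory GRing.Theory Num.Theory.
Import numFieldNormedType.Exports.
Local Open Scope classical_set_scope.
Local Open Scope ring_scope.
Set Implicit Arguments. Unset Strict Implicit. Unset Printing Implicit Defensive.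

(* Let w = |x-y|^2 + u, a = (s+1)/2, q(x,u) = int w^-a dmu and let E(x,u) be the
   smoothed field int (x-y) w^-a dmu, renormalized at infinity and by a constant.
   Testing reflectionlessness against tent functions shows that, for a suitable
   constant, the truncated fields tend weakly to 0 on mu; so integrals of E against
   a tent reduce to interactions through odd kernels. This gives, at points of the
   support, |E(x,u)| <= C (theta + theta^-s sqrt(u) q(x,u)) for all theta in (0,1]:
   otherwise E would be nearly constant and comparatively large on a ball of radius
   sqrt(u), which forces mu(B(y, 2^-k sqrt(u))) to decay like 2^-k(d+1), and a grid
   covering produces a null ball centred in the support.

   If s <= d-1 and the support contains a ball, div E is nonnegative and dominates
   u int w^-a-1. Averaging over a fine grid against tents, the flux first bounds the
   average of u int w^-a-1, hence sqrt(u) q tends to 0 on average as u -> 0, hence so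
   do E and then div E. But the average of div E is bounded below by the mass of the ball.

   If s > d-1, put beta = s+1-d in (0,1) and L = Lap_x + 4 u d_uu + 2 beta d_u. Then
   L E = 0 and L(|E|^2 - lam u q^2) >= lam beta (1-beta) q^2 for small lam > 0, so at
   penalized near-maxima of |E|^2 - lam u q^2 the density is tiny, hence E is tiny as
   well. Thus |E|^2 <= lam u q^2 for all small lam, i.e. E = 0. Now div E = 0 reads
   2 u q_u = -beta q, so u^(beta/2) q is constant in u, which contradicts
   q = O(u^(-1/2)) unless mu = 0. *)

(** * Euclidean geometry and the support *)

Section EuclideanGeometry.
Context {R : realType} {d : nat}.
Implicit Types x y z : 'rV[R]_d.

(** Reflectionlessness is a weak statement on mu: it says nothing pointwise and nothing off the
    support. It becomes pointwise because mu charges every ball centred in its support, while q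
    controls how much E can vary at scale sqrt(u). The parameter theta separates close pairs, where
    a Lipschitz test function gains a factor theta, from the other pairs, which cost theta^-s times
    a density. Writing u = h^2 with a height h turns L into Lap_x + d_hh + ((beta - 1)/h) d_h. Its
    radial fundamental solution is w^((1-s)/2) (a logarithm if s = 1), and the kernel of E is a
    multiple of the x-gradient of it; hence L E = 0. The variable u is kept instead of h because the
    kernels are then smooth in w up to u = 0 off the support. There L degenerates, so the maximum
    principle has to cope with a boundary. The two ranges of s differ by a sign: d - 1 - s >= 0
    makes div E the integral of a nonnegative kernel. For s > d - 1 this is lost, but beta > 0 gives
    the right sign on the boundary u = 0. *)

Lemma dotpC x y : dotp x y = dotp y x.
Proof. by apply: eq_bigr => i _; rewrite mulrC. Qed.

Lemma dotpDl x y z : dotp (x + y) z = dotp x z + dotp y z.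
Proof. by rewrite -big_split; apply: eq_bigr => i _; rewrite mxE mulrDl. Qed.

Lemma dotpZl (c : R) x y : dotp (c *: x) y = c * dotp x y.
Proof. by rewrite /dotp mulr_sumr; apply: eq_bigr => i _; rewrite mxE mulrA. Qed.

Lemma dotpNl x y : dotp (- x) y = - dotp x y.
Proof. by rewrite -scaleN1r dotpZl mulN1r. Qed.

Lemma dotpDr x y z : dotp x (y + z) = dotp x y + dotp x z.
Proof. by rewrite dotpC dotpDl !(dotpC x). Qed.

Lemma dotpZr (c : R) x y : dotp x (c *: y) = c * dotp x y.
Proof. by rewrite dotpC dotpZl dotpC. Qed.

Lemma dotpNr x y : dotp x (- y) = - dotp x y.
Proof. by rewrite dotpC dotpNl dotpC. Qed.

Lemma dotp_ge0 x : 0 <= dotp x x.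
Proof. by apply: sumr_ge0 => i _; rewrite -expr2 sqr_ge0. Qed.

Lemma dotp_delta x i : dotp x (delta_mx ord0 i) = x ord0 i.
Proof.
rewrite /dotp (bigD1 i)//= big1 ?addr0 ?mxE ?eqxx ?mulr1//.
by move=> j ji; rewrite mxE (negbTE ji) andbF mulr0.
Qed.

Lemma enorm_ge0 x : 0 <= enorm x.
Proof. exact: sqrtr_ge0. Qed.
Hint Resolve enorm_ge0 : core.

Lemma enorm_sqr x : enorm x ^+ 2 = dotp x x.
Proof. by rewrite sqr_sqrtr// dotp_ge0. Qed.

Lemma coord_sqr_le x i : x ord0 i ^+ 2 <= dotp x x.
Proof.
rewrite /dotp (bigD1 i)//= -expr2 lerDl sumr_ge0// => j _.
by rewrite -expr2 sqr_ge0.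
Qed.

Lemma coord_le x i : `|x ord0 i| <= enorm x.
Proof.
by rewrite -(ler_pXn2r (_ : (0 < 2)%N)) ?nnegrE// enorm_sqr real_normK ?num_real// coord_sqr_le.
Qed.

Lemma cauchy_schwarz x y : `|dotp x y| <= enorm x * enorm y.
Proof.
rewrite -(ler_pXn2r (_ : (0 < 2)%N)) ?nnegrE ?mulr_ge0//.
rewrite exprMn !enorm_sqr real_normK ?num_real//.
have [y0|y0] := eqVneq (dotp y y) 0.
  suff -> : y = 0.
    by rewrite -(scale0r 0) !(dotpZr, dotpZl) !mul0r expr0n/= mulr0.
  apply/rowP => i; rewrite mxE; apply/eqP; rewrite -sqrf_eq0 eq_le sqr_ge0 andbT.
  by rewrite -y0 coord_sqr_le.
have yp : 0 < dotp y y by rewrite lt_neqAle eq_sym y0 dotp_ge0.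
have := dotp_ge0 (dotp y y *: x - dotp x y *: y).
rewrite !(dotpDl, dotpDr, dotpNl, dotpNr, dotpZl, dotpZr) (dotpC y x).
set p := dotp x x; set q := dotp x y; set r := dotp y y in yp *.
rewrite [X in 0 <= X -> _](_ : _ = r * (p * r - q ^+ 2)); last by ring.
by rewrite pmulr_rge0// subr_ge0.
Qed.

Lemma enormD x y : enorm (x + y) <= enorm x + enorm y.
Proof.
rewrite -(ler_pXn2r (_ : (0 < 2)%N)) ?nnegrE ?addr_ge0//.
rewrite sqrrD !enorm_sqr !(dotpDl, dotpDr) (dotpC y x).
have := cauchy_schwarz x y; have := ler_norm (dotp x y); lra.
Qed.

Lemma enormN x : enorm (- x) = enorm x.
Proof. by rewrite /enorm dotpNl dotpNr opprK. Qed.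

Lemma enormZ (c : R) x : enorm (c *: x) = `|c| * enorm x.
Proof. by rewrite /enorm dotpZl dotpZr mulrA -expr2 sqrtrM ?sqr_ge0// sqrtr_sqr. Qed.

Lemma enorm0 : enorm (0 : 'rV[R]_d) = 0.
Proof. by rewrite -(scale0r 0) enormZ normr0 mul0r. Qed.

Lemma enormB x y : enorm (x - y) = enorm (y - x).
Proof. by rewrite -enormN opprB. Qed.

Lemma enorm_dist x y z : enorm (x - z) <= enorm (x - y) + enorm (y - z).
Proof. by rewrite (le_trans _ (enormD _ _))// addrA subrK. Qed.

Lemma enorm_eq0 x : (enorm x == 0) = (x == 0).
Proof.
apply/eqP/eqP => [x0|->]; last exact: enorm0.
apply/rowP => i; rewrite mxE; apply/eqP; rewrite -normr_eq0 eq_le normr_ge0 andbT.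
by rewrite -x0 coord_le.
Qed.

Lemma enorm_delta i : enorm (delta_mx ord0 i : 'rV[R]_d) = 1.
Proof. by rewrite /enorm dotp_delta mxE !eqxx sqrtr1. Qed.

Lemma enorm_le_coord x (r : R) : 0 <= r -> (forall i, `|x ord0 i| <= r) ->
  enorm x <= d%:R * r.
Proof.
move=> r0 xr; rewrite -(ler_pXn2r (_ : (0 < 2)%N)) ?nnegrE ?mulr_ge0//.
rewrite enorm_sqr exprMn.
have : dotp x x <= \sum_(i < d) r ^+ 2.
  apply: ler_sum => i _; rewrite -expr2 -(real_normK (num_real (x ord0 i))).
  by rewrite ler_pXn2r ?nnegrE.
rewrite sumr_const card_ord -(mulr_natl (r ^+ 2)) => /le_trans; apply.
apply: ler_wpM2r; first exact: sqr_ge0.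
by rewrite -natrX ler_nat; case: d => // n; rewrite expnS leq_pmulr// expn_gt0.
Qed.

Lemma coord_le_norm x i : `|x ord0 i| <= `|x|.
Proof.
rewrite [leRHS]mx_normrE.
exact: (le_bigmax _ (fun ij : 'I_1 * 'I_d => `|x ij.1 ij.2|) (ord0, i)).
Qed.

Lemma enorm_le_norm x : enorm x <= d%:R * `|x|.
Proof. by apply: enorm_le_coord => // i; exact: coord_le_norm. Qed.

Lemma norm_le_enorm x : `|x| <= enorm x.
Proof.
rewrite [leLHS]mx_normrE; apply: bigmax_le => //= -[i j] _ /=.
by rewrite ord1 coord_le.
Qed.

(** The topology of row vectors comes from the max norm, so a Euclidean Lipschitz bound is converted
    at the price of a factor [d%:R]. *)
Lemma lipschitz_enorm_continuous (f : 'rV[R]_d -> R) (L : R) :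
  (forall x y, `|f x - f y| <= L * enorm (x - y)) -> continuous f.
Proof.
move=> fL x; apply/(@cvgrPdist_le _ _ _ (nbhs x)) => e e0.
have C0 : 0 < `|L| * d%:R + 1 by rewrite ltr_wpDl// mulr_ge0.
near=> y.
rewrite (le_trans (fL _ _))//.
rewrite (@le_trans _ _ ((`|L| * d%:R + 1) * `|x - y|))//.
  rewrite mulrDl mul1r -mulrA.
  have : L * enorm (x - y) <= `|L| * enorm (x - y) by rewrite ler_wpM2r// ler_norm.
  have : `|L| * enorm (x - y) <= `|L| * (d%:R * `|x - y|).
    by rewrite ler_wpM2l// enorm_le_norm.
  have : 0 <= `|x - y| by []. lra.
rewrite mulrC -ler_pdivlMr//.
near: y; apply: (@cvgr_dist_le _ _ _ _ _ id x); first exact: cvg_id.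
by rewrite divr_gt0.
Unshelve. all: by end_near. Qed.

Lemma enorm_lip x y : `|enorm x - enorm y| <= enorm (x - y).
Proof.
have := enorm_dist x y 0; have := enorm_dist y x 0; rewrite !subr0 (enormB y x).
by move=> h1 h2; rewrite ler_norml; apply/andP; split; lra.
Qed.

Lemma continuous_enormB x : continuous (fun y => enorm (y - x)).
Proof.
apply: (@lipschitz_enorm_continuous _ 1) => y z.
by rewrite mul1r (le_trans (enorm_lip _ _))// opprB addrA subrK.
Qed.

Lemma open_eball x (r : R) : open (eball x r).
Proof.
have -> : eball x r = (fun y => enorm (y - x)) @^-1` [set t | t < r] by [].
apply: open_comp; last exact: open_lt.
by move=> y _; exact: continuous_enormB.
Qed.

Lemma compact_closed_eball x (r : R) : compact [set y | enorm (y - x) <= r].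
Proof.
apply: bounded_closed_compact; last first.
  have -> : [set y | enorm (y - x) <= r] = (fun y => enorm (y - x)) @^-1` [set t | t <= r] by [].
  apply: closed_comp; last exact: closed_le.
  by move=> y _; exact: continuous_enormB.
exists (r + enorm x); split; first exact: num_real.
move=> M rM y /= yr.
have := norm_le_enorm y; have := enorm_dist y x 0; rewrite !subr0; lra.
Qed.

Lemma nbhs_eball x (A : set 'rV[R]_d) : nbhs x A -> exists2 r : R, 0 < r & eball x r `<=` A.
Proof.
rewrite -nbhs_ballE => -[e/= e0 eA]; exists e => // y /= xy; apply: eA.
rewrite mx_norm_ball /ball_ /= -opprB normrN.
exact: le_lt_trans (norm_le_enorm _) xy.
Qed.

End EuclideanGeometry.
#[global] Hint Extern 0 (is_true (0 <= enorm _)) => solve [apply: enorm_ge0] : core.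

Section Measurability.
Context {R : realType} {d : nat}.
Local Notation Rd := (@Rdm R d).
Implicit Types x y z : 'rV[R]_d.

Lemma measurable_open (A : set Rd) : open (A : set 'rV[R]_d) -> measurable A.
Proof. by move=> oA; apply: sub_sigma_algebra. Qed.

Lemma measurable_closed (A : set Rd) : closed (A : set 'rV[R]_d) -> measurable A.
Proof. by move=> cA; rewrite -(setCK A); apply: measurableC; apply: measurable_open; exact: closed_openC. Qed.

Lemma measurable_eball x (r : R) : measurable (eball x r : set Rd).
Proof. by apply: measurable_open; exact: open_eball. Qed.

Lemma continuous_measurable (f : 'rV[R]_d -> R) : continuous f ->
  measurable_fun [set: Rd] (f : Rd -> R).
Proof.
move=> /continuousP cf mD; apply: (measurability _ (RGenOpens.measurableE R)) => //.
move=> _ [_ [a [b ->] <-]]; rewrite setTI; apply: measurable_open.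
exact/cf/interval_open.
Qed.

Lemma measurable_coord i : measurable_fun [set: Rd] (fun x : Rd => (x : 'rV[R]_d) ord0 i).
Proof.
apply: (@continuous_measurable (fun x => x ord0 i)).
apply: (@lipschitz_enorm_continuous _ _ _ 1) => x y.
by rewrite mul1r (le_trans _ (coord_le _ i))// !mxE.
Qed.

Lemma measurable_dotp d' (T : measurableType d') (f g : T -> 'rV[R]_d) :
  (forall i, measurable_fun setT (fun t => f t ord0 i)) ->
  (forall i, measurable_fun setT (fun t => g t ord0 i)) ->
  measurable_fun setT (fun t => dotp (f t) (g t)).
Proof.
by move=> mf mg; apply: measurable_sum => i; apply: measurable_funM.
Qed.

Lemma measurable_enorm d' (T : measurableType d') (f : T -> 'rV[R]_d) :
  (forall i, measurable_fun setT (fun t => f t ord0 i)) ->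
  measurable_fun setT (fun t => enorm (f t)).
Proof.
move=> mf; apply: (@measurableT_comp _ _ _ _ _ _ (@Num.sqrt R) _ (fun t => dotp (f t) (f t))).
  by apply: continuous_measurable_fun; exact: sqrt_continuous.
exact: measurable_dotp.
Qed.

End Measurability.

Section Support.
Context {R : realType} {d : nat}.
Variable mu : {measure set (Rd R d) -> \bar R}.

Lemma closed_supp : closed (supp mu).
Proof.
move=> x cx r r0; have r20 : 0 < r / 2 by rewrite divr_gt0.
have [y [sy /= yx]] : supp mu `&` eball x (r / 2) !=set0.
  apply: cx; apply: open_nbhs_nbhs; split; first exact: open_eball.
  by rewrite /eball/= subrr enorm0.
apply: lt_le_trans (sy _ r20) _; apply: le_measure; rewrite ?inE; [exact: measurable_eball..|].
by move=> z /= zy; have := enorm_dist z y x; move: zy yx; rewrite /eball/=; lra.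
Qed.

Lemma measurable_supp : measurable (supp mu : set (Rd R d)).
Proof. by apply: measurable_closed; exact: closed_supp. Qed.

(* Lindelof: rational balls form a countable base. *)
Lemma null_supp : mu (~` supp mu) = 0%E.
Proof.
pose c (q : 'rV[rat]_d) : 'rV[R]_d := map_mx ratr q.
pose B (p : 'rV[rat]_d * rat) := eball (c p.1) (ratr p.2).
pose P (p : 'rV[rat]_d * rat) := `[< mu (B p) = 0%E >].
pose F (n : nat) : set (Rd R d) :=
  if unpickle n is Some p then (if P p then B p else set0) else set0.
have mF n : measurable (F n).
  rewrite /F; case: (unpickle n) => // p; case: ifP => // _; exact: measurable_eball.
have F0 n : mu (F n) = 0%E.
  by rewrite /F; case: (unpickle n) => // p; case: ifPn => // /asboolP.
have cup0 : mu (\bigcup_n F n) = 0%E.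
  apply/negligibleP; first exact: bigcup_measurable.
  by apply: negligible_bigcup => n; exists (F n); split.
apply/eqP; rewrite -measure_le0 -[leRHS]cup0 le_measure ?inE//.
- by apply: measurableC; exact: measurable_supp.
- exact: bigcup_measurable.
move=> x /= nx.
have [r r0 xr0] : exists2 r : R, 0 < r & mu (eball x r) = 0%E.
  apply/not_exists2P => h; apply: nx => r r0.
  by have [//|/eqP] := h r; rewrite lt0e measure_ge0 andbT => ->.
have r20 : 0 < r / 2 by rewrite divr_gt0.
(* A rational radius q < r/2 and a rational centre within q of x give a ball of the countable family
   that contains x and lies in [eball x r], hence is null. *)
have [q qr] := rat_in_itvoo r20.
move: qr; rewrite in_itv/= => /andP[q0 qr].
have e0 : 0 < ratr q / (d%:R + 1) :> R by rewrite divr_gt0// ltr_wpDl.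
have /choice[v hv] : forall i : 'I_d, exists p : rat, x ord0 i - ratr q / (d%:R + 1) < ratr p < x ord0 i + ratr q / (d%:R + 1).
  move=> i; have hlt : x ord0 i - ratr q / (d%:R + 1) < x ord0 i + ratr q / (d%:R + 1) by lra.
  by have [p] := rat_in_itvoo hlt; rewrite in_itv/= => pq; exists p.
pose w : 'rV[rat]_d := \row_i v i.
have xw : enorm (x - c w) < ratr q.
  apply: (@le_lt_trans _ _ (d%:R * (ratr q / (d%:R + 1)))).
    apply: enorm_le_coord => [|i]; first exact: ltW.
    rewrite !mxE; have /andP[h1 h2] := hv i; rewrite ler_norml; apply/andP; split; lra.
  by rewrite mulrA ltr_pdivrMr ?ltr_wpDl// mulrC ltr_pM2l// ltrDl.
have Bw : B (w, q) `<=` eball x r.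
  move=> y /= yw; rewrite /eball/=; have := enorm_dist y (c w) x; rewrite (enormB (c w)).
  by move: yw; rewrite /B /eball/=; lra.
have PB : P (w, q).
  apply/asboolP/eqP; rewrite -measure_le0 -[leRHS]xr0 le_measure ?inE//; exact: measurable_eball.
exists (pickle (w, q)) => //; rewrite /F pickleK PB.
by rewrite /B /eball/=.
Qed.

End Support.

(** * Riesz kernels *)

Section PowerFunction.
Context {R : realType}.
Implicit Types a x y c : R.

Lemma powRN_le a x y : 0 <= a -> 0 < x -> x <= y -> y `^ (- a) <= x `^ (- a).
Proof.
move=> a0 x0 xy; rewrite !powRN lef_pV2 ?posrE ?powR_gt0 ?(lt_le_trans x0)//.
by apply: ge0_ler_powR => //; rewrite nnegrE ltW// (lt_le_trans x0).
Qed.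

Lemma powRN_comparable a x y c : 0 <= a -> 0 < x -> 0 < y -> 0 < c -> y <= c * x ->
  x `^ (- a) <= c `^ a * y `^ (- a).
Proof.
move=> a0 x0 y0 c0 ycx.
rewrite !powRN ler_pdivlMr ?powR_gt0// mulrC ler_pdivrMr ?powR_gt0//.
rewrite -(powRM _ (ltW c0) (ltW x0)).
by apply: ge0_ler_powR => //; rewrite nnegrE ltW// mulr_gt0.
Qed.

Lemma powR_sqr a x : 0 <= x -> (x ^+ 2) `^ a = x `^ (2 * a).
Proof. by move=> x0; rewrite -powR_mulrn// -powRrM. Qed.

(** The alternative k = 0 is the central ball of radius t, where x has no lower bound. *)
Lemma dyadic_up x t : 0 < t -> 0 <= x ->
  exists k : nat, x < 2 ^+ k * t /\ (k = 0%N \/ 2 ^+ k * t / 2 <= x).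
Proof.
move=> t0 x0; have ex : exists n : nat, x < 2 ^+ n * t.
  exists (Num.bound (x / t)); rewrite -ltr_pdivrMr//.
  have xt0 : 0 <= x / t by rewrite divr_ge0// ltW.
  rewrite (lt_trans (archi_boundP xt0))// -natrX ltr_nat.
  exact: ltn_expl.
case: (ex_minnP ex) => k xk kmin; exists k; split => //.
case: k xk kmin => [|k] xk kmin; [by left|right].
rewrite leNgt; apply/negP => xk2; suff : (k.+1 <= k)%N by rewrite ltnn.
by apply: kmin; move: xk2; rewrite exprS; lra.
Qed.

Lemma dyadic_down x r : 0 < x -> x < r ->
  exists k : nat, x < r / 2 ^+ k /\ r / 2 ^+ k / 2 <= x.
Proof.
move=> x0 xr; have ex : exists n : nat, r <= 2 ^+ n * x.
  have [k [h _]] := dyadic_up x0 (ltW (lt_trans x0 xr)).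
  by exists k; exact: ltW.
case: (ex_minnP ex) => -[|k] rk kmin; first by move: rk; rewrite expr0 mul1r leNgt xr.
have p : 0 < 2 ^+ k :> R by rewrite exprn_gt0.
exists k; split; last first.
  rewrite -mulrA -invfM ler_pdivrMr ?mulr_gt0//.
  by move: rk; rewrite exprS; lra.
rewrite ltr_pdivlMr// mulrC ltNge; apply/negP => /kmin; by rewrite ltnn.
Qed.

Lemma ler_sqr_ge0 x y : 0 <= x -> x <= y -> x ^+ 2 <= y ^+ 2.
Proof. by move=> x0 xy; rewrite ler_pXn2r// nnegrE (le_trans x0). Qed.

End PowerFunction.

Section DyadicIntegrals.
Context {R : realType} {d : nat}.
Local Notation Rd := (@Rdm R d).
Variables (mu : {measure set Rd -> \bar R}) (s Lam : R).
Hypothesis mu_nice : nice s Lam mu.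

(** The function f is at most the sum of the multiples c_k of the indicators of B(x, r_k). By
    niceness the k-th term has integral at most M / 2^(k+1), and these bounds add up to M. *)
Lemma dyadic_bound (x : 'rV[R]_d) (f : Rd -> R) (c r : nat -> R) (M : R) :
  measurable_fun setT f -> (forall y, 0 <= f y) ->
  (forall k, 0 <= c k) -> (forall k, 0 < r k) ->
  (forall k, c k * (Lam * r k `^ s) <= M / (2 ^ (k + 1))%:R) ->
  (forall y, f y != 0 -> exists k, enorm ((y : 'rV[R]_d) - x) < r k /\ f y <= c k) ->
  (\int[mu]_y (f y)%:E <= M%:E)%E.
Proof.
move=> mf f0 c0 r0 crM fcr.
pose g k (y : Rd) : \bar R := (c k * \1_(eball x (r k)) y)%:E.
have mg k : measurable_fun setT (g k).
  apply/measurable_EFinP; apply: measurable_funM => //.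
  exact: measurable_indic (measurable_eball _ _).
have g0 k y : (0 <= g k y)%E by rewrite lee_fin mulr_ge0.
apply: (@le_trans _ _ (\int[mu]_y \sum_(k <oo) g k y)%E).
  apply: ge0_le_integral => //.
  - by move=> y _; rewrite lee_fin.
  - exact/measurable_EFinP.
  - exact: ge0_emeasurable_sum.
  move=> y _; have [->|/fcr[k [yr fy]]] := eqVneq (f y) 0.
    exact: nneseries_ge0.
  apply: (le_trans _ (@nneseries_lim_ge _ _ _ _ k.+1 _)) => //.
  rewrite big_nat_recr//= (@le_trans _ _ (g k y))//; last first.
    by rewrite leeDr// sume_ge0.
  by rewrite /g indicE mem_set// mulr1 lee_fin.
rewrite integral_nneseries//.
apply: (@le_trans _ _ (\sum_(k <oo) (M / (2 ^ (k + 1))%:R)%:E)%E).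
  apply: lee_nneseries => // [k _ _|k _]; first exact: integral_ge0.
  rewrite /g; under eq_integral do rewrite EFinM.
  rewrite ge0_integralZl//=; last 2 first.
  - by apply/measurable_EFinP; exact: measurable_indic (measurable_eball _ _).
  - by rewrite lee_fin.
  rewrite integral_indic ?setIT//; last exact: measurable_eball.
  apply: (@le_trans _ _ ((c k)%:E * (Lam * r k `^ s)%:E)%E).
    by rewrite lee_wpmul2l ?lee_fin//; exact: mu_nice.
  by rewrite -EFinM lee_fin.
have := @cvg_geometric_eseries_half R M 0; rewrite expr0 divr1 => /cvg_lim <- //.
Qed.

End DyadicIntegrals.

Ltac nonneg := repeat first
  [ assumption | exact: ltW | exact: normr_ge0 | exact: powR_ge0 | exact: enorm_ge0 | exact: sqr_ge0
  | exact: ler0n | exact: ler01 | exact: dotp_ge0 | exact: powR_ge0 | (rewrite invr_ge0) | apply: mulr_ge0 | apply: addr_ge0 | apply: exprn_ge0 ].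

Section RieszKernel.
Context {R : realType} {d : nat}.
Implicit Types (s u t : R) (v : 'rV[R]_d).

(** A smoothing of |v|^(-s-1), the scalar factor of the Riesz kernel, at length sqrt(u); u = 0 gives
    the singular kernel back away from v = 0. *)
Definition ker s u v : R := (dotp v v + u) `^ (- ((s + 1) / 2)).

Lemma ker_ge0 s u v : 0 <= ker s u v.
Proof. exact: powR_ge0. Qed.

Lemma ker_le s u v (rho : R) : 0 < s -> 0 < rho -> rho ^+ 2 <= dotp v v + u ->
  ker s u v <= rho `^ (- (s + 1)).
Proof.
move=> s0 rho0 h; rewrite /ker.
have := @powRN_le R ((s + 1) / 2) _ _ _ (exprn_gt0 2 rho0) h.
rewrite (powR_sqr _ (ltW rho0)) (_ : 2 * - ((s + 1) / 2) = - (s + 1)); last lra.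
by apply; lra.
Qed.

Lemma measurable_ker s u d' (T : measurableType d') (f : T -> 'rV[R]_d) :
  (forall i, measurable_fun setT (fun z => f z ord0 i)) ->
  measurable_fun setT (fun z => ker s u (f z)).
Proof.
move=> mf; apply: (@measurableT_comp _ _ _ _ _ _ (fun z : R => z `^ _)).
  exact: measurable_powR.
by apply: measurable_funD => //; exact: measurable_dotp.
Qed.

End RieszKernel.
#[global] Hint Extern 0 (is_true (0 <= ker _ _ _)) => solve [apply: ker_ge0] : core.

Section RieszIntegrals.
Context {R : realType} {d : nat}.
Local Notation Rd := (@Rdm R d).
Variables (mu : {measure set Rd -> \bar R}) (s Lam : R).
Hypothesis mu_nice : nice s Lam mu.
Hypothesis s_gt0 : 0 < s.
Implicit Types x : 'rV[R]_d.

Lemma measurable_coordB x i :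
  measurable_fun [set: Rd] (fun y : Rd => (x - (y : 'rV[R]_d)) ord0 i).
Proof.
under eq_fun do rewrite !mxE.
by apply: measurable_funB => //; exact: measurable_coord.
Qed.

(** At distance about 2^k t the kernel is at most (2^(k-1) t)^(-s-1), against a mass Lam (2^k t)^s:
    the contributions decay like 2^-k / t. Of 2^(s+2), the factor 2^(s+1) comes from the radius
    2^(k-1) t and the last 2 from the geometric series. *)
Lemma ker_integral_le x (t : R) : 0 < t ->
  (\int[mu]_y (ker s (t ^+ 2) (x - (y : 'rV[R]_d)))%:E <= (2 `^ (s + 2) * Lam / t)%:E)%E.
Proof.
move=> t0.
have p k : 0 < 2 ^+ k * t by rewrite mulr_gt0// exprn_gt0.
have q k : 0 < 2 ^+ k * t / 2 by rewrite divr_gt0.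
apply: (@dyadic_bound _ _ _ _ _ mu_nice x _ (fun k => (2 ^+ k * t / 2) `^ (- (s + 1))) (fun k => 2 ^+ k * t)) => //.
- by apply: measurable_ker => i; exact: measurable_coordB.
- by move=> k; exact: powR_ge0.
- move=> k; set r := 2 ^+ k * t.
  have r0 : 0 < r by exact: p.
  have h2 : 0 <= 2^-1 :> R by rewrite invr_ge0.
  rewrite (mulrC r 2^-1) (powRM _ h2 (ltW r0)).
  rewrite (_ : 2^-1 `^ (- (s + 1)) = 2 `^ (s + 1)); last first.
    by rewrite -powR_inv1// -powRrM mulN1r opprK.
  rewrite (_ : _ * _ * _ = 2 `^ (s + 1) * Lam * (r `^ (- (s + 1)) * r `^ s)); last by ring.
  rewrite (_ : r `^ (- (s + 1)) * r `^ s = r^-1); last first.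
    rewrite -powRD ?(gt_eqF r0) ?implybT// -(powR_inv1 (ltW r0)).
    by congr (_ `^ _); lra.
  rewrite natrX exprD expr1 /r.
  rewrite (_ : 2 `^ (s + 2) = 2 `^ (s + 1) * 2); last first.
    rewrite (_ : s + 2 = (s + 1) + 1); last lra.
    by rewrite powRD ?powRr1// pnatr_eq0 implybT.
  have k0 : 2 ^+ k != 0 :> R by rewrite expf_neq0.
  rewrite le_eqVlt; apply/orP; left; apply/eqP; field.
  by rewrite k0 gt_eqF.
- move=> y _; have [k [h1 h2]] := dyadic_up t0 (enorm_ge0 ((y : 'rV[R]_d) - x)).
  exists k; split => //; apply: ker_le => //; rewrite -enorm_sqr enormB.
  case: h2 => [->|h2]; last first.
    by rewrite -[leLHS]addr0 lerD ?sqr_ge0// ler_sqr_ge0// ltW.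
  by rewrite expr0 mul1r -[leLHS]add0r lerD ?sqr_ge0// ler_sqr_ge0//; lra.
Qed.

(** The local counterpart: a Lipschitz factor |y - x| tames the singularity |y - x|^-s, so that the
    shell of radius r / 2^k contributes a multiple of r / 2^k. *)
Lemma near_integral_le x (r A : R) (f : Rd -> R) : 0 < r -> 0 <= A ->
  measurable_fun setT f -> (forall y, 0 <= f y) ->
  (forall y, f y != 0 -> 0 < enorm ((y : 'rV[R]_d) - x) < r /\
    f y <= A * (enorm ((y : 'rV[R]_d) - x) * enorm ((y : 'rV[R]_d) - x) `^ (- s))) ->
  (\int[mu]_y (f y)%:E <= (A * (2 `^ (s + 1) * Lam * r))%:E)%E.
Proof.
move=> r0 A0 mf f0 fb.
have p k : 0 < r / 2 ^+ k by rewrite divr_gt0// exprn_gt0.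
apply: (@dyadic_bound _ _ _ _ _ mu_nice x _
  (fun k => A * ((r / 2 ^+ k) * (r / 2 ^+ k / 2) `^ (- s))) (fun k => r / 2 ^+ k)) => //.
- by move=> k; rewrite mulr_ge0// mulr_ge0 ?powR_ge0// ltW.
- move=> k; set q := r / 2 ^+ k.
  have q0 : 0 < q by exact: p.
  have h2 : 0 <= 2^-1 :> R by rewrite invr_ge0.
  rewrite (mulrC q 2^-1) (powRM _ h2 (ltW q0)).
  rewrite (_ : 2^-1 `^ (- s) = 2 `^ s); last first.
    by rewrite -powR_inv1// -powRrM mulN1r opprK.
  have qs : q `^ (- s) * q `^ s = 1 by rewrite powRN mulVf// gt_eqF// powR_gt0.
  rewrite (_ : _ * _ = A * (q * (2 `^ s) * Lam * (q `^ (- s) * q `^ s))); last by ring.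
  rewrite qs mulr1 natrX exprD expr1.
  rewrite powRD; last by rewrite pnatr_eq0 implybT.
  rewrite powRr1// /q.
  have k0 : 2 ^+ k != 0 :> R by rewrite expf_neq0.
  by rewrite le_eqVlt; apply/orP; left; apply/eqP; field.
- move=> y /fb[/andP[h1 h2] h3]; have [k [h4 h5]] := dyadic_down h1 h2.
  exists k; split => //; apply: (le_trans h3); apply: ler_wpM2l => //; apply: ler_pM => //.
  + exact: powR_ge0.
  + exact: ltW.
  + by apply: powRN_le => //; [exact: ltW|rewrite divr_gt0].
Qed.

End RieszIntegrals.

Section MeanValue.
Context {R : realType}.
Implicit Types (f df : R -> R) (a x y z c : R).

Lemma mean_value f df x y : x <= y ->
  (forall z, x <= z <= y -> is_derive z 1 f (df z)) ->
  exists2 z, x <= z <= y & f y - f x = df z * (y - x).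
Proof.
move=> xy fdf.
have [||z] := @MVT_segment R f df x y xy.
- by move=> z; rewrite in_itv/= => /andP[xz zy]; apply: fdf; rewrite !ltW.
- apply: derivable_within_continuous => z; rewrite in_itv/= => zxy.
  by have [] := fdf z zxy.
by rewrite in_itv/= => zxy e; exists z.
Qed.

(** Mean value theorem; in either order of x and y the intermediate point z satisfies y <= c z,
    which moves the derivative back to y. *)
Lemma powRN_sub_le a c x y : 0 <= a -> 1 <= c -> 0 < x -> 0 < y ->
  x <= c * y -> y <= c * x ->
  `|x `^ (- a) - y `^ (- a)| <= a * c `^ (a + 1) * y `^ (- a - 1) * `|x - y|.
Proof.
move=> a0 c1 x0 y0 xcy ycx; have c0 : 0 < c by exact: lt_le_trans c1.
have bnd z : 0 < z -> y <= c * z -> `|- a * z `^ (- a - 1)| <= a * c `^ (a + 1) * y `^ (- a - 1).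
  move=> z0 ycz; rewrite mulNr normrN ger0_norm ?mulr_ge0 ?powR_ge0// -mulrA ler_wpM2l//.
  rewrite -opprD; apply: powRN_comparable => //; lra.
have [xy|/ltW yx] := leP x y.
  have [z z1 e] : exists2 z, x <= z <= y &
      y `^ (- a) - x `^ (- a) = - a * z `^ (- a - 1) * (y - x).
    apply: (@mean_value (fun z => z `^ (- a)) (fun z => - a * z `^ (- a - 1)) _ _ xy) => z /andP[xz _]; apply: is_derive1_powR; exact: lt_le_trans xz.
  rewrite distrC e normrM (distrC x) ler_wpM2r//; move/andP : z1 => [xz zy].
  apply: bnd; [exact: lt_le_trans xz|].
  by rewrite (le_trans ycx)// ler_wpM2l// ltW.
have [z z1 e] : exists2 z, y <= z <= x &
    x `^ (- a) - y `^ (- a) = - a * z `^ (- a - 1) * (x - y).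
  apply: (@mean_value (fun z => z `^ (- a)) (fun z => - a * z `^ (- a - 1)) _ _ yx) => z /andP[yz _]; apply: is_derive1_powR; exact: lt_le_trans yz.
rewrite e normrM ler_wpM2r//; move/andP : z1 => [yz zx].
apply: bnd; [exact: lt_le_trans yz|].
by rewrite (le_trans yz)// ler_peMl// (le_trans (ltW y0)).
Qed.

End MeanValue.

Section KernelEstimates.
Context {R : realType} {d : nat}.
Variable s : R.
Hypothesis s_gt0 : 0 < s.
Implicit Types (u c m : R) (v x y : 'rV[R]_d).

Lemma ker_comparable u u' c v v' : 0 < c -> 0 < dotp v v + u ->
  0 < dotp v' v' + u' -> dotp v' v' + u' <= c * (dotp v v + u) ->
  ker s u v <= c `^ ((s + 1) / 2) * ker s u' v'.
Proof. by move=> c0 w0 w'0 h; apply: powRN_comparable => //; rewrite divr_ge0// addr_ge0// ltW. Qed.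

Lemma dotp_shift x x' y : dotp (x - y) (x - y) <= 2 * dotp (x' - y) (x' - y) + 2 * dotp (x - x') (x - x').
Proof.
rewrite -!enorm_sqr; have := enorm_dist x x' y.
set A := enorm (x - y); set B := enorm (x - x'); set C := enorm (x' - y) => h.
have A0 : 0 <= A by exact: enorm_ge0. have h2 : A ^+ 2 <= (B + C) ^+ 2 by apply: ler_sqr_ge0.
have := sqr_ge0 (B - C); nra.
Qed.

Lemma weight_comparable u u' c x x' y : 2 <= c ->
  2 * dotp (x - x') (x - x') + u <= c * u' ->
  dotp (x - y) (x - y) + u <= c * (dotp (x' - y) (x' - y) + u').
Proof.
move=> c2 h; have := dotp_shift x x' y; have := dotp_ge0 (x' - y).
set A := dotp (x' - y) _; set B := dotp (x - y) _ => A0 ?.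
have : 2 * A <= c * A by rewrite ler_wpM2r. lra.
Qed.

Lemma riesz_sub_le c m u u' v v' j : 1 <= c -> 0 < m -> 0 <= u -> 0 <= u' ->
  m ^+ 2 <= dotp v' v' + u' -> 0 < dotp v v + u ->
  dotp v v + u <= c * (dotp v' v' + u') ->
  dotp v' v' + u' <= c * (dotp v v + u) ->
  `|v ord0 j * ker s u v - v' ord0 j * ker s u' v'| <=
   (c `^ ((s + 1) / 2) + (s + 1) / 2 * c `^ ((s + 1) / 2 + 1) * (c + 1)) *
     (enorm (v - v') + `|u - u'| / m) * ker s u' v'.
Proof.
move=> c1 m0 u0 u'0 mw' w0 ww' w'w.
set a := (s + 1) / 2; set w := dotp v v + u in w0 ww' w'w *.
set w' := dotp v' v' + u' in mw' ww' w'w *.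
have a0 : 0 <= a by have := s_gt0; rewrite /a; lra.
have c0 : 0 < c by exact: lt_le_trans c1.
have w'0 : 0 < w' by rewrite (lt_le_trans _ mw')// exprn_gt0.
(* q = sqrt(w') is the natural length at v': it dominates m and |v'|, and c q dominates |v|. A
   variation of the weight is therefore q times a length. *)
have [q q0 qw] : exists2 q : R, 0 < q & q ^+ 2 = w'.
  by exists (Num.sqrt w'); rewrite ?sqrtr_gt0// sqr_sqrtr// ltW.
have q0' := ltW q0; have m0' := ltW m0.
have qN0 : q != 0 by rewrite gt_eqF.
have mN0 : m != 0 by rewrite gt_eqF.
have mq : m <= q by rewrite -(@ler_pXn2r _ 2)// ?nnegrE ?qw// ltW.
have vq' : enorm v' <= q.
  by rewrite -(@ler_pXn2r _ 2)// ?nnegrE ?(ltW q0)// qw enorm_sqr /w'; lra.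
have vq : enorm v <= c * q.
  rewrite -(@ler_pXn2r _ 2)// ?nnegrE ?mulr_ge0 ?(ltW q0) ?(ltW c0)// exprMn qw enorm_sqr.
  apply: (@le_trans _ _ (c * w')); first by move: ww'; rewrite /w; lra.
  by rewrite ler_wpM2r ?(ltW w'0)// expr2 ler_peMl// ltW.
have wsub : `|w - w'| <= q * ((c + 1) * enorm (v - v') + `|u - u'| / m).
  have -> : w - w' = dotp (v - v') (v + v') + (u - u').
    by rewrite /w /w' dotpDl !dotpDr !dotpNl (dotpC v' v); ring.
  apply: (le_trans (ler_normD _ _)); rewrite mulrDr lerD//.
    apply: (le_trans (cauchy_schwarz _ _)).
    rewrite mulrCA mulrC mulrA ler_wpM2r//.
    by rewrite (le_trans (enormD _ _))//; lra.
  rewrite mulrCA ler_peMr// ler_pdivlMr// mul1r//.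
have K0 : 0 <= ker s u' v' by exact: ker_ge0.
have e1 : ker s u v <= c `^ a * ker s u' v' by exact: ker_comparable.
have e2 : `|ker s u v - ker s u' v'| <= a * c `^ (a + 1) * (c + 1) *
    (enorm (v - v') + `|u - u'| / m) * ker s u' v' / q.
  apply: (le_trans (powRN_sub_le a0 c1 w0 w'0 ww' w'w)).
  have -> : w' `^ (- a - 1) = ker s u' v' / q / q.
    have wN0 : w' != 0 by rewrite gt_eqF.
    rewrite (@powRB _ w' (- a) 1) ?wN0 ?implybT// (powRr1 (ltW w'0)).
    by rewrite -[X in _ / X]qw expr2 invfM mulrA.
  apply: (@le_trans _ _ (a * c `^ (a + 1) * (ker s u' v' / q / q) *
    (q * ((c + 1) * enorm (v - v') + `|u - u'| / m)))).
    by apply: ler_wpM2l => //; nonneg.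
  have um : 0 <= `|u - u'| / m by rewrite divr_ge0// ltW.
  rewrite [leLHS](_ : _ = a * c `^ (a + 1) * (ker s u' v' / q) * ((c + 1) * enorm (v - v') + `|u - u'| / m)); last first.
    by field; rewrite ?mN0 ?qN0.
  rewrite [leRHS](_ : _ = a * c `^ (a + 1) * (ker s u' v' / q) * ((c + 1) * (enorm (v - v') + `|u - u'| / m))); last first.
    by ring.
  apply: ler_wpM2l; first by nonneg.
  by rewrite mulrDr lerD2l ler_peMl//; lra.
rewrite [X in `|X|](_ : _ = (v - v') ord0 j * ker s u v + v' ord0 j * (ker s u v - ker s u' v')); last first.
  by rewrite !mxE; ring.
apply: (le_trans (ler_normD _ _)); rewrite !normrM (ger0_norm (ker_ge0 s u v)).
have um : 0 <= `|u - u'| / m by rewrite divr_ge0// ltW.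
rewrite mulrDl mulrDl lerD//.
  apply: (@le_trans _ _ (enorm (v - v') * (c `^ a * ker s u' v'))).
    by rewrite ler_pM// ?ker_ge0// coord_le.
  rewrite mulrCA mulrA ler_wpM2r// ler_wpM2l ?powR_ge0//; lra.
apply: (le_trans (ler_pM _ _ (le_trans (coord_le _ _) vq') e2)) => //.
rewrite le_eqVlt; apply/orP; left; apply/eqP; by field; rewrite ?mN0 ?qN0.
Qed.

End KernelEstimates.

Section TruncatedKernel.
Context {R : realType} {d : nat}.
Variable s : R.
Hypothesis s_gt0 : 0 < s.
Implicit Types (u c t delta : R) (v x y : 'rV[R]_d).

Definition tker delta v : R := (Num.max delta (enorm v) `^ (s + 1))^-1.

Lemma Kd_coord delta v j : Kd s delta v ord0 j = v ord0 j * tker delta v.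
Proof. by rewrite mxE mulrC. Qed.

Lemma tker_ge0 delta v : 0 <= tker delta v.
Proof. by rewrite invr_ge0 powR_ge0. Qed.

Lemma exponent_ge0 : 0 <= (s + 1) / 2.
Proof. by have := s_gt0; lra. Qed.

Lemma powRN_exponent t : 0 <= t -> (t `^ (s + 1))^-1 = (t ^+ 2) `^ (- ((s + 1) / 2)).
Proof. by move=> t0; rewrite powR_sqr// -powRN; congr (_ `^ _); lra. Qed.

Lemma ker_le_tker u delta v : 0 < delta -> delta ^+ 2 <= u -> ker s u v <= tker delta v.
Proof.
move=> d0 du; rewrite /tker /ker; set m := Num.max _ _.
have m0 : 0 < m by rewrite lt_max d0.
rewrite powRN_exponent ?(ltW m0)//; apply: powRN_le; [exact: exponent_ge0|exact: exprn_gt0|].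
have := dotp_ge0 v; have := sqr_ge0 delta; rewrite -enorm_sqr.
by rewrite /m; case: (leP delta (enorm v)) => _; lra.
Qed.

Lemma ker_le_riesz u v : 0 <= u -> v != 0 -> ker s u v <= (enorm v `^ (s + 1))^-1.
Proof.
move=> u0 v0; have n0 : 0 < enorm v by rewrite lt_neqAle eq_sym enorm_eq0 v0 enorm_ge0.
rewrite powRN_exponent ?(ltW n0)//; apply: powRN_le; [exact: exponent_ge0|exact: exprn_gt0|].
by rewrite enorm_sqr; lra.
Qed.

Lemma tker_le_riesz delta v : v != 0 -> tker delta v <= (enorm v `^ (s + 1))^-1.
Proof.
move=> v0; have n0 : 0 < enorm v by rewrite lt_neqAle eq_sym enorm_eq0 v0 enorm_ge0.
have s1 : 0 <= s + 1 by have := s_gt0; lra.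
rewrite lef_pV2 ?posrE ?powR_gt0 ?lt_max ?n0 ?orbT//.
apply: ge0_ler_powR => //; rewrite ?nnegrE ?le_max ?enorm_ge0 ?orbT//.
by rewrite lexx orbT.
Qed.

Lemma riesz_size v : v != 0 -> enorm v * (enorm v `^ (s + 1))^-1 = enorm v `^ (- s).
Proof.
move=> v0; have n0 : 0 < enorm v by rewrite lt_neqAle eq_sym enorm_eq0 v0 enorm_ge0.
rewrite -powRN -{1}(powRr1 (ltW n0)) -powRD ?(gt_eqF n0) ?implybT//.
by congr (_ `^ _); lra.
Qed.

Lemma coord_mul_le (k k' b : R) v j : 0 <= k <= b -> 0 <= k' <= b ->
  `|v ord0 j * (k - k')| <= enorm v * b.
Proof.
move=> /andP[k0 kb] /andP[k'0 k'b]; rewrite normrM ler_pM ?coord_le//.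
by rewrite ler_norml; apply/andP; split; lra.
Qed.

Lemma tker_sub_ker_near delta u v j : 0 <= u ->
  `|v ord0 j * (tker delta v - ker s u v)| <= enorm v `^ (- s).
Proof.
move=> u0; have [->|v0] := eqVneq v 0; first by rewrite mxE mul0r normr0 powR_ge0.
rewrite -riesz_size//; apply: coord_mul_le; first by rewrite tker_ge0 tker_le_riesz.
by rewrite ker_ge0 ker_le_riesz.
Qed.

Lemma tker_sub_tker delta delta' v j :
  `|v ord0 j * (tker delta v - tker delta' v)| <= enorm v `^ (- s) /\
  (Num.max delta delta' <= enorm v -> v ord0 j * (tker delta v - tker delta' v) = 0).
Proof.
split; last first.
  rewrite ge_max /tker => /andP[h h'].
  by rewrite (max_idPr h) (max_idPr h') subrr mulr0.
have [->|v0] := eqVneq v 0; first by rewrite mxE mul0r normr0 powR_ge0.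
rewrite -riesz_size//; apply: coord_mul_le; by rewrite tker_ge0 tker_le_riesz.
Qed.

(** Far from the origin, exchanging truncation for smoothing gains a factor t / |v| over the trivial
    bound |v|^-s; what remains is O(|v|^(-s-1)), which mu integrates at infinity. *)
Lemma tker_sub_ker_far delta t c v j : 0 < t -> 1 <= c -> v != 0 -> delta <= enorm v ->
  dotp v v + t ^+ 2 <= c * dotp v v ->
  `|v ord0 j * (tker delta v - ker s (t ^+ 2) v)| <=
    ((s + 1) / 2 * c `^ ((s + 1) / 2 + 1)) * t * ker s (t ^+ 2) v.
Proof.
move=> t0 c1 v0 dv wc.
have n0 : 0 < enorm v by rewrite lt_neqAle eq_sym enorm_eq0 v0 enorm_ge0.
rewrite /tker (max_idPr dv) powRN_exponent ?(ltW n0)// enorm_sqr.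
have vv0 : 0 < dotp v v by rewrite -enorm_sqr exprn_gt0.
have t20 : 0 < t ^+ 2 by exact: exprn_gt0.
set w := dotp v v + t ^+ 2 in wc *.
have w0 : 0 < w by rewrite /w; lra.
have vcw : dotp v v <= c * w.
  by rewrite /w (@le_trans _ _ (1 * w))// ?ler_wpM2r//; rewrite /w; lra.
rewrite normrM.
apply: (le_trans (ler_pM _ _ (coord_le _ _) (powRN_sub_le exponent_ge0 c1 vv0 w0 vcw wc))) => //.
rewrite [`|dotp v v - w|](_ : _ = t ^+ 2); last first.
  by rewrite /w opprD addrA subrr add0r normrN ger0_norm// ltW.
have -> : w `^ (- ((s + 1) / 2) - 1) = ker s (t ^+ 2) v / w.
  by rewrite powRB ?(gt_eqF w0) ?implybT// powRr1// ltW.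
set A := _ * c `^ _; set k := ker _ _ _.
have A0 : 0 <= A by rewrite mulr_ge0 ?powR_ge0 ?exponent_ge0.
have k0 : 0 <= k by exact: ker_ge0.
rewrite [leLHS](_ : _ = A * t * k * (enorm v * t / w)); last by ring.
apply: ler_piMr; first by nonneg.
rewrite ler_pdivrMr// mul1r /w -enorm_sqr.
by have := sqr_ge0 (enorm v - t); have := sqr_ge0 (enorm v); have := sqr_ge0 t; nra.
Qed.

(** At equal scales both kernels are multiples of [ker s (delta ^+ 2) v] for |v| < delta, and the
    far estimate with c = 2 covers the rest. *)
Lemma tker_sub_ker delta v j : 0 < delta ->
  `|v ord0 j * (tker delta v - ker s (delta ^+ 2) v)| <=
    (2 `^ ((s + 1) / 2) + (s + 1) / 2 * 2 `^ ((s + 1) / 2 + 1)) * delta * ker s (delta ^+ 2) v.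
Proof.
move=> d0; set A := 2 `^ _; set B := _ * 2 `^ _; set k := ker _ _ _.
have A0 : 0 <= A by exact: powR_ge0.
have B0 : 0 <= B by rewrite mulr_ge0 ?powR_ge0 ?exponent_ge0.
have k0 : 0 <= k by exact: ker_ge0.
have dk0 : 0 <= delta * k by rewrite mulr_ge0// ltW.
have [vd|dv] := ltP (enorm v) delta; last first.
  have n0 : 0 < enorm v by exact: lt_le_trans dv.
  have v0 : v != 0 by rewrite -enorm_eq0 gt_eqF.
  apply: (@le_trans _ _ (B * delta * k)); last by have := mulr_ge0 A0 dk0; lra.
  apply: tker_sub_ker_far => //; first by rewrite ler1n.
  have := ler_sqr_ge0 (ltW d0) dv; rewrite -enorm_sqr; lra.
apply: (@le_trans _ _ (A * delta * k)); last by have := mulr_ge0 B0 dk0; lra.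
have tk : tker delta v <= A * k.
  rewrite /tker (max_idPl (ltW vd)) powRN_exponent ?(ltW d0)//.
  have d20 : 0 < delta ^+ 2 by exact: exprn_gt0.
  have w0 : 0 < dotp v v + delta ^+ 2 by have := dotp_ge0 v; lra.
  apply: powRN_comparable => //; first exact: exponent_ge0.
  have := ler_sqr_ge0 (enorm_ge0 v) (ltW vd); rewrite -enorm_sqr; lra.
have Ak0 : 0 <= A * k by rewrite mulr_ge0.
have h : `|v ord0 j * (tker delta v - k)| <= enorm v * (A * k).
  apply: coord_mul_le; first by rewrite tker_ge0.
  by rewrite k0/= (le_trans _ tk)//; exact: ker_le_tker.
apply: (le_trans h); rewrite (_ : A * delta * k = delta * (A * k)); last by ring.
by apply: ler_wpM2r => //; exact: ltW.
Qed.

Lemma measurable_tker delta d' (T : measurableType d') (f : T -> 'rV[R]_d) :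
  (forall i, measurable_fun setT (fun z => f z ord0 i)) ->
  measurable_fun setT (fun z => tker delta (f z)).
Proof.
move=> mf; apply: (eq_measurable_fun (fun z => (Num.max delta (enorm (f z))) `^ (- (s + 1)))).
  by move=> z _; rewrite powRN.
apply: (@measurableT_comp _ _ _ _ _ _ (fun z : R => z `^ _)); first exact: measurable_powR.
by apply: measurable_maxr => //; exact: measurable_enorm.
Qed.

End TruncatedKernel.

(** * Integrals dominated at infinity *)

Section Dominated.
Context {R : realType} {d : nat}.
Local Notation Rd := (@Rdm R d).
Variables (mu : {measure set Rd -> \bar R}) (s Lam : R).
Hypothesis mu_nice : nice s Lam mu.
Hypothesis s_gt0 : 0 < s.
Variable D : set Rd.
Hypothesis mD : measurable D.
Implicit Types f g : Rd -> R.

(* Everything integrated below is O(|y|^{-s-1}) at infinity. *)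
Definition dominated f := measurable_fun setT f /\
  exists2 C : R, 0 <= C & forall y, D y -> `|f y| <= C * ker s 1 (y : 'rV[R]_d).

Local Notation Int f := (\int[mu]_(y in D) f y).

Lemma measurable_ker1 : measurable_fun [set: Rd] (fun y : Rd => ker s 1 (y : 'rV[R]_d)).
Proof. by apply: measurable_ker => i; exact: measurable_coord. Qed.

Lemma ker1_integrable : mu.-integrable [set: Rd] (EFin \o (fun y : Rd => ker s 1 (y : 'rV[R]_d))).
Proof.
apply/integrableP; split; first by apply/measurable_EFinP; exact: measurable_ker1.
have := ker_integral_le mu_nice s_gt0 0 ltr01.
rewrite expr1n => h; apply: le_lt_trans (ltry _); apply: le_trans h.
rewrite le_eqVlt; apply/orP; left; apply/eqP; apply: eq_integral => y _ /=.
by rewrite ger0_norm ?ker_ge0// /ker sub0r dotpNl dotpNr opprK.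
Qed.

Lemma dominated_integrable f : dominated f -> mu.-integrable D (EFin \o f).
Proof.
move=> [mf [C C0 fC]].
have h : mu.-integrable D (EFin \o (fun y : Rd => C * ker s 1 (y : 'rV[R]_d))).
  apply: (@integrableS _ _ _ _ setT) => //.
  exact: (integrableZl measurableT C ker1_integrable).
apply: le_integrable h => //; first by apply/measurable_EFinP; exact: measurable_funTS.
move=> y Dy /=; rewrite lee_fin (le_trans (fC y Dy))//.
exact: ler_norm.
Qed.

Lemma dominated_le f g (C : R) : measurable_fun setT f -> dominated g -> 0 <= C ->
  (forall y, D y -> `|f y| <= C * `|g y|) -> dominated f.
Proof.
move=> mf [mg [A A0 gA]] C0 fg; split => //; exists (C * A); first exact: mulr_ge0.
by move=> y Dy; rewrite (le_trans (fg y Dy))// -mulrA ler_wpM2l// gA.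
Qed.

Lemma dominatedD f g : dominated f -> dominated g -> dominated (fun y => f y + g y).
Proof.
move=> [mf [A A0 fA]] [mg [B B0 gB]]; split; first exact: measurable_funD.
exists (A + B); first exact: addr_ge0.
by move=> y Dy; rewrite (le_trans (ler_normD _ _))// mulrDl lerD ?fA ?gB.
Qed.

Lemma dominatedM (c : R) f : dominated f -> dominated (fun y => c * f y).
Proof.
move=> df; apply: (@dominated_le _ f `|c|) => //.
  by apply: measurable_funM => //; case: df.
by move=> y _; rewrite normrM.
Qed.

Lemma dominatedN f : dominated f -> dominated (fun y => - f y).
Proof.
move=> /(dominatedM (-1)) [mf h]; split.
  by apply: eq_measurable_fun mf => y _; rewrite mulN1r.
by case: h => C C0 h; exists C => // y /h; rewrite mulN1r.
Qed.

Lemma dominatedB f g : dominated f -> dominated g -> dominated (fun y => f y - g y).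
Proof. by move=> df dg; apply: dominatedD => //; exact: dominatedN. Qed.

Lemma dominated0 : dominated (fun=> 0).
Proof. by split => //; exists 0 => // y _; rewrite normr0 mul0r. Qed.

Lemma dominated_sum (I : Type) (r : seq I) (F : I -> Rd -> R) :
  (forall i, dominated (F i)) -> dominated (fun y => \sum_(i <- r) F i y).
Proof.
move=> dF; elim: r => [|i r IH].
  by under eq_fun do rewrite big_nil; exact: dominated0.
by under eq_fun do rewrite big_cons; exact: dominatedD.
Qed.

Lemma dominated_bounded (b : Rd -> R) f (B : R) : measurable_fun setT b ->
  (forall y, `|b y| <= B) -> dominated f -> dominated (fun y => b y * f y).
Proof.
move=> mb bB df; apply: (@dominated_le _ f `|B|) => //.
  by apply: measurable_funM => //; case: df.
by move=> y _; rewrite normrM ler_wpM2r// (le_trans (bB y))// ler_norm.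
Qed.

Lemma IntD f g : dominated f -> dominated g -> Int (fun y => f y + g y) = Int f + Int g.
Proof. by move=> df dg; apply: RintegralD => //; exact: dominated_integrable. Qed.

Lemma IntB f g : dominated f -> dominated g -> Int (fun y => f y - g y) = Int f - Int g.
Proof. by move=> df dg; apply: RintegralB => //; exact: dominated_integrable. Qed.

Lemma IntM (c : R) f : dominated f -> Int (fun y => c * f y) = c * Int f.
Proof. by move=> df; apply: RintegralZl => //; exact: dominated_integrable. Qed.

Lemma Int_sum (I : Type) (r : seq I) (F : I -> Rd -> R) :
  (forall i, dominated (F i)) -> Int (fun y => \sum_(i <- r) F i y) = \sum_(i <- r) Int (F i).
Proof.
move=> dF; elim: r => [|i r IH].
  rewrite big_nil; under eq_Rintegral do rewrite big_nil.
  by rewrite Rintegral_cst// mul0r.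
rewrite big_cons -IH -IntD//; last exact: dominated_sum.
by apply: eq_Rintegral => y _; rewrite big_cons.
Qed.

Lemma Int_le f g : dominated f -> dominated g -> (forall y, D y -> f y <= g y) ->
  Int f <= Int g.
Proof. by move=> df dg fg; apply: le_Rintegral => //; exact: dominated_integrable. Qed.

Lemma Int_norm_le f g : dominated f -> dominated g -> (forall y, D y -> `|f y| <= g y) ->
  `|Int f| <= Int g.
Proof.
move=> df dg fg; apply: (le_trans (le_normr_Rintegral mD (dominated_integrable df))).
apply: Int_le => //.
apply: (@dominated_le _ f 1) => //; last by move=> y _; rewrite mul1r normr_id.
by apply: measurableT_comp => //; case: df.
Qed.

Lemma ker_dominated_unif u (rho : R) : 0 < u -> exists2 C : R, 0 <= C &
  forall x y : 'rV[R]_d, enorm x <= rho -> ker s u (x - y) <= C * ker s 1 y.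
Proof.
move=> u0.
pose c : R := 2 + (2 * rho ^+ 2 + 1) / u.
have c2 : 2 <= c by rewrite /c lerDl divr_ge0 ?ltW//; have := sqr_ge0 rho; lra.
have c0 : 0 < c by lra.
exists (c `^ ((s + 1) / 2)); first exact: powR_ge0.
move=> x y xr.
have -> : ker s 1 y = ker s 1 (0 - y) by rewrite /ker sub0r dotpNl dotpNr opprK.
apply: ker_comparable => //; first by have := dotp_ge0 (x - y); lra.
  by have := dotp_ge0 (0 - y); lra.
apply: weight_comparable => //; rewrite sub0r dotpNl dotpNr opprK -enorm_sqr.
rewrite /c [leRHS]mulrDl divfK ?gt_eqF//.
have := ler_sqr_ge0 (enorm_ge0 x) xr; have := sqr_ge0 rho; lra.
Qed.

(** Cancellation at infinity: the second summand is minus the vector kernel at (0 - y, 1), and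
    [riesz_sub_le] compares the two. Uniformity for |x| <= rho is what integration in x against
    localized functions requires. *)
Lemma riesz_dominated_unif u (rho : R) j : 0 < u -> exists2 C : R, 0 <= C &
  forall x y : 'rV[R]_d, enorm x <= rho ->
  `|(x - y) ord0 j * ker s u (x - y) + y ord0 j * ker s 1 y| <= C * ker s 1 y.
Proof.
move=> u0.
(* The quotient by u bounds the weight at (0 - y, 1) by the one at (x - y, u); the last summand
   serves the opposite comparison, and 2 comes from the parallelogram inequality. *)
pose c : R := 2 + (2 * rho ^+ 2 + 1) / u + (2 * rho ^+ 2 + u).
have r2 := sqr_ge0 rho.
have q0 : 0 <= (2 * rho ^+ 2 + 1) / u by rewrite divr_ge0 ?ltW//; lra.
have c2 : 2 <= c by rewrite /c; lra.
have c0 : 0 < c by lra.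
set K := (c `^ ((s + 1) / 2) + (s + 1) / 2 * c `^ ((s + 1) / 2 + 1) * (c + 1)).
have K0 : 0 <= K.
  have a0 := exponent_ge0 s_gt0; have c1 : 0 <= c + 1 by lra.
  by rewrite /K; nonneg.
exists (K * (`|rho| + `|u - 1| / 1)); first by rewrite mulr_ge0// addr_ge0// divr1.
move=> x y xr.
have ky : ker s 1 y = ker s 1 (0 - y) by rewrite /ker sub0r dotpNl dotpNr opprK.
have ej : y ord0 j = - (0 - y) ord0 j by rewrite !mxE sub0r opprK.
rewrite ky [X in _ + X * _]ej mulNr.
have xr2 := ler_sqr_ge0 (enorm_ge0 x) xr.
have x20 : dotp (x - 0) (x - 0) <= rho ^+ 2 by rewrite subr0 -enorm_sqr.
have x02 : dotp (0 - x) (0 - x) <= rho ^+ 2 by rewrite sub0r dotpNl dotpNr opprK -enorm_sqr.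
apply: (le_trans (@riesz_sub_le _ _ _ s_gt0 c 1 u 1 _ _ j _ _ _ _ _ _ _ _)) => //.
- lra.
- exact: ltW.
- by rewrite expr1n; have := dotp_ge0 (0 - y); lra.
- by have := dotp_ge0 (x - y); lra.
- apply: weight_comparable => //; rewrite /c; lra.
- apply: weight_comparable => //.
  have -> : c * u = 2 * u + (2 * rho ^+ 2 + 1) + (2 * rho ^+ 2 + u) * u.
    by rewrite /c; field; rewrite gt_eqF.
  have h1 : 0 <= 2 * u by lra.
  have h2 : 0 <= (2 * rho ^+ 2 + u) * u by rewrite mulr_ge0 ?(ltW u0)//; lra.
  lra.
apply: ler_wpM2r; first exact: ker_ge0.
apply: ler_wpM2l => //; rewrite lerD2r.
rewrite (_ : x - y - (0 - y) = x); last by rewrite sub0r opprK subrK.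
by rewrite (le_trans xr)// ler_norm.
Qed.

Lemma tker_dominated_unif delta (rho : R) j : 0 < delta -> exists2 C : R, 0 <= C &
  forall x y : 'rV[R]_d, enorm x <= rho ->
  `|(x - y) ord0 j * tker s delta (x - y) + y ord0 j * ker s 1 y| <= C * ker s 1 y.
Proof.
move=> d0; have d20 : 0 < delta ^+ 2 by exact: exprn_gt0.
have [C C0 hC] := riesz_dominated_unif rho j d20.
have [B B0 hB] := ker_dominated_unif rho d20.
set A := (2 `^ ((s + 1) / 2) + (s + 1) / 2 * 2 `^ ((s + 1) / 2 + 1)) * delta.
have A0 : 0 <= A by have a0 := exponent_ge0 s_gt0; rewrite /A; nonneg.
exists (A * B + C); first by nonneg.
move=> x y xr.
rewrite [X in `|X|](_ : _ = (x - y) ord0 j * (tker s delta (x - y) - ker s (delta ^+ 2) (x - y)) +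
   ((x - y) ord0 j * ker s (delta ^+ 2) (x - y) + y ord0 j * ker s 1 y)); last by ring.
apply: (le_trans (ler_normD _ _)); rewrite mulrDl lerD ?hC//.
apply: (le_trans (tker_sub_ker s_gt0 _ _ d0)); rewrite -/A -mulrA.
by apply: ler_wpM2l => //; exact: hB.
Qed.

End Dominated.

(** * Fubini for localized double integrals, and antisymmetrization *)

Section Fubini.
Context {R : realType} {d : nat}.
Local Notation Rd := (@Rdm R d).
Variable mu : {sigma_finite_measure set Rd -> \bar R}.
Implicit Types (f : Rd -> Rd -> R) (g : Rd -> R).

Local Notation Int f := (\int[mu]_y f y).

(** Only a uniform L^1 bound for f x with x in B is available. Outside B the second identity holds
    because g x = 0 kills both sides, whether or not f x is integrable. *)
Lemma localized_integrable f g (B : set Rd) (G0 Q : R) :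
  measurable_fun setT (fun p : Rd * Rd => f p.1 p.2) -> measurable_fun setT g ->
  measurable B -> (mu B < +oo)%E -> 0 <= G0 -> 0 <= Q ->
  (forall x, `|g x| <= G0) -> (forall x, ~ B x -> g x = 0) ->
  (forall x, B x -> (\int[mu]_y `|f x y|%:E <= Q%:E)%E) ->
  (mu \x mu)%E.-integrable setT (EFin \o (fun p : Rd * Rd => g p.1 * f p.1 p.2)) /\
  (forall x, \int[mu]_y (g x * f x y)%:E = (g x * Int (f x))%:E)%E.
Proof.
move=> mf mg mB Boo G00 Q0 gG gB fQ.
have mfx x : measurable_fun setT (f x).
  exact: (measurableT_comp mf (pair1_measurable x)).
have mF : measurable_fun setT (EFin \o (fun p : Rd * Rd => g p.1 * f p.1 p.2)).
  apply/measurable_EFinP; apply: measurable_funM => //.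
  by apply: (measurableT_comp mg); exact: measurable_fst.
have fint x : B x -> mu.-integrable setT (EFin \o f x).
  move=> Bx; apply/integrableP; split; first exact/measurable_EFinP.
  by apply: le_lt_trans (fQ x Bx) _; rewrite ltry.
split; last first.
  move=> x; have [Bx|/gB gx0] := pselect (B x); last first.
    rewrite gx0 mul0r; under eq_integral do rewrite mul0r.
    by rewrite integral0.
  under eq_integral do rewrite EFinM.
  rewrite integralZl//; last exact: fint.
  by rewrite EFinM /Rintegral fineK//; apply: integrable_fin_num => //; exact: fint.
apply/integrable12ltyP => //.
apply: (@le_lt_trans _ _ (\int[mu]_x ((G0 * Q)%:E * (\1_B x)%:E)%E)%E).
  apply: ge0_le_integral => //=.
  - by move=> x _; apply: integral_ge0.
  - have := @measurable_fun_fubini_tonelli_F _ _ _ _ R mu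
      (fun p => `|(g p.1 * f p.1 p.2)%:E|)%E.
    by apply => //; exact: measurableT_comp.
  - apply/measurable_EFinP; apply: measurable_funM => //; exact: measurable_indic.
  move=> x _; have [Bx|nBx] := pselect (B x); last first.
    rewrite gB// integral0_eq ?mule_ge0 ?lee_fin ?mulr_ge0//.
    by move=> y _; rewrite mul0r normr0.
  rewrite indicE mem_set// mule1 EFinM.
  under eq_integral do rewrite normrM EFinM.
  rewrite ge0_integralZl//=; last first.
    by apply/measurable_EFinP; exact: measurableT_comp.
  by apply: lee_pmul => //; [exact: integral_ge0|rewrite lee_fin|exact: fQ].
rewrite ge0_integralZl ?lee_fin ?mulr_ge0//; last first.
  by apply/measurable_EFinP; exact: measurable_indic.
by rewrite integral_indic// setIT lte_mul_pinfty// lee_fin mulr_ge0.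
Qed.

Lemma localized_integral f g (B : set Rd) (G0 Q : R) :
  measurable_fun setT (fun p : Rd * Rd => f p.1 p.2) -> measurable_fun setT g ->
  measurable B -> (mu B < +oo)%E -> 0 <= G0 -> 0 <= Q ->
  (forall x, `|g x| <= G0) -> (forall x, ~ B x -> g x = 0) ->
  (forall x, B x -> (\int[mu]_y `|f x y|%:E <= Q%:E)%E) ->
  mu.-integrable setT (EFin \o (fun x => g x * Int (f x))).
Proof.
move=> mf mg mB Boo G00 Q0 gG gB fQ.
have [h e] := localized_integrable mf mg mB Boo G00 Q0 gG gB fQ.
have := integrable_fubini_F h; apply: eq_integrable => // x _.
by rewrite /fubini_F /= e.
Qed.

(* An odd kernel only sees the differences [g x - g y]. *)
Lemma odd_kernel_bound (kappa : 'rV[R]_d -> R) g (B : set Rd) (Q0 Q : R) :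
  measurable_fun setT (fun p : Rd * Rd => kappa ((p.1 : 'rV[R]_d) - p.2)) ->
  (forall v, kappa (- v) = - kappa v) ->
  measurable_fun setT g -> measurable B -> (mu B < +oo)%E -> 0 <= Q0 -> 0 <= Q ->
  (forall x, 0 <= g x <= 1) -> (forall x, ~ B x -> g x = 0) ->
  (forall x, (\int[mu]_y `|kappa ((x : 'rV[R]_d) - y)|%:E <= Q0%:E)%E) ->
  (forall x, B x -> (\int[mu]_y (`|kappa ((x : 'rV[R]_d) - y)| * `|g x - g y|)%:E <= Q%:E)%E) ->
  `|Int (fun x => g x * Int (fun y => kappa ((x : 'rV[R]_d) - y)))| <= Q * fine (mu B).
Proof.
move=> mk ok mg mB Boo Q00 Qge0 g01 gB kQ0 kQ.
have gG x : `|g x| <= 1 by have /andP[g0 g1] := g01 x; rewrite ger0_norm.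
pose f x y := kappa ((x : 'rV[R]_d) - (y : 'rV[R]_d)).
have [iF eF] := localized_integrable mk mg mB Boo ler01 Q00 gG gB (fun x _ => kQ0 x).
set F := (X in _.-integrable _ (EFin \o X)) in iF.
have mswap : measurable_fun [set: Rd * Rd] (fun p => (p.2, p.1)).
  by apply: measurable_fun_pair; [exact: measurable_snd|exact: measurable_fst].
(* F2 is F with the variables exchanged; both have integral I, so the integral of F + F2 is 2 I. *)
pose F2 (p : Rd * Rd) := g p.2 * kappa ((p.2 : 'rV[R]_d) - p.1).
have mF : measurable_fun setT F by move/measurable_int : iF => /measurable_EFinP.
have mF2 : measurable_fun setT F2 by exact: (measurableT_comp mF mswap).
have iF2 : (mu \x mu)%E.-integrable setT (EFin \o F2).
  apply/integrable21ltyP; first exact/measurable_EFinP.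
  by move/integrable12ltyP : iF; apply; exact/measurable_EFinP.
have e1 : (\int[(mu \x mu)%E]_p (F p)%:E = \int[mu]_x (g x * Int (fun y => kappa ((x : 'rV[R]_d) - y)))%:E)%E.
  rewrite -(integral12_prod_meas1 iF); apply: eq_integral => x _.
  by rewrite /fubini_F -eF.
have e2 : (\int[(mu \x mu)%E]_p (F2 p)%:E = \int[(mu \x mu)%E]_p (F p)%:E)%E.
  by rewrite -(integral21_prod_meas1 iF2) -(integral12_prod_meas1 iF).
set I := (X in `|X| <= _).
have eI : (I%:E = \int[(mu \x mu)%E]_p (F p)%:E)%E.
  by rewrite /I /Rintegral -e1 fineK//; exact: integrable_fin_num iF.
have e3 : ((I + I)%:E = \int[(mu \x mu)%E]_p (F p + F2 p)%:E)%E.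
  under eq_integral do rewrite EFinD.
  by rewrite integralD//= -e2 in eI *; rewrite EFinD eI e2.
pose H (p : Rd * Rd) := `|kappa ((p.1 : 'rV[R]_d) - p.2)| * `|g p.1 - g p.2|.
have mH : measurable_fun setT H.
  apply: measurable_funM; first exact: measurableT_comp.
  apply: measurableT_comp => //; apply: measurable_funB.
    by apply: (measurableT_comp mg); exact: measurable_fst.
  by apply: (measurableT_comp mg); exact: measurable_snd.
have H0 p : 0 <= H p by rewrite mulr_ge0.
pose H1 (p : Rd * Rd) := \1_B p.1 * H p.
pose H2 (p : Rd * Rd) := \1_B p.2 * H p.
have m1 : measurable_fun setT H1.
  apply: measurable_funM => //.
  by apply: (measurableT_comp (measurable_indic mB)); exact: measurable_fst.
have m2 : measurable_fun setT H2.
  apply: measurable_funM => //.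
  by apply: (measurableT_comp (measurable_indic mB)); exact: measurable_snd.
have H10 p : 0 <= H1 p by rewrite mulr_ge0.
have H20 p : 0 <= H2 p by rewrite mulr_ge0.
(* Oddness turns F + F2 into kappa (x - y) (g x - g y), which vanishes when both points are outside
   B. H1 and H2 cover x in B and y in B, and have equal integrals by symmetry. *)
have FH p : `|F p + F2 p| <= H1 p + H2 p.
  have -> : F p + F2 p = kappa ((p.1 : 'rV[R]_d) - p.2) * (g p.1 - g p.2).
    by rewrite /F /F2 -(opprB p.1 p.2) ok; ring.
  rewrite normrM -/(H p) /H1 /H2 -mulrDl.
  have [B1|/gB g1] := pselect (B p.1).
    by rewrite {1}indicE mem_set// ler_peMl// lerDl.
  have [B2|/gB g2] := pselect (B p.2).
    by rewrite [X in _ + X]indicE mem_set// ler_peMl// lerDr.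
  by rewrite /H g1 g2 subrr normr0 !mulr0.
have fub (h : Rd * Rd -> R) : measurable_fun setT h -> (forall p, 0 <= h p) ->
   (\int[(mu \x mu)%E]_p (h p)%:E = \int[mu]_x \int[mu]_y (h (x, y))%:E)%E.
  move=> mh h0; rewrite (@fubini_tonelli1 _ _ _ _ R mu mu (EFin \o h))//.
  exact/measurable_EFinP.
have H1Q : (\int[(mu \x mu)%E]_p (H1 p)%:E <= (Q * fine (mu B))%:E)%E.
  rewrite fub//; apply: (@le_trans _ _ (\int[mu]_x (Q%:E * (\1_B x)%:E)%E)%E).
    apply: ge0_le_integral => //=.
    - by move=> x _; apply: integral_ge0 => y _; rewrite lee_fin.
    - have := @measurable_fun_fubini_tonelli_F _ _ _ _ R mu (EFin \o H1).
      by apply => //; exact/measurable_EFinP.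
    - apply/measurable_EFinP; apply: measurable_funM => //; exact: measurable_indic.
    move=> x _; have [Bx|nBx] := pselect (B x); last first.
      rewrite integral0_eq ?mule_ge0 ?lee_fin//.
      by move=> y _; rewrite /H1/= indicE memNset// mul0r.
    rewrite indicE mem_set// mule1; apply: le_trans (kQ x Bx).
    rewrite le_eqVlt; apply/orP; left; apply/eqP; apply: eq_integral => y _.
    by rewrite /H1 /= indicE mem_set// mul1r.
  rewrite ge0_integralZl ?lee_fin//; last first.
    by apply/measurable_EFinP; exact: measurable_indic.
  rewrite integral_indic// setIT EFinM fineK//.
  by rewrite ge0_fin_numE.
have H2Q : (\int[(mu \x mu)%E]_p (H2 p)%:E <= (Q * fine (mu B))%:E)%E.
  apply: le_trans H1Q.
  rewrite (@fubini_tonelli2 _ _ _ _ R mu mu (EFin \o H2))//; last exact/measurable_EFinP.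
  rewrite (fub _ m1 H10) le_eqVlt; apply/orP; left; apply/eqP; apply: eq_integral => x _.
  apply: eq_integral => y _; rewrite /= /H2 /H1 /H /=.
  by rewrite -(opprB x y) ok normrN (distrC (g y)).
have : (`|(I + I)%:E| <= ((Q * fine (mu B)) + (Q * fine (mu B)))%:E)%E.
  rewrite e3; apply: (le_trans (le_abse_integral _ _ _)) => //.
    by apply/measurable_EFinP; exact: measurable_funD.
  apply: (@le_trans _ _ (\int[(mu \x mu)%E]_p ((H1 p)%:E + (H2 p)%:E))%E).
    apply: ge0_le_integral => //=.
    - by apply/measurable_EFinP; apply: measurableT_comp => //; exact: measurable_funD.
    - by apply/measurable_EFinP; exact: measurable_funD.
    - by move=> p _; rewrite lee_fin.
  rewrite ge0_integralD//; last 4 first.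
  - by move=> p _; rewrite lee_fin.
  - exact/measurable_EFinP.
  - by move=> p _; rewrite lee_fin.
  - exact/measurable_EFinP.
  by rewrite EFinD leeD.
rewrite /= lee_fin -!mulr2n normrMn lerMn2r.
by [].
Qed.

End Fubini.

Section Packaging.
Context {R : realType} {d : nat}.
Local Notation Rd := (@Rdm R d).

Lemma locally_finite_sigma_finite (mu : {measure set Rd -> \bar R}) :
  locally_finite mu -> sigma_finite setT mu.
Proof.
move=> lf; exists (fun n => eball 0 n%:R).
  apply/seteqP; split => // x _; exists (Num.bound (enorm x)) => //.
  by rewrite /eball/= subr0 archi_boundP.
by move=> n; split; [exact: measurable_eball|exact: lf].
Qed.

(** An alias of mu on which the sigma-finite structure can be declared from the proof of local
    finiteness; product measures need that structure. *)
Definition sigma_finite_copy (mu : {measure set Rd -> \bar R}) of locally_finite mu :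
  set Rd -> \bar R := mu.

Variables (mu : {measure set Rd -> \bar R}) (mu_lf : locally_finite mu).

HB.instance Definition _ := Measure.copy (sigma_finite_copy mu_lf) mu.

HB.instance Definition _ := Measure_isSigmaFinite.Build _ _ _
  (sigma_finite_copy mu_lf) (locally_finite_sigma_finite mu_lf).

Lemma sigma_finite_copyE :
  (sigma_finite_copy mu_lf : {sigma_finite_measure set Rd -> \bar R}) = mu :> {measure set Rd -> \bar R}.
Proof. exact: eq_measure. Qed.

End Packaging.

(** * Tent functions *)

Section Tent.
Context {R : realType} {d : nat}.
Local Notation Rd := (@Rdm R d).
Implicit Types (x y : 'rV[R]_d) (r : R).

Definition tent y r (x : 'rV[R]_d) : R := Num.max 0 (1 - enorm (x - y) / r).

Lemma tent_ge0 y r x : 0 <= tent y r x.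
Proof. by rewrite le_max lexx. Qed.

Lemma tent_le1 y r x : 0 < r -> tent y r x <= 1.
Proof. by move=> r0; rewrite ge_max ler01/= gerBl divr_ge0// ltW. Qed.

Lemma tent_out y r x : 0 < r -> ~ eball y r x -> tent y r x = 0.
Proof.
move=> r0 /negP; rewrite /eball/= -leNgt => h.
by apply/max_idPl; rewrite subr_le0 ler_pdivlMr// mul1r.
Qed.

Lemma tent_half y r x : 0 < r -> eball y (r / 2) x -> 1 / 2 <= tent y r x.
Proof.
rewrite /eball/= => r0 h; rewrite le_max; apply/orP; right.
have : enorm (x - y) / r <= 1 / 2 by rewrite ler_pdivrMr//; lra.
lra.
Qed.

Lemma tent_lip y r x x' : 0 < r -> `|tent y r x - tent y r x'| <= r^-1 * enorm (x - x').
Proof.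
move=> r0.
have h : `|(1 - enorm (x - y) / r) - (1 - enorm (x' - y) / r)| <= r^-1 * enorm (x - x').
  rewrite (_ : _ - _ = (enorm (x' - y) - enorm (x - y)) * r^-1); last by ring.
  rewrite normrM (ger0_norm (_ : 0 <= r^-1)) ?invr_ge0 ?(ltW r0)// mulrC.
  apply: ler_wpM2l; first by rewrite invr_ge0 ltW.
  by rewrite (le_trans (enorm_lip _ _))// opprB addrA subrK enormB.
apply: le_trans h; rewrite /tent.
set a := 1 - _; set b := 1 - _.
case: (leP 0 a) => ha; case: (leP 0 b) => hb //.
- by rewrite subr0 ger0_norm// ger0_norm; lra.
- by rewrite sub0r normrN ger0_norm// ler0_norm; lra.
- by rewrite subrr normr0.
Qed.

Lemma tent_osc y r x x' : 0 < r -> `|tent y r x - tent y r x'| <= 1.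
Proof.
move=> r0; have := tent_ge0 y r x; have := tent_ge0 y r x'.
by have := tent_le1 y x r0; have := tent_le1 y x' r0; rewrite ler_norml; lra.
Qed.

Lemma measurable_tent y r : 0 < r -> measurable_fun [set: Rd] (tent y r : Rd -> R).
Proof.
move=> r0; apply: continuous_measurable; apply: (@lipschitz_enorm_continuous _ _ _ r^-1).
by move=> x x'; exact: tent_lip.
Qed.

End Tent.

(** The limit is the supremum of the lower approximations Z a - C a, each of which lies below every
    Z b + C b; this keeps the explicit rate C a. *)
Lemma approximate_limit {R : realType} (Z : R -> R) (C : R) : 0 <= C ->
  (forall a b, 0 < a -> 0 < b -> `|Z a - Z b| <= C * Num.max a b) ->
  exists N, forall a, 0 < a -> `|Z a - N| <= C * a.
Proof.
move=> C0 ZC.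
have hab a b : 0 < a -> 0 < b -> Z a - C * a <= Z b + C * b.
  move=> a0 b0; have := ZC a b a0 b0.
  have h : C * Num.max a b <= C * a + C * b.
    by rewrite -mulrDr ler_wpM2l// ge_max; apply/andP; split; lra.
  rewrite ler_norml => /andP[_]; lra.
pose A := [set Z a - C * a | a in [set a | 0 < a]].
have hA : has_sup A.
  split; first by exists (Z 1 - C * 1); exists 1 => //=.
  by exists (Z 1 + C * 1) => _ [a /= a0 <-]; exact: hab.
exists (sup A) => a a0; rewrite ler_distl; apply/andP; split.
  by rewrite lerBlDr; apply: ge_sup => [|_ [b /= b0 <-]]; [case: hA|];  rewrite // hab.
have : Z a - C * a <= sup A by apply: sup_upper_bound => //; exists a.
lra.
Qed.

(** * Fields of odd kernels, renormalized at infinity *)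

Section KernelFields.
Context {R : realType} {d : nat}.
Local Notation Rd := (@Rdm R d).
Variable mu : {sigma_finite_measure set Rd -> \bar R}.
Variables (s Lam : R).
Hypothesis mu_nice : nice s Lam mu.
Hypothesis s_gt0 : 0 < s.
Hypothesis Lam_ge0 : 0 <= Lam.
Implicit Types (k : 'rV[R]_d -> R) (g : Rd -> R) (j : 'I_d).

Local Notation Int f := (\int[mu]_y f y).
Local Notation dominated := (@dominated R d s setT).

(** The kernel (x - y)_j w^-a is only O(|y|^-s) at infinity, which a nice measure need not
    integrate. Adding this term, independent of x, leaves O(|y|^(-s-1)). *)
Definition offset j (y : 'rV[R]_d) : R := y ord0 j * ker s 1 y.

(** A common frame for smoothed and truncated kernels: both need the same offset, so their fields
    can be subtracted. *)
Definition admissible_kernel j k :=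
  [/\ measurable_fun setT (fun p : Rd * Rd => k ((p.1 : 'rV[R]_d) - p.2)),
      (forall v, k (- v) = - k v) &
      forall rho : R, exists2 C : R, 0 <= C & forall x y : 'rV[R]_d, enorm x <= rho ->
        `|k (x - y) + offset j y| <= C * ker s 1 y].

Definition kernel_field k j (x : Rd) : R :=
  Int (fun y => k ((x : 'rV[R]_d) - y) + offset j y).

Lemma measurable_sub_coord i :
  measurable_fun [set: Rd * Rd] (fun p : Rd * Rd => ((p.1 : 'rV[R]_d) - p.2) ord0 i).
Proof.
under eq_fun do rewrite !mxE.
apply: measurable_funB.
  by apply: (measurableT_comp (measurable_coord i)); exact: measurable_fst.
by apply: (measurableT_comp (measurable_coord i)); exact: measurable_snd.
Qed.

Lemma measurable_offset j : measurable_fun [set: Rd] (offset j : Rd -> R).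
Proof. by apply: measurable_funM; [exact: measurable_coord|exact: measurable_ker1]. Qed.

Lemma admissible_ker j u : 0 < u -> admissible_kernel j (fun v => v ord0 j * ker s u v).
Proof.
move=> u0; split.
- apply: measurable_funM; first exact: measurable_sub_coord.
  by apply: measurable_ker => i; exact: measurable_sub_coord.
- by move=> v; rewrite mxE mulNr /ker dotpNl dotpNr opprK.
- by move=> rho; exact: riesz_dominated_unif.
Qed.

Lemma admissible_tker j delta : 0 < delta -> admissible_kernel j (fun v => v ord0 j * tker s delta v).
Proof.
move=> u0; split.
- apply: measurable_funM; first exact: measurable_sub_coord.
  by apply: measurable_tker => i; exact: measurable_sub_coord.
- by move=> v; rewrite mxE mulNr /tker enormN.
- by move=> rho; exact: tker_dominated_unif.
Qed.

Let Q1 : R := 2 `^ (s + 2) * Lam.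

Lemma Q1_ge0 : 0 <= Q1.
Proof. by rewrite mulr_ge0 ?powR_ge0. Qed.

Lemma ker1_le x : (\int[mu]_y (ker s 1 ((x : 'rV[R]_d) - y))%:E <= Q1%:E)%E.
Proof. by have := ker_integral_le mu_nice s_gt0 x ltr01; rewrite expr1n divr1. Qed.

Lemma ker1_le0 : (\int[mu]_y (ker s 1 (y : 'rV[R]_d))%:E <= Q1%:E)%E.
Proof.
apply: le_trans (ker1_le 0); rewrite le_eqVlt; apply/orP; left; apply/eqP.
by apply: eq_integral => y _; rewrite /ker sub0r dotpNl dotpNr opprK.
Qed.

Lemma abs_integral_le (f : Rd -> R) (C : R) : measurable_fun setT f -> 0 <= C ->
  (forall y, `|f y| <= C * ker s 1 (y : 'rV[R]_d)) ->
  (\int[mu]_y `|f y|%:E <= (C * Q1)%:E)%E.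
Proof.
move=> mf C0 fC.
have mk := @measurable_ker1 R d s.
apply: (@le_trans _ _ (\int[mu]_y (C%:E * (ker s 1 (y : 'rV[R]_d))%:E))%E).
  apply: ge0_le_integral => //.
  - by apply/measurable_EFinP; exact: measurableT_comp.
  - by apply/measurable_EFinP; exact: measurable_funM.
  - by move=> y _; rewrite lee_fin.
rewrite ge0_integralZl//; last 2 first.
- exact/measurable_EFinP.
- by move=> y _; rewrite lee_fin ker_ge0.
by rewrite EFinM; apply: lee_wpmul2l => //; exact: ker1_le0.
Qed.

Lemma eball_fin (c : 'rV[R]_d) (r : R) : 0 < r -> (mu (eball c r) < +oo)%E.
Proof. by move=> r0; apply: le_lt_trans (mu_nice c r0) _; rewrite ltry. Qed.

Lemma localized_field (f : Rd -> Rd -> R) g (c : 'rV[R]_d) (r G0 : R) : 0 < r ->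
  measurable_fun setT (fun p : Rd * Rd => f p.1 p.2) ->
  (exists2 C : R, 0 <= C & forall x y : 'rV[R]_d, enorm (x - c) <= r -> `|f x y| <= C * ker s 1 y) ->
  measurable_fun setT g -> 0 <= G0 -> (forall x, `|g x| <= G0) ->
  (forall x, ~ eball c r x -> g x = 0) ->
  mu.-integrable setT (EFin \o (fun x => g x * Int (f x))).
Proof.
move=> r0 mf [C C0 fC] mg G00 gG gB.
have mfx x : measurable_fun setT (f x) by exact: (measurableT_comp mf (pair1_measurable x)).
apply: (@localized_integral _ _ _ _ _ (eball c r) G0 (C * Q1)) => //.
- exact: measurable_eball.
- exact: eball_fin.
- by rewrite mulr_ge0 ?Q1_ge0.
by move=> x Bx; apply: abs_integral_le => // y; apply: fC; exact: ltW.
Qed.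

Lemma admissible_dominated j k x : admissible_kernel j k ->
  dominated (fun y : Rd => k (x - (y : 'rV[R]_d)) + offset j y).
Proof.
move=> [mk _ kC]; split.
  apply: measurable_funD; last exact: measurable_offset.
  exact: (measurableT_comp mk (pair1_measurable (x : Rd))).
by have [C C0 h] := kC (enorm x); exists C => // y _; exact: h.
Qed.

Lemma kernel_field_integrable j k g (c : 'rV[R]_d) (r G0 : R) : admissible_kernel j k -> 0 < r ->
  measurable_fun setT g -> 0 <= G0 -> (forall x, `|g x| <= G0) ->
  (forall x, ~ eball c r x -> g x = 0) ->
  mu.-integrable setT (EFin \o (fun x => g x * kernel_field k j x)).
Proof.
move=> [mk _ kC] r0 mg G00 gG gB.
apply: (localized_field (c := c) (r := r) (G0 := G0) (f := fun x y => k ((x : 'rV[R]_d) - y) + offset j y)) => //.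
  apply: measurable_funD => //.
  by apply: (measurableT_comp (measurable_offset j)); exact: measurable_snd.
have [C C0 h] := kC (r + enorm c); exists C => // x y xc; apply: h.
have := enorm_dist x c 0; rewrite !subr0; lra.
Qed.

(** In the difference of the two fields the offsets cancel, and k1 - k2 is odd, so only the
    oscillation of the tent enters. *)
Lemma kernel_field_diff j k1 k2 (c : 'rV[R]_d) (r Q : R) :
  admissible_kernel j k1 -> admissible_kernel j k2 -> 0 < r -> 0 <= Q ->
  (forall x, eball c r x -> (\int[mu]_y (`|k1 ((x : 'rV[R]_d) - y) - k2 (x - y)| *
      `|tent c r x - tent c r y|)%:E <= Q%:E)%E) ->
  `|Int (fun x => tent c r x * kernel_field k1 j x) - Int (fun x => tent c r x * kernel_field k2 j x)|
    <= Q * fine (mu (eball c r)).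
Proof.
move=> a1 a2 r0 Q0 kQ.
have [m1 o1 C1] := a1; have [m2 o2 C2] := a2.
have mt := @measurable_tent R d c r r0.
have t1 x : `|tent c r x| <= 1 by rewrite ger0_norm ?tent_ge0 ?tent_le1.
have tout (x : Rd) : ~ eball c r x -> tent c r x = 0 by exact: tent_out.
have i1 := kernel_field_integrable a1 r0 mt ler01 t1 tout.
have i2 := kernel_field_integrable a2 r0 mt ler01 t1 tout.
rewrite -RintegralB//.
pose kappa v := k1 v - k2 v.
rewrite [X in `|X|](_ : _ = Int (fun x => tent c r x * Int (fun y => kappa ((x : 'rV[R]_d) - y)))); last first.
  apply: eq_Rintegral => x _; rewrite -mulrBr; congr (_ * _); rewrite /kernel_field.
  rewrite -(IntB mu_nice s_gt0 measurableT); [|exact: admissible_dominated..].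
  by apply: eq_Rintegral => y _; rewrite /kappa; ring.
(* At x = 0 and y = - v the two offsets agree, which bounds kappa by a multiple of [ker s 1]; its
   integrals are then bounded uniformly in x. *)
have [A A0 hA] := C1 0; have [B B0 hB] := C2 0.
have kAB v : `|kappa v| <= (A + B) * ker s 1 v.
  have := hA 0 (- v); have := hB 0 (- v); rewrite enorm0 lexx sub0r opprK => /(_ isT) h2 /(_ isT) h1.
  rewrite /kappa (_ : _ - _ = (k1 v + offset j (- v)) - (k2 v + offset j (- v))); last by ring.
  apply: (le_trans (ler_normB _ _)); rewrite mulrDl.
  rewrite {1 2}/ker dotpNl dotpNr opprK in h1 h2.
  by apply: lerD.
have mkappa : measurable_fun setT (fun p : Rd * Rd => kappa ((p.1 : 'rV[R]_d) - p.2)).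
  exact: measurable_funB.
have AB0 : 0 <= A + B by rewrite addr_ge0.
apply: (odd_kernel_bound (Q0 := (A + B) * Q1)) => //.
- by move=> v; rewrite /kappa o1 o2; ring.
- exact: measurable_eball.
- exact: eball_fin.
- by rewrite mulr_ge0 ?Q1_ge0.
- by move=> x; rewrite tent_ge0 tent_le1.
move=> x; have mkx : measurable_fun setT (fun y : Rd => kappa (x - (y : 'rV[R]_d))).
  exact: (measurableT_comp mkappa (pair1_measurable (x : Rd))).
have mker : measurable_fun setT (fun y : Rd => ker s 1 (x - (y : 'rV[R]_d))).
  by apply: measurable_ker => i; exact: measurable_coordB.
apply: (@le_trans _ _ (\int[mu]_y ((A + B)%:E * (ker s 1 (x - (y : 'rV[R]_d)))%:E))%E).
  apply: ge0_le_integral => //.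
  - by apply/measurable_EFinP; exact: measurableT_comp.
  - by apply/measurable_EFinP; exact: measurable_funM.
  - by move=> y _; rewrite lee_fin.
rewrite ge0_integralZl//; last 2 first.
- exact/measurable_EFinP.
- by move=> y _; rewrite lee_fin ker_ge0.
by rewrite EFinM; apply: lee_wpmul2l => //; exact: ker1_le.
Qed.

End KernelFields.

(** * Force balance *)

Section ForceBalance.
Context {R : realType} {d : nat}.
Local Notation Rd := (@Rdm R d).
Variable mu : {sigma_finite_measure set Rd -> \bar R}.
Variables (s Lam : R).
Hypothesis mu_nice : nice s Lam mu.
Hypothesis s_gt0 : 0 < s.
Hypothesis Lam_ge0 : 0 <= Lam.

Local Notation Int f := (\int[mu]_y f y).

Definition tfield delta j := kernel_field mu s (fun v : 'rV[R]_d => v ord0 j * tker s delta v) j.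
Definition rfield u j := kernel_field mu s (fun v : 'rV[R]_d => v ord0 j * ker s u v) j.

(** Truncations at a and b agree beyond max(a, b). Below, their difference is at most |v|^-s and the
    tent contributes |v| / r, so the interaction is O(max(a, b)). *)
Lemma tfield_cauchy j c r : 0 < r -> exists2 C : R, 0 <= C & forall a b : R, 0 < a -> 0 < b ->
  `|Int (fun x => tent c r x * tfield a j x) - Int (fun x => tent c r x * tfield b j x)| <= C * Num.max a b.
Proof.
move=> r0; have ri0 : 0 <= r^-1 by rewrite invr_ge0 ltW.
exists (r^-1 * (2 `^ (s + 1) * Lam) * fine (mu (eball c r))).
  by rewrite !mulr_ge0 ?powR_ge0 ?fine_ge0.
move=> a b a0 b0; set m := Num.max a b.
have m0 : 0 < m by rewrite lt_max a0.
rewrite (_ : _ * m = r^-1 * (2 `^ (s + 1) * Lam * m) * fine (mu (eball c r))); last by ring.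
apply: (kernel_field_diff mu_nice) => //; try exact: admissible_tker.
  by rewrite !mulr_ge0 ?powR_ge0// ltW.
move=> x _; apply: (near_integral_le mu_nice s_gt0 (x := x)) => //.
- apply: measurable_funM.
    apply: measurableT_comp => //; apply: measurable_funB; apply: measurable_funM.
    + exact: measurable_coordB.
    + by apply: measurable_tker => i; exact: measurable_coordB.
    + exact: measurable_coordB.
    + by apply: measurable_tker => i; exact: measurable_coordB.
  by apply: measurableT_comp => //; apply: measurable_funB => //; exact: measurable_tent.
- move=> y h; rewrite enormB; set v : 'rV[R]_d := x - y in h *.
  have [k1 k2] := tker_sub_tker s_gt0 a b v j.
  rewrite -mulrBr in h; split.
    rewrite lt_neqAle enorm_ge0 andbT eq_sym enorm_eq0; apply/andP; split.
      by apply: contraNneq h => ->; rewrite mxE mul0r normr0 mul0r.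
    by rewrite ltNge; apply: contraNN h => /k2 ->; rewrite normr0 mul0r.
  rewrite -mulrBr mulrC mulrA; apply: ler_pM => //; exact: tent_lip.
Qed.

Lemma tfield_limit j c r : 0 < r -> exists N C : R, forall a : R, 0 < a ->
  `|Int (fun x => tent c r x * tfield a j x) - N| <= C * a.
Proof.
move=> r0; have [C C0 hC] := tfield_cauchy j c r0.
by have [N hN] := approximate_limit C0 hC; exists N, C.
Qed.

(** The pairing is evaluated for the choices B = B(0, r), z = 0 and phi the indicator of 2B. For g
    of mean zero the terms that do not depend on x disappear, so the pairing is the limit of the
    renormalized truncated ones. *)
Lemma pairT1_tfield j (g : Rd -> R) (r G0 : R) (N : R) : 0 < r ->
  measurable_fun setT g -> 0 <= G0 -> (forall x, `|g x| <= G0) ->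
  (forall x, ~ eball 0 r x -> g x = 0) -> Int g = 0 ->
  (fun delta => Int (fun x => g x * tfield delta j x)) @ 0^'+ --> N ->
  pairT1 s mu (\1_(eball 0 (2 * r)) : Rd -> R) 0 (fun x => g x *: delta_mx ord0 j) = N.
Proof.
move=> r0 mg G00 gG gB g0 ZN.
have r0' := ltW r0.
set phi : Rd -> R := \1_(eball 0 (2 * r)).
have mphi : measurable_fun setT phi by exact: measurable_indic (measurable_eball _ _).
have phi01 y : `|phi y| <= 1.
  by rewrite /phi indicE; case: (_ \in _); rewrite ?normr0 ?normr1.
have phi01' y : `|1 - phi y| <= 1.
  by rewrite /phi indicE; case: (_ \in _); rewrite ?subrr ?normr0 ?subr0 ?normr1.
have gint : mu.-integrable setT (EFin \o g).
  have h : mu.-integrable setT (EFin \o (\1_(eball 0 r) : Rd -> R)).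
    have mB := @measurable_eball R d 0 r.
    apply/integrableP; split; first by apply/measurable_EFinP; exact: measurable_indic.
    rewrite (_ : integral _ _ _ = mu (eball 0 r)); first exact: (eball_fin mu_nice).
    have := integral_indic mu measurableT mB; rewrite setIT => <-.
    by apply: eq_integral => x _ /=; rewrite ger0_norm.
  apply: le_integrable (integrableZl measurableT G0 h) => //; first exact/measurable_EFinP.
  move=> x _ /=; rewrite lee_fin indicE; have [Bx|nBx] := pselect (eball 0 r x).
    by rewrite mem_set// mulr1 (ger0_norm G00).
  by rewrite memNset// mulr0 gB.
have algA (p a o : R) : p * a = p * (a + o) - p * o by ring.
have algB (p a b o : R) : p * (a - b) = p * (a + o) - p * (b + o) by ring.
have algD (a b o : R) : a - b = (a + o) - (b + o) by ring.
have algC (p a b o : R) : (a + o) - ((1 - p) * (b + o) + p * o) = p * a + (1 - p) * (a - b) by ring.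
pose k delta (v : 'rV[R]_d) := v ord0 j * tker s delta v.
(* fA is the kernel of the pairing with phi, fB that of the correction term, both truncated at
   delta. *)
pose fA delta (x y : Rd) := phi y * k delta ((x : 'rV[R]_d) - y).
pose fB delta (x y : Rd) := (1 - phi y) * (k delta ((x : 'rV[R]_d) - y) - k delta (0 - (y : 'rV[R]_d))).
pose sec := Int (fun x : Rd => dotp (g x *: delta_mx ord0 j) (vint mu (fun y : Rd => (1 - phi y) *:
         (Kr s ((x : 'rV[R]_d) - y) - Kr s (0 - (y : 'rV[R]_d)))))).
have eA delta : pairTd s mu delta phi (fun x => g x *: delta_mx ord0 j) =
    Int (fun x => g x * Int (fA delta x)).
  apply: eq_Rintegral => x _; rewrite dotpZr dotp_delta; congr (_ * _).
  rewrite mxE; apply: eq_Rintegral => y _.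
  by rewrite /fA mxE Kd_coord.
have KrE v : Kr s v ord0 j = v ord0 j * (enorm v `^ (s + 1))^-1 by rewrite mxE mulrC.
(* For x in B(0, r) and y outside B(0, 2 r), both |x - y| and |y| are at least r > delta, so
   truncation leaves the correction term unchanged. *)
have eB delta : 0 < delta < r -> sec = Int (fun x => g x * Int (fB delta x)).
  move=> /andP[d0 dr]; apply: eq_Rintegral => x _.
  rewrite dotpZl dotpC dotp_delta.
  have [Bx|/gB ->] := pselect (eball 0 r x); last by rewrite !mul0r.
  congr (_ * _); rewrite mxE; apply: eq_Rintegral => y _.
  have KB (v w : 'rV[R]_d) : (Kr s v - Kr s w) ord0 j = Kr s v ord0 j - Kr s w ord0 j.
    by rewrite mxE [X in _ + X]mxE.
  rewrite mxE KB !KrE /fB; have [By|nBy] := pselect (eball 0 (2 * r) y).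
    by rewrite /phi indicE mem_set// subrr !mul0r.
  congr (_ * _); move: Bx nBy => /=; rewrite /eball /= !subr0 => Bx /negP; rewrite -leNgt => By.
  have h1 : delta <= enorm ((x : 'rV[R]_d) - y).
    have := enorm_dist y x 0; rewrite !subr0 (enormB y); lra.
  have h2 : delta <= enorm (0 - (y : 'rV[R]_d)) by rewrite sub0r enormN; lra.
  by rewrite /k /tker (max_idPr h1) (max_idPr h2).
have eE delta : 0 < delta < r ->
    Int (fun x => g x * tfield delta j x) = pairTd s mu delta phi (fun x => g x *: delta_mx ord0 j) + sec.
  move=> dr; rewrite eA (eB _ dr); have /andP[d0 _] := dr.
  have ak : admissible_kernel s j (k delta) by exact: admissible_tker.
  have [mk ok kC] := ak.
  have [C C0 hC] := kC r; have [C' C'0 hC'] := kC 0.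
  have offb y : `|phi y * offset s j y| <= (2 * r) * ker s 1 (y : 'rV[R]_d).
    rewrite /phi indicE; have [By|nBy] := pselect (eball 0 (2 * r) y); last first.
      by rewrite memNset// mul0r normr0 mulr_ge0 ?ker_ge0// mulr_ge0.
    rewrite mem_set// mul1r /offset normrM (ger0_norm (ker_ge0 _ _ _)).
    apply: ler_wpM2r; first exact: ker_ge0.
    by apply: (le_trans (coord_le _ _)); move: By; rewrite /eball/= subr0 => /ltW.
  have moff : measurable_fun setT (offset s j : Rd -> R) by exact: measurable_offset.
  have doff : @dominated R d s setT (fun y => phi y * offset s j y).
    split; first exact: measurable_funM.
    by exists (2 * r); [rewrite mulr_ge0|move=> y _; exact: offb].
  have mfx2 : measurable_fun setT (fun p : Rd * Rd => phi p.2).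
    by apply: (measurableT_comp mphi); exact: measurable_snd.
  have mk0 : measurable_fun setT (fun p : Rd * Rd => k delta (0 - (p.2 : 'rV[R]_d))).
    have h := measurableT_comp mk (pair1_measurable (0 : Rd)).
    exact: (measurableT_comp h measurable_snd).
  have iA : mu.-integrable setT (EFin \o (fun x => g x * Int (fA delta x))).
    apply: (localized_field mu_nice s_gt0 Lam_ge0 (c := 0) (r := r) (G0 := G0)) => //.
      exact: (measurable_funM mfx2 mk).
    exists (C + 2 * r); first by rewrite addr_ge0 ?mulr_ge0.
    move=> x y; rewrite subr0 => xr.
    rewrite /fA (algA _ _ (offset s j y)).
    apply: (le_trans (ler_normB _ _)); rewrite mulrDl lerD ?offb//.
    rewrite normrM -[leRHS]mul1r; apply: ler_pM => //; exact: hC.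
  have iB : mu.-integrable setT (EFin \o (fun x => g x * Int (fB delta x))).
    apply: (localized_field mu_nice s_gt0 Lam_ge0 (c := 0) (r := r) (G0 := G0)) => //.
      have m1 : measurable_fun setT (fun p : Rd * Rd => 1 - phi p.2) by exact: measurable_funB.
      exact: (measurable_funM m1 (measurable_funB mk mk0)).
    exists (C + C'); first by rewrite addr_ge0.
    move=> x y; rewrite subr0 => xr.
    rewrite /fB normrM -[leRHS]mul1r; apply: ler_pM => //.
    have -> : k delta (x - y) - k delta (0 - y) = (k delta (x - y) + offset s j y) - (k delta (0 - y) + offset s j y).
      exact: algD.
    apply: (le_trans (ler_normB _ _)); rewrite mulrDl lerD//; first exact: hC.
    by apply: hC'; rewrite enorm0.
  rewrite -RintegralD//.
  (* The excess of the renormalized field over fA + fB: it does not depend on x, so it integrates to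
     0 against g. *)
  pose c0 := Int (fun y => (1 - phi y) * (k delta (0 - (y : 'rV[R]_d)) + offset s j y) + phi y * offset s j y).
  have dk x : @dominated R d s setT (fun y : Rd => k delta (x - (y : 'rV[R]_d)) + offset s j y).
    exact: admissible_dominated.
  have m1phi : measurable_fun setT (fun y => 1 - phi y) by exact: measurable_funB.
  transitivity (Int (fun x => g x * tfield delta j x - c0 * g x)).
    rewrite RintegralB//; first by rewrite RintegralZl// g0 mulr0 subr0.
    - exact: (kernel_field_integrable mu_nice s_gt0 Lam_ge0 ak r0 mg G00 gG gB).
    - exact: (integrableZl measurableT c0 gint).
  apply: eq_Rintegral => x _; rewrite -mulrDr [c0 * _]mulrC -mulrBr; congr (_ * _).
  have dA : @dominated R d s setT (fA delta x).
    have := dominatedB (dominated_bounded mphi phi01 (dk x)) doff.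
    by congr (dominated _ _ _); apply/funext => y; rewrite /fA; exact/esym/algA.
  have dB : @dominated R d s setT (fB delta x).
    have := dominatedB (dominated_bounded m1phi phi01' (dk x)) (dominated_bounded m1phi phi01' (dk 0)).
    by congr (dominated _ _ _); apply/funext => y; rewrite /fB; exact/esym/algB.
  have dC : @dominated R d s setT (fun y => (1 - phi y) * (k delta (0 - (y : 'rV[R]_d)) + offset s j y) + phi y * offset s j y).
    by apply: dominatedD => //; exact: (dominated_bounded m1phi phi01' (dk 0)).
  rewrite /tfield /kernel_field -(IntB mu_nice s_gt0 measurableT (dk x) dC).
  rewrite -(IntD mu_nice s_gt0 measurableT dA dB).
  by apply: eq_Rintegral => y _; rewrite /fA /fB; exact: algC.
rewrite /pairT1 -/sec /pairT.
suff -> : lim (pairTd s mu delta phi (fun x : Rd => g x *: delta_mx ord0 j) @[delta --> 0^'+]) = N - sec.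
  by rewrite subrK.
apply/cvg_lim => //.
have : (fun delta => Int (fun x => g x * tfield delta j x) - sec) @ 0^'+ --> N - sec.
  by apply: cvgB => //; exact: cvg_cst.
apply: cvg_trans; apply: near_eq_cvg; near=> delta.
rewrite eE ?addrK//; apply/andP; split; near: delta.
- exact: nbhs_right_gt.
- exact: nbhs_right_lt.
Unshelve. all: by end_near. Qed.

Lemma tent_integrable y r : 0 < r -> mu.-integrable setT (EFin \o (tent y r : Rd -> R)).
Proof.
move=> r0; have mB := @measurable_eball R d y r.
have h : mu.-integrable setT (EFin \o (\1_(eball y r) : Rd -> R)).
  apply/integrableP; split; first by apply/measurable_EFinP; exact: measurable_indic.
  rewrite (_ : integral _ _ _ = mu (eball y r)); first exact: (eball_fin mu_nice).
  have := integral_indic mu measurableT mB; rewrite setIT => <-.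
  by apply: eq_integral => x _ /=; rewrite ger0_norm.
apply: le_integrable h => //; first by apply/measurable_EFinP; exact: measurable_tent.
move=> x _ /=; rewrite lee_fin indicE; have [Bx|nBx] := pselect (eball y r x).
  by rewrite mem_set// normr1 ger0_norm ?tent_ge0 ?tent_le1.
by rewrite memNset// normr0 tent_out// normr0.
Qed.

Lemma tent_integral_ge y r : 0 < r ->
  1 / 2 * fine (mu (eball y (r / 2))) <= Int (tent y r : Rd -> R).
Proof.
move=> r0; have r20 : 0 < r / 2 by rewrite divr_gt0.
have mB := @measurable_eball R d y (r / 2).
rewrite -lee_fin /Rintegral fineK; last by apply: integrable_fin_num => //; exact: tent_integrable.
rewrite EFinM fineK; last by rewrite ge0_fin_numE//; exact: (eball_fin mu_nice).
have := integral_indic mu measurableT mB; rewrite setIT => <-.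
rewrite -ge0_integralZl//; last by apply/measurable_EFinP; exact: measurable_indic.
apply: ge0_le_integral => //.
- by apply/measurable_EFinP; apply: measurable_funM => //; exact: measurable_indic.
- by apply/measurable_EFinP; exact: measurable_tent.
move=> x _; rewrite -EFinM lee_fin indicE; have [Bx|nBx] := pselect (eball y (r / 2) x).
  by rewrite mem_set// mulr1 tent_half.
by rewrite memNset// mulr0 tent_ge0.
Qed.

Lemma enorm_scale_delta (a b : R) j : enorm (a *: delta_mx ord0 j - b *: delta_mx ord0 j : 'rV[R]_d) = `|a - b|.
Proof. by rewrite -scalerBl enormZ enorm_delta mulr1. Qed.

(* [tfield delta j] tends weakly to a constant [c j] on [mu]; comparing it with
   the smooth field [rfield u j] only involves an odd kernel. *)
Lemma force_balance : reflectionless s mu -> (exists p, supp mu p) ->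
  exists c : 'I_d -> R, forall j y (r u Q delta0 : R), 0 < r -> 0 < u -> 0 <= Q -> 0 < delta0 ->
  (forall delta, 0 < delta < delta0 -> forall x, eball y r x ->
    (\int[mu]_z (`|(x - (z : 'rV[R]_d)) ord0 j * (tker s delta (x - (z : 'rV[R]_d)) - ker s u (x - (z : 'rV[R]_d)))| *
       `|tent y r x - tent y r z|)%:E <= Q%:E)%E) ->
  `|Int (fun x : Rd => tent y r x * (rfield u j x - c j))| <= Q * fine (mu (eball y r)).
Proof.
move=> [_ refl] [p sp].
have ms0 : 0 < Int (tent p 1 : Rd -> R).
  apply: lt_le_trans (tent_integral_ge p ltr01); rewrite mulr_gt0//.
  have h12 : 0 < 1 / 2 :> R by rewrite divr_gt0.
  by rewrite fine_gt0// sp//= (eball_fin mu_nice).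
set ms := Int (tent p 1 : Rd -> R) in ms0.
have [NC hNC] : exists NC : 'I_d -> R * R, forall j, forall a : R, 0 < a ->
  `|Int (fun x => tent p 1 x * tfield a j x) - (NC j).1| <= (NC j).2 * a.
  have h j : exists NC : R * R, forall a : R, 0 < a ->
      `|Int (fun x => tent p 1 x * tfield a j x) - NC.1| <= NC.2 * a.
    by have [N [C h]] := tfield_limit j p ltr01; exists (N, C).
  by have /choice[NC hNC] := h; exists NC.
exists (fun j => (NC j).1 / ms) => j y r u Q delta0 r0 u0 Q0 d00 hQ.
have [N [C hN]] := tfield_limit j y r0.
set m := Int (tent y r : Rd -> R).
have to_limit (F : R -> R) (l K : R) : (forall a, 0 < a -> `|F a - l| <= K * a) -> F @ 0^'+ --> l.
  move=> FK; apply/cvgrPdist_le => e e0; near=> a.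
  have a0 : 0 < a by near: a; exact: nbhs_right_gt.
  rewrite distrC (le_trans (FK _ a0))//.
  have K0 : 0 < `|K| + 1 by rewrite ltr_wpDl.
  apply: (@le_trans _ _ ((`|K| + 1) * a)).
    by apply: ler_wpM2r; [exact: ltW|have := ler_norm K; lra].
  rewrite mulrC -ler_pdivlMr//; near: a; apply: nbhs_right_le; rewrite divr_gt0//.
have mt := @measurable_tent R d y r r0.
have mtp := @measurable_tent R d p 1 ltr01.
have tint := tent_integrable y r0.
have tintp := tent_integrable p ltr01.
have t1 x : `|tent y r x| <= 1 by rewrite ger0_norm ?tent_ge0 ?tent_le1.
have tout (x : Rd) : ~ eball y r x -> tent y r x = 0 by exact: tent_out.
have tp1 x : `|tent p 1 x| <= 1 by rewrite ger0_norm ?tent_ge0 ?tent_le1.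
have tpout (x : Rd) : ~ eball p 1 x -> tent p 1 x = 0 by exact: tent_out.
pose rho := enorm y + r + enorm p + 1.
have rho0 : 0 < rho by have := enorm_ge0 y; have := enorm_ge0 p; rewrite /rho; lra.
(* A combination of two tents with mean zero. Reflectionlessness makes its limit pairing vanish, so
   the ratio of the limit N to the mass m of the tent is the same for every tent; this ratio is the
   constant c j. The tent at p serves as reference, with positive mass because p is in the
   support. *)
pose g (x : Rd) := ms * tent y r x - m * tent p 1 x.
have mg : measurable_fun setT g by apply: measurable_funB; exact: measurable_funM.
have gout (x : 'rV[R]_d) : rho <= enorm x -> g x = 0.
  move=> rx; rewrite /g tout ?tpout ?mulr0 ?subrr//.
    rewrite /eball/= => /lt_geF/negP; apply; have := enorm_dist x p 0; rewrite !subr0.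
    have := enorm_ge0 y; rewrite /rho in rx; lra.
  rewrite /eball/= => /lt_geF/negP; apply; have := enorm_dist x y 0; rewrite !subr0.
  have := enorm_ge0 p; rewrite /rho in rx; lra.
have ik (a : R) : 0 < a -> mu.-integrable setT (EFin \o (fun x => tent y r x * tfield a j x)).
  move=> a0; have ak : admissible_kernel s j (fun v => v ord0 j * tker s a v) by exact: admissible_tker.
  exact: (kernel_field_integrable mu_nice s_gt0 Lam_ge0 ak r0 mt ler01 t1 tout).
have ikp (a : R) : 0 < a -> mu.-integrable setT (EFin \o (fun x => tent p 1 x * tfield a j x)).
  move=> a0; have ak : admissible_kernel s j (fun v => v ord0 j * tker s a v) by exact: admissible_tker.
  exact: (kernel_field_integrable mu_nice s_gt0 Lam_ge0 ak ltr01 mtp ler01 tp1 tpout).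
have Zg a : 0 < a -> Int (fun x => g x * tfield a j x) =
    ms * Int (fun x => tent y r x * tfield a j x) - m * Int (fun x => tent p 1 x * tfield a j x).
  move=> a0; rewrite -!RintegralZl//; [|exact: ikp|exact: ik].
  rewrite -RintegralB//; [|exact: (integrableZl measurableT _ (ik _ a0))|exact: (integrableZl measurableT _ (ikp _ a0))].
  by apply: eq_Rintegral => x _; rewrite /g mulrBl !mulrA.
have g0 : Int g = 0.
  rewrite /g RintegralB//; [|exact: (integrableZl measurableT _ tint)|exact: (integrableZl measurableT _ tintp)].
  by rewrite !RintegralZl// -/m -/ms mulrC subrr.
have gN : ms * N - m * (NC j).1 = 0.
  have r10 : 0 < rho + 1 by lra.
  rewrite -(@pairT1_tfield j g (rho + 1) (`|ms| + `|m|) (ms * N - m * (NC j).1)) //; first last.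
  - apply: (to_limit _ _ (`|ms| * C + `|m| * (NC j).2)) => a a0; rewrite Zg//.
    rewrite (_ : _ - _ = ms * (Int (fun x => tent y r x * tfield a j x) - N) -
       m * (Int (fun x => tent p 1 x * tfield a j x) - (NC j).1)); last by ring.
    apply: (le_trans (ler_normB _ _)); rewrite mulrDl !normrM -!mulrA.
    by apply: lerD; apply: ler_wpM2l => //; [exact: hN|exact: hNC].
  - move=> x; rewrite /eball/= subr0 => /negP; rewrite -leNgt => h; apply: gout; lra.
  - move=> x; apply: (le_trans (ler_normB _ _)); rewrite !normrM.
    by apply: lerD; rewrite -[leRHS]mulr1; apply: ler_wpM2l.
  pose psi (x : 'rV[R]_d) : 'rV[R]_d := g x *: delta_mx ord0 j.
  have sub : supp_fun psi `<=` [set x | enorm (x - 0) <= rho].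
    rewrite /supp_fun closureE => x; apply; split.
      have -> : [set x | enorm (x - 0) <= rho] = (fun y => enorm (y - 0)) @^-1` [set t | t <= rho] :> set 'rV[R]_d by [].
      apply: preimage_closed; last exact: closed_le.
      by move=> z _; exact: continuous_enormB.
    move=> z /= zN; rewrite subr0 leNgt; apply/negP => /ltW /gout gz.
    by move: zN; rewrite /psi gz scale0r eqxx.
  apply: (refl psi _ _ _ 0 (rho + 1)).
  - exists (`|ms| * r^-1 + `|m| * 1^-1) => x x'; rewrite /psi enorm_scale_delta /g.
    rewrite (_ : _ - _ = ms * (tent y r x - tent y r x') - m * (tent p 1 x - tent p 1 x')); last by ring.
    apply: (le_trans (ler_normB _ _)); rewrite mulrDl !normrM -!mulrA.
    by apply: lerD; apply: ler_wpM2l => //; exact: tent_lip.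
  - have cl : closed (supp_fun psi) by exact: closed_closure.
    exact: (subclosed_compact cl (@compact_closed_eball R d 0 rho) sub).
  - apply/rowP => i; rewrite !mxE.
    rewrite (_ : Rintegral _ _ _ = Int (fun x => (delta_mx ord0 j : 'rV[R]_d) ord0 i * g x)).
      have ig : mu.-integrable setT (EFin \o g).
        exact: (integrableB measurableT (integrableZl measurableT _ tint) (integrableZl measurableT _ tintp)).
      by rewrite RintegralZl// g0 mulr0.
    by apply: eq_Rintegral => x _; rewrite /psi mxE mulrC.
  - exact: r10.
  - by move=> x /sub /=; rewrite /eball/=; lra.
  - by rewrite /eball/= subrr enorm0.
  - split; first exact: measurable_indic (measurable_eball _ _).
    have mB := @measurable_eball R d 0 (2 * (rho + 1)).
    rewrite (_ : integral _ _ _ = mu (eball 0 (2 * (rho + 1)))).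
      by apply: (eball_fin mu_nice); rewrite mulr_gt0.
    have := integral_indic mu measurableT mB; rewrite setIT => <-.
    apply: eq_integral => x _; rewrite indicE; case: (_ \in _); by rewrite ?expr1n ?expr0n.
  - by move=> x; rewrite indicE; case: (_ \in _); rewrite /= ?lexx ler01.
  - by move=> x Bx; rewrite indicE mem_set.
have au : admissible_kernel s j (fun v => v ord0 j * ker s u v) by exact: admissible_ker.
have iu : mu.-integrable setT (EFin \o (fun x => tent y r x * rfield u j x)).
  exact: (kernel_field_integrable mu_nice s_gt0 Lam_ge0 au r0 mt ler01 t1 tout).
have -> : Int (fun x : Rd => tent y r x * (rfield u j x - (NC j).1 / ms)) =
   Int (fun x => tent y r x * rfield u j x) - N.
  have -> : N = ((NC j).1 / ms) * m.
    have msN0 : ms != 0 by rewrite gt_eqF.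
    by apply: (mulfI msN0); rewrite mulrA mulrCA mulfV// mulr1 [RHS]mulrC; lra.
  rewrite -RintegralZl// -RintegralB//; last exact: (integrableZl measurableT _ tint).
  by apply: eq_Rintegral => x _; rewrite mulrBr [X in _ - X]mulrC.
apply/ler_addgt0Pr => e e0.
(* A truncation fine enough both for the hypothesis (a < delta0) and for the limit (C a <= e). *)
pose a := Num.min (delta0 / 2) (e / (`|C| + 1)).
have C0 : 0 < `|C| + 1 by rewrite ltr_wpDl.
have a0 : 0 < a by rewrite lt_min !divr_gt0.
have ad : a < delta0 by rewrite gt_min; apply/orP; left; lra.
have ae : C * a <= e.
  apply: (@le_trans _ _ ((`|C| + 1) * a)).
    by apply: ler_wpM2r; [exact: ltW|have := ler_norm C; lra].
  by rewrite mulrC -ler_pdivlMr// ge_min lexx orbT.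
have alg (b1 b2 b3 : R) : b1 - b3 = (b2 - b3) - (b2 - b1) by ring.
rewrite (alg _ (Int (fun x => tent y r x * tfield a j x)) N).
apply: (le_trans (ler_normB _ _)); rewrite addrC; apply: lerD; last exact: le_trans (hN _ a0) ae.
apply: (kernel_field_diff mu_nice) => //; first exact: admissible_tker.
move=> x Bx; apply: le_trans (hQ a _ x Bx); last by rewrite a0.
by rewrite le_eqVlt; apply/orP; left; apply/eqP; apply: eq_integral => z _; rewrite -mulrBr.
Unshelve. all: by end_near. Qed.

End ForceBalance.

(** * Density and smoothed field as integrals over the support *)

Section SupportIntegrals.
Context {R : realType} {d : nat}.
Local Notation Rd := (@Rdm R d).
Variables (mu : {measure set Rd -> \bar R}) (s Lam : R).
Hypothesis mu_nice : nice s Lam mu.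
Hypothesis s_gt0 : 0 < s.

Local Notation S := (supp mu : set Rd).
Local Notation Int f := (\int[mu]_(y in S) f y).

Lemma dominatedS (D : set Rd) f : @dominated R d s setT f -> @dominated R d s D f.
Proof. by move=> [mf [C C0 h]]; split => //; exists C => // y _; exact: h. Qed.

(** The complement of the support is null. Integrating over the support means that kernel bounds are
    needed only for y in it, which later allows u = 0 at points off the support. *)
Lemma integral_supp f : @dominated R d s setT f -> (\int[mu]_y f y) = Int f.
Proof.
move=> df; rewrite /Rintegral; congr fine.
rewrite (negligible_integral (N := ~` S)) ?null_supp//.
- by rewrite setDE setCK setTI.
- by apply: measurableC; exact: measurable_supp.
- exact: (dominated_integrable mu_nice s_gt0 measurableT df).
Qed.

Definition density u (x : 'rV[R]_d) : R := Int (fun y : Rd => ker s u (x - (y : 'rV[R]_d))).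

Definition field (c : 'I_d -> R) u j (x : 'rV[R]_d) : R :=
  Int (fun y : Rd => (x - (y : 'rV[R]_d)) ord0 j * ker s u (x - (y : 'rV[R]_d)) + offset s j y) - c j.

Lemma dominated_ker u (x : 'rV[R]_d) : 0 < u ->
  @dominated R d s setT (fun y : Rd => ker s u (x - (y : 'rV[R]_d))).
Proof.
move=> u0; split; first by apply: measurable_ker => i; exact: measurable_coordB.
have [C C0 h] := @ker_dominated_unif R d s s_gt0 u (enorm x) u0; exists C => // y _.
by rewrite ger0_norm ?ker_ge0//; exact: h.
Qed.

Lemma dominated_riesz u j (x : 'rV[R]_d) : 0 < u ->
  @dominated R d s setT (fun y : Rd => (x - (y : 'rV[R]_d)) ord0 j * ker s u (x - (y : 'rV[R]_d)) + offset s j y).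
Proof.
move=> u0; split.
  apply: measurable_funD; last exact: measurable_offset.
  apply: measurable_funM; first exact: measurable_coordB.
  by apply: measurable_ker => i; exact: measurable_coordB.
by have [C C0 h] := @riesz_dominated_unif R d s s_gt0 u (enorm x) j u0; exists C => // y _; exact: h.
Qed.

Lemma density_ge0 u x : 0 <= density u x.
Proof. by apply: Rintegral_ge0 => y _; exact: ker_ge0. Qed.

Lemma density_EFin u x : 0 < u ->
  (\int[mu]_y (ker s u (x - (y : 'rV[R]_d)))%:E = (density u x)%:E)%E.
Proof.
move=> u0; have dk := dominated_ker x u0.
rewrite /density -(integral_supp dk) /Rintegral fineK//.
apply: integrable_fin_num => //; exact: (dominated_integrable mu_nice s_gt0 measurableT dk).
Qed.

Lemma density_le (t : R) x : 0 < t -> t * density (t ^+ 2) x <= 2 `^ (s + 2) * Lam.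
Proof.
move=> t0; have t20 : 0 < t ^+ 2 by exact: exprn_gt0.
have := ker_integral_le mu_nice s_gt0 x t0.
by rewrite (density_EFin _ t20) lee_fin ler_pdivlMr// mulrC.
Qed.

(** On B(x, 2 t) the weight is at most 4 t^2 + t^2, whence the 5. *)
Lemma ball_le_density (t : R) x : 0 < t ->
  fine (mu (eball x (2 * t))) <= 5 `^ ((s + 1) / 2) * t `^ s * (t * density (t ^+ 2) x).
Proof.
move=> t0; have t20 : 0 < t ^+ 2 by exact: exprn_gt0.
have tt0 : 0 < 2 * t by rewrite mulr_gt0.
have mB := @measurable_eball R d x (2 * t).
have fB : (mu (eball x (2 * t)) < +oo)%E.
  by apply: le_lt_trans (mu_nice x tt0) _; rewrite ltry.
set a := (s + 1) / 2.
have a0 : 0 <= a by exact: exponent_ge0.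
have h : (((5 * t ^+ 2) `^ (- a))%:E * mu (eball x (2 * t)) <= (density (t ^+ 2) x)%:E)%E.
  rewrite -(density_EFin _ t20).
  have := integral_indic mu measurableT mB; rewrite setIT => <-.
  rewrite -ge0_integralZl ?lee_fin ?powR_ge0//; last first.
    by apply/measurable_EFinP; exact: measurable_indic.
  apply: ge0_le_integral => //.
  - by move=> y _; rewrite -EFinM lee_fin mulr_ge0 ?powR_ge0.
  - by apply/measurable_EFinP; apply: measurable_funM => //; exact: measurable_indic.
  - by apply/measurable_EFinP; case: (dominated_ker x t20).
  move=> y _; rewrite -EFinM lee_fin indicE; have [By|nBy] := pselect (eball x (2 * t) y); last first.
    by rewrite memNset// mulr0 ker_ge0.
  rewrite mem_set// mulr1; apply: powRN_le => //.
    by have := dotp_ge0 (x - (y : 'rV[R]_d)); lra.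
  have := ler_sqr_ge0 (enorm_ge0 _) (ltW By); rewrite enormB enorm_sqr exprMn; lra.
move: h; rewrite -[mu _]fineK ?ge0_fin_numE// -EFinM lee_fin => h.
have p0 : 0 < (5 * t ^+ 2) `^ a by rewrite powR_gt0// mulr_gt0.
move: h; rewrite powRN mulrC ler_pdivrMr// => h; apply: (le_trans h).
rewrite le_eqVlt; apply/orP; left; apply/eqP.
rewrite powRM ?(ltW t20)// powR_sqr ?(ltW t0)//.
rewrite (_ : 2 * a = s + 1); last by rewrite /a; lra.
rewrite powRD ?(gt_eqF t0) ?implybT// powRr1 ?(ltW t0)//; ring.
Qed.

(** For |x - x0| <= t the weights at x and x0 are comparable with factor 3 (2 t^2 + t^2 <= 3 t^2),
    and [riesz_sub_le] is integrated. Neither the constant c nor the offset enters. *)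
Lemma field_sub_le c (t : R) j (x x0 : 'rV[R]_d) : 0 < t -> enorm (x - x0) <= t ->
  `|field c (t ^+ 2) j x - field c (t ^+ 2) j x0| <=
   (3 `^ ((s + 1) / 2) + (s + 1) / 2 * 3 `^ ((s + 1) / 2 + 1) * (3 + 1)) * (t * density (t ^+ 2) x0).
Proof.
move=> t0 xt; have t20 : 0 < t ^+ 2 by exact: exprn_gt0.
set K := (X in _ <= X * _).
rewrite /field (_ : forall a b e : R, a - e - (b - e) = a - b); last by move=> *; ring.
have mS := measurable_supp mu.
have d1 := dominatedS S (dominated_riesz j x t20).
have d0 := dominatedS S (dominated_riesz j x0 t20).
have dk := dominatedS S (dominated_ker x0 t20).
rewrite -(IntB mu_nice s_gt0 mS d1 d0) /density mulrA -(IntM mu_nice s_gt0 mS _ dk).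
apply: (Int_norm_le mu_nice s_gt0 mS) => //.
- exact: dominatedB.
- exact: dominatedM.
have xx : dotp (x - x0) (x - x0) <= t ^+ 2.
  by rewrite -enorm_sqr; exact: ler_sqr_ge0.
have xx' : dotp (x0 - x) (x0 - x) <= t ^+ 2 by rewrite -enorm_sqr enormB enorm_sqr.
move=> y _; rewrite (_ : forall a b e : R, a + e - (b + e) = a - b); last by move=> *; ring.
have h3 : 1 <= 3 :> R by lra.
apply: (le_trans (@riesz_sub_le _ _ _ s_gt0 3 t _ _ _ _ j h3 t0 (ltW t20) (ltW t20) _ _ _ _)).
- by have := dotp_ge0 (x0 - (y : 'rV[R]_d)); lra.
- by have := dotp_ge0 (x - (y : 'rV[R]_d)); lra.
- by apply: weight_comparable; lra.
- by apply: weight_comparable; lra.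
rewrite subrr normr0 mul0r addr0 -/K; apply: ler_wpM2r; first exact: ker_ge0.
apply: ler_wpM2l.
  by rewrite /K; have a0 := exponent_ge0 s_gt0; nonneg.
by rewrite opprB addrA subrK.
Qed.

End SupportIntegrals.

(** * Decay of the field on the support *)

Section InteractionBound.
Context {R : realType} {d : nat}.
Local Notation Rd := (@Rdm R d).
Variables (mu : {measure set Rd -> \bar R}) (s Lam : R).
Hypothesis mu_nice : nice s Lam mu.
Hypothesis s_gt0 : 0 < s.
Hypothesis Lam_ge0 : 0 <= Lam.
Hypothesis s_ltd : s < d%:R.
Implicit Types (x y z v : 'rV[R]_d) (t r : R).

(** Here s < d enters: dyadic powers with exponent s are replaced by integer powers, which the decay
    exponent d + 1 beats. *)
Lemma two_powR_le n : (2 ^+ n : R) `^ s <= (2 ^+ n) ^+ d.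
Proof.
have h1 : 1 <= 2 ^+ n :> R by rewrite exprn_ege1// ler1n.
rewrite -[leRHS]powR_mulrn ?exprn_ge0//.
by apply: ler_powR => //; exact: ltW.
Qed.

Lemma dyadic_powRN t n : 0 < t -> (t / 2 ^+ n) `^ (- s) <= t `^ (- s) * (2 ^+ n) ^+ d.
Proof.
move=> t0; have p : 0 < 2 ^+ n :> R by rewrite exprn_gt0.
rewrite powRM ?(ltW t0) ?invr_ge0 ?(ltW p)//.
apply: ler_wpM2l; first exact: powR_ge0.
rewrite -(powR_inv1 (ltW p)) -powRrM mulN1r opprK; exact: two_powR_le.
Qed.

Lemma indicator_integral (c : R) x r : 0 < r -> 0 <= c ->
  (\int[mu]_z (c * \1_(eball x r) z)%:E = (c * fine (mu (eball x r)))%:E)%E.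
Proof.
move=> r0 c0; have mB := @measurable_eball R d x r.
under eq_integral do rewrite EFinM.
rewrite ge0_integralZl//; last by apply/measurable_EFinP; exact: measurable_indic.
rewrite integral_indic// setIT EFinM fineK// ge0_fin_numE//.
by apply: le_lt_trans (mu_nice x r0) _; rewrite ltry.
Qed.

(** The constant of [tker_sub_ker_far] with c = 5, since |v| >= t/2 gives |v|^2 + t^2 <= 5 |v|^2. *)
Let far_const : R := (s + 1) / 2 * 5 `^ ((s + 1) / 2 + 1).

Lemma far_const_ge0 : 0 <= far_const.
Proof. by rewrite /far_const; have a0 := exponent_ge0 s_gt0; nonneg. Qed.

(* Masses of the balls B(y, t/2^i) decaying like (t/2^i)^{d+1} make the
   interactions of a tent with everything at distance >= theta r negligible. *)
Lemma interaction_bound x y t theta delta (B0 : R) k j : 0 < t -> 0 < theta -> theta <= 1 ->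
  0 < delta -> delta < theta * (t / 2 ^+ k.+1) -> 0 <= B0 ->
  eball y (t / 2 ^+ k.+1) x ->
  (forall i, (i <= k)%N -> fine (mu (eball y (t / 2 ^+ i))) <= t `^ s * B0 / (2 ^+ i) ^+ d.+1) ->
  (\int[mu]_z (`|(x - (z : 'rV[R]_d)) ord0 j *
       (tker s delta (x - (z : 'rV[R]_d)) - ker s (t ^+ 2) (x - (z : 'rV[R]_d)))| *
       `|tent y (t / 2 ^+ k.+1) x - tent y (t / 2 ^+ k.+1) z|)%:E <=
   (2 `^ (s + 1) * Lam * theta + 2 ^+ d * theta `^ (- s) * B0 + 2 * 4 ^+ d * B0 +
    far_const * (t * density mu s (t ^+ 2) x))%:E)%E.
Proof.
move=> t0 th0 th1 d0 dr B00 xB mass; set r := t / 2 ^+ k.+1 in dr xB *.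
have p n : 0 < 2 ^+ n :> R by rewrite exprn_gt0.
have r0 : 0 < r by rewrite divr_gt0.
have t20 : 0 < t ^+ 2 by exact: exprn_gt0.
have thr0 : 0 < theta * r by rewrite mulr_gt0.
pose kap v := `|v ord0 j * (tker s delta v - ker s (t ^+ 2) v)|.
pose F (z : Rd) : R := kap (x - (z : 'rV[R]_d)) * `|tent y r x - tent y r z|.
have mt := @measurable_tent R d y r r0.
have mkap : measurable_fun setT (fun z : Rd => kap (x - (z : 'rV[R]_d))).
  apply: measurableT_comp => //; apply: measurable_funM; first exact: measurable_coordB.
  apply: measurable_funB.
    by apply: measurable_tker => i; exact: measurable_coordB.
  by apply: measurable_ker => i; exact: measurable_coordB.
have mF : measurable_fun setT F.
  by apply: measurable_funM => //; apply: measurableT_comp => //; exact: measurable_funB.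
have kap0 v : 0 <= kap v by exact: normr_ge0.
have F0 z : 0 <= F z by rewrite mulr_ge0.
have Fkap z : F z <= kap (x - (z : 'rV[R]_d)) by rewrite ler_piMr// tent_osc.
have kapn v : kap v <= enorm v `^ (- s) by apply: tker_sub_ker_near => //; exact: ltW.
have mB c (q : R) : measurable_fun [set: Rd] (\1_(eball c q) : Rd -> R).
  exact: measurable_indic (measurable_eball _ _).
(* Four regions for v = x - z: F1 for |v| < theta r, F2 for theta r <= |v| < r, the F3 i for the
   dyadic shells between r and t/2, and F4 beyond t/2. *)
pose F1 (z : Rd) : R := \1_(eball x (theta * r)) z * F z.
pose F2 (z : Rd) : R := (theta * r) `^ (- s) * \1_(eball y (t / 2 ^+ k)) z.
pose F3 i (z : Rd) : R := (t / 2 ^+ i.+2) `^ (- s) * \1_(eball y (t / 2 ^+ i)) z.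
pose F4 (z : Rd) : R := (far_const * t) * ker s (t ^+ 2) (x - (z : 'rV[R]_d)).
have F10 z : 0 <= F1 z by rewrite mulr_ge0.
have F20 z : 0 <= F2 z by rewrite mulr_ge0// powR_ge0.
have F30 i z : 0 <= F3 i z by rewrite mulr_ge0// powR_ge0.
have fct0 : 0 <= far_const * t by apply: mulr_ge0; [exact: far_const_ge0|exact: ltW].
have F40 z : 0 <= F4 z by rewrite mulr_ge0// ker_ge0.
have m1 : measurable_fun setT F1 by exact: measurable_funM.
have m2 : measurable_fun setT F2 by exact: measurable_funM.
have m3 i : measurable_fun setT (F3 i) by exact: measurable_funM.
have m4 : measurable_fun setT F4.
  by apply: measurable_funM => //; apply: measurable_ker => i; exact: measurable_coordB.
have sum0 z : 0 <= \sum_(i < k) F3 i z by apply: sumr_ge0.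
have main z : F z <= F1 z + F2 z + (\sum_(i < k) F3 i z) + F4 z.
  set v := x - (z : 'rV[R]_d).
  have := F10 z; have := F20 z; have := F40 z; have := sum0 z.
  have [vth|thv] := ltP (enorm v) (theta * r).
    have -> : F1 z = F z by rewrite /F1 indicE mem_set ?mul1r// /eball/= enormB.
    lra.
  have v0 : 0 < enorm v by exact: lt_le_trans thv.
  have vN0 : v != 0 by rewrite -enorm_eq0 gt_eqF.
  have yx : enorm (x - y) < r by [].
  have zy : enorm ((z : 'rV[R]_d) - y) <= enorm v + enorm (x - y).
    by rewrite /v (enormB x); exact: enorm_dist.
  have kap_le (q : R) : 0 < q -> q <= enorm v -> F z <= q `^ (- s).
    move=> q0 qv; apply: (le_trans (Fkap z)); apply: (le_trans (kapn _)).
    by apply: powRN_le => //; exact: ltW.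
  have [vr|rv] := ltP (enorm v) r.
    suff : F z <= F2 z by lra.
    rewrite /F2 indicE mem_set ?mulr1; first exact: kap_le.
    rewrite /eball/=; apply: (le_lt_trans zy).
    have -> : t / 2 ^+ k = r + r by rewrite /r exprS; field; rewrite gt_eqF.
    lra.
  have [vt|tv] := ltP (enorm v) (t / 2).
    have t2t : t / 2 < t by lra.
    have [n [n1 n2]] := dyadic_down v0 (lt_trans vt t2t).
    have nk : (n < k.+1)%N.
      rewrite ltnNge; apply/negP => kn.
      have : t / 2 ^+ n <= r.
        by rewrite /r ler_pM2l// lef_pV2 ?posrE// ler_eXn2l// ltr1n.
      lra.
    case: n nk n1 n2 => [|n] nk n1 n2; first by move: n2; rewrite expr0 divr1; lra.
    have nk' : (n < k)%N by [].
    have : F3 (Ordinal nk') z <= \sum_(i < k) F3 i z.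
      by rewrite (bigD1 (Ordinal nk'))//= lerDl sumr_ge0.
    suff : F z <= F3 (Ordinal nk') z by lra.
    rewrite /F3 /= indicE mem_set ?mulr1.
      apply: kap_le; first by rewrite divr_gt0.
      by move: n2; rewrite [in X in _ -> X]exprS invfM mulrA mulrAC.
    rewrite /eball/=; apply: (le_lt_trans zy).
    have -> : t / 2 ^+ n = t / 2 ^+ n.+1 + t / 2 ^+ n.+1 by rewrite exprS; field; rewrite gt_eqF.
    have : r <= t / 2 ^+ n.+1.
      by rewrite /r ler_pM2l// lef_pV2 ?posrE// ler_eXn2l// ?ltr1n// ltnS ltnW.
    lra.
  suff : F z <= F4 z by lra.
  apply: (le_trans (Fkap z)); rewrite /F4 -/v.
  apply: tker_sub_ker_far => //.
  - by rewrite ler1n.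
  - apply: ltW; apply: (lt_le_trans dr); apply: (le_trans _ rv).
    by rewrite ler_piMl// ltW.
  have := ler_sqr_ge0 (_ : 0 <= t / 2) tv; rewrite enorm_sqr expr_div_n; move=> h.
  have : t ^+ 2 / 2 ^+ 2 <= dotp v v by apply: h; lra.
  by lra.
apply: (@le_trans _ _ (\int[mu]_z ((F1 z + F2 z + \sum_(i < k) F3 i z + F4 z)%:E))%E).
  apply: ge0_le_integral => //.
  - exact/measurable_EFinP.
  - apply/measurable_EFinP; apply: measurable_funD => //; apply: measurable_funD => //.
      exact: measurable_funD.
    exact: measurable_sum.
  - by move=> z _; rewrite lee_fin; exact: main.
under eq_integral do rewrite !EFinD -sumEFin.
rewrite ge0_integralD//; last 4 first.
- by move=> z _; rewrite !adde_ge0 ?lee_fin// sume_ge0// => i _; rewrite lee_fin.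
- apply: emeasurable_funD; last by apply: emeasurable_sum => i; exact/measurable_EFinP.
  by apply: emeasurable_funD; exact/measurable_EFinP.
- by move=> z _; rewrite lee_fin.
- exact/measurable_EFinP.
rewrite ge0_integralD//; last 4 first.
- by move=> z _; rewrite adde_ge0 ?lee_fin.
- by apply: emeasurable_funD; exact/measurable_EFinP.
- by move=> z _; rewrite sume_ge0// => i _; rewrite lee_fin.
- by apply: emeasurable_sum => i; exact/measurable_EFinP.
rewrite ge0_integralD//; last 4 first.
- by move=> z _; rewrite lee_fin.
- exact/measurable_EFinP.
- by move=> z _; rewrite lee_fin.
- exact/measurable_EFinP.
rewrite !EFinD; apply: leeD; [apply: leeD; [apply: leeD|]|].
(* Close pairs: the tent has slope 1/r and the region has radius theta r, so only a factor theta is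
   left. *)
- have -> : 2 `^ (s + 1) * Lam * theta = r^-1 * (2 `^ (s + 1) * Lam * (theta * r)).
    by field; rewrite gt_eqF.
  apply: (near_integral_le mu_nice s_gt0 (x := x)) => //.
    by rewrite invr_ge0 ltW.
  move=> z F1N0; set v := x - (z : 'rV[R]_d).
  have zB : eball x (theta * r) z.
    by move: F1N0; rewrite /F1 indicE; case: (pselect (eball x (theta * r) z)) => // h; rewrite memNset// mul0r eqxx.
  move: F1N0; rewrite /F1 indicE mem_set// mul1r => FN0.
  rewrite enormB -/v; split.
    apply/andP; split; last by rewrite enormB.
    rewrite lt_neqAle enorm_ge0 andbT eq_sym enorm_eq0.
    by apply: contraNneq FN0 => v0; rewrite /F -/v v0 /kap mxE mul0r normr0 mul0r.
  rewrite /F -/v mulrC mulrA; apply: ler_pM => //.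
  exact: tent_lip.
- rewrite /F2 indicator_integral ?powR_ge0 ?divr_gt0// lee_fin.
  apply: (@le_trans _ _ ((theta * r) `^ (- s) * (t `^ s * B0 / (2 ^+ k) ^+ d.+1))).
    by apply: ler_wpM2l; [exact: powR_ge0|exact: mass].
  rewrite powRM ?(ltW th0) ?(ltW r0)//.
  apply: (@le_trans _ _ (theta `^ (- s) * (t `^ (- s) * (2 ^+ k.+1) ^+ d) * (t `^ s * B0 / (2 ^+ k) ^+ d.+1))).
    apply: ler_wpM2r; first by rewrite divr_ge0 ?mulr_ge0 ?powR_ge0// exprn_ge0// ltW.
    by apply: ler_wpM2l; [exact: powR_ge0|exact: dyadic_powRN].
  have tt : t `^ (- s) * t `^ s = 1 by rewrite powRN mulVf// gt_eqF// powR_gt0.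
  have pk : (2 ^+ k) ^+ d != 0 :> R by rewrite gt_eqF// exprn_gt0.
  have pk' : 2 ^+ k != 0 :> R by rewrite gt_eqF.
  rewrite [leLHS](_ : _ = (2 ^+ d * theta `^ (- s) * B0) * ((t `^ (- s) * t `^ s) * (2 ^+ k)^-1)); last first.
    by rewrite exprS exprMn [X in _ / X]exprS; field; rewrite pk pk'.
  rewrite tt mul1r ler_piMr//; first by rewrite mulr_ge0// mulr_ge0 ?powR_ge0// exprn_ge0.
  by rewrite invf_le1// exprn_ege1// ler1n.
- rewrite ge0_integral_sum//; last 2 first.
  + by move=> i; exact/measurable_EFinP.
  + by move=> i z _; rewrite lee_fin.
  (* The kernel loses at most (4 2^i)^d and the mass gains (2^i)^(d+1): the shells form a geometric
     series. *)
  apply: (@le_trans _ _ (\sum_(i < k) ((4 ^+ d * B0) * (2 ^+ i)^-1)%:E)%E).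
    apply: lee_sum => i _; rewrite /F3 indicator_integral ?powR_ge0 ?divr_gt0// lee_fin.
    apply: (@le_trans _ _ ((t `^ (- s) * (2 ^+ i.+2) ^+ d) * (t `^ s * B0 / (2 ^+ i) ^+ d.+1))).
      apply: ler_pM; [exact: powR_ge0|exact: fine_ge0|exact: dyadic_powRN|].
      by apply: mass; exact: ltnW.
    have tt : t `^ (- s) * t `^ s = 1 by rewrite powRN mulVf// gt_eqF// powR_gt0.
    have pk : (2 ^+ i) ^+ d != 0 :> R by rewrite gt_eqF// exprn_gt0.
    have pk' : 2 ^+ i != 0 :> R by rewrite gt_eqF.
    rewrite [leLHS](_ : _ = (t `^ (- s) * t `^ s) * (4 ^+ d * B0 / 2 ^+ i)); first by rewrite tt mul1r.
    have -> : 2 ^+ i.+2 = 4 * 2 ^+ i :> R by rewrite !exprS; ring.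
    by rewrite exprMn [X in _ / X]exprS; field; rewrite pk pk'.
  rewrite sumEFin lee_fin -mulr_sumr.
  have geo : \sum_(i < k) (2 ^+ i)^-1 <= 2 :> R.
    have -> : \sum_(i < k) (2 ^+ i)^-1 = 2 - 2 / 2 ^+ k :> R.
      elim: k {mass dr xB F2 F20 m2 main mF F F0 Fkap F1 F10 m1 sum0 r r0 thr0 mt} => [|k IH].
        by rewrite big_ord0 expr0 divr1 subrr.
      rewrite big_ord_recr/= IH exprS; have := p k => pk; field; exact: lt0r_neq0.
    by rewrite lerBlDr lerDl divr_ge0// ltW.
  rewrite mulrC -mulrA; apply: ler_wpM2r => //.
  by rewrite mulr_ge0// exprn_ge0.
- rewrite /F4; under eq_integral do rewrite EFinM.
  rewrite ge0_integralZl//; last 2 first.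
  + by apply/measurable_EFinP; apply: measurable_ker => i; exact: measurable_coordB.
  + by move=> z _; rewrite lee_fin ker_ge0.
  by rewrite (density_EFin mu_nice s_gt0 x t20) -EFinM mulrA.
Qed.

End InteractionBound.

(** * Null balls by dyadic covering *)

Section Covering.
Context {R : realType} {d : nat}.
Local Notation Rd := (@Rdm R d).
Variables (mu : {measure set Rd -> \bar R}) (s Lam : R).
Hypothesis mu_nice : nice s Lam mu.
Implicit Types (x y : 'rV[R]_d) (t r : R).

Lemma grid_point (a h : R) (n : nat) : 0 < h -> 0 <= a < n%:R * h ->
  exists i : 'I_n, `|a - i%:R * h| <= h.
Proof.
move=> h0 /andP[a0 an]; have ah0 : 0 <= a / h by rewrite divr_ge0// ltW.
have := truncn_itv ah0 => /andP[t1 t2].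
have tn : (Num.truncn (a / h) < n)%N.
  by rewrite -(ltr_nat R); apply: (le_lt_trans t1); rewrite ltr_pdivrMr.
exists (Ordinal tn) => /=; move: t1 t2; rewrite ler_pdivlMr// ltr_pdivrMr// => t1 t2.
rewrite ger0_norm; first by move: t2; rewrite -addn1 natrD mulrDl mul1r; lra.
by rewrite subr_ge0.
Qed.

Lemma measure_bigsetU_le (I : Type) (r : seq I) (F : I -> set Rd) : (forall i, measurable (F i)) ->
  (mu (\big[setU/set0]_(i <- r) F i) <= \sum_(i <- r) mu (F i))%E.
Proof.
move=> mF; elim: r => [|i r IH]; first by rewrite !big_nil measure0.
rewrite !big_cons; apply: (le_trans (measureU2 _ _ _)) => //; last exact: leeD.
by apply: bigsetU_measurable.
Qed.

(** A ball is covered by 2^(n d) balls of radius t / 2^n, each of mass at most A 2^(-n(d+1)); the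
    total A 2^-n tends to 0. *)
Lemma null_ball x0 t (A : R) : 0 < t ->
  (forall n y, eball x0 (t / 4) y ->
     (mu (eball y (t / 2 ^+ n)) <= (A / (2 ^+ n) ^+ d.+1)%:E)%E) ->
  mu (eball x0 (t / (8 * d.+1%:R))) = 0%E.
Proof.
move=> t0 hA; set rho := t / (8 * d.+1%:R).
have d0 : 0 < d.+1%:R :> R by rewrite ltr0n.
have rho0 : 0 < rho by rewrite divr_gt0// mulr_gt0.
have rt : rho * (8 * d.+1%:R) = t by rewrite /rho divfK// gt_eqF// mulr_gt0.
have A0 : 0 <= A.
  have := hA 0%N x0; rewrite /eball/= subrr enorm0 expr0 expr1n !divr1 divr_gt0// => /(_ isT).
  by move=> h; rewrite -lee_fin; apply: le_trans h.
have step n : (mu (eball x0 rho) <= (A / 2 ^+ n)%:E)%E.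
  have p : 0 < 2 ^+ n :> R by rewrite exprn_gt0.
  (* The mesh of the grid on the cube of half-side rho. With rho = t / (8 (d+1)), balls of radius t
     / 2^n around the grid points cover, and all grid points are within t/4 of x0. *)
  pose h : R := 2 * rho / 2 ^+ n.
  have h0 : 0 < h by rewrite divr_gt0// mulr_gt0.
  have nh : (2 ^ n)%:R * h = 2 * rho by rewrite natrX /h mulrC divfK// gt_eqF.
  pose c (f : {ffun 'I_d -> 'I_(2 ^ n)}) : 'rV[R]_d := \row_i (x0 ord0 i - rho + (f i)%:R * h).
  have cx f : eball x0 (t / 4) (c f).
    rewrite /eball/=; apply: (@le_lt_trans _ _ (d%:R * rho)).
      apply: enorm_le_coord => [|i]; first exact: ltW.
      rewrite !mxE (_ : _ - _ = (f i)%:R * h - rho); last by ring.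
      have f0 : 0 <= (f i)%:R * h by rewrite mulr_ge0// ltW.
      have f1 : (f i)%:R * h <= 2 * rho.
        by rewrite -nh ler_wpM2r ?(ltW h0)// ler_nat ltnW.
      by rewrite ler_norml; apply/andP; split; lra.
    rewrite ltr_pdivlMr// -rt.
    have : d%:R * rho < d.+1%:R * rho by rewrite ltr_pM2r// ltr_nat.
    have : 0 <= d%:R * rho by rewrite mulr_ge0// ltW.
    lra.
  have cover : eball x0 rho `<=` \bigcup_(f in [set: {ffun 'I_d -> 'I_(2 ^ n)}]) eball (c f) (t / 2 ^+ n).
    move=> x xr.
    have hx i : exists k : 'I_(2 ^ n), `|(x ord0 i - x0 ord0 i + rho) - k%:R * h| <= h.
      apply: grid_point => //; rewrite nh.
      have := coord_le (x - x0) i; rewrite !mxE ler_norml => /andP[h1 h2].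
      by move: xr; rewrite /eball/= => xr; apply/andP; split; lra.
    have /choice[f hf] := hx.
    exists (finfun f) => //; rewrite /eball/=; apply: (@le_lt_trans _ _ (d%:R * h)).
      apply: enorm_le_coord => [|i]; first exact: ltW.
      rewrite !mxE ffunE; apply: le_trans (hf i).
      by rewrite (_ : _ - _ = x ord0 i - x0 ord0 i + rho - (f i)%:R * h)//; ring.
    rewrite /h mulrA ltr_pM2r ?invr_gt0// -rt.
    have : d%:R * rho < d.+1%:R * rho by rewrite ltr_pM2r// ltr_nat.
    have : 0 <= d%:R * rho by rewrite mulr_ge0// ltW.
    lra.
  apply: (@le_trans _ _ (\sum_(f : {ffun 'I_d -> 'I_(2 ^ n)}) mu (eball (c f) (t / 2 ^+ n)))%E).
    apply: le_trans (measure_bigsetU_le _ _); last by move=> f; exact: measurable_eball.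
    apply: le_measure; rewrite ?inE; first exact: measurable_eball.
      by apply: bigsetU_measurable => f _; exact: measurable_eball.
    by move=> x /cover[f _ xf]; rewrite (bigD1 f)//=; left.
  apply: (@le_trans _ _ (\sum_(f : {ffun 'I_d -> 'I_(2 ^ n)}) (A / (2 ^+ n) ^+ d.+1)%:E)%E).
    by apply: lee_sum => f _; apply: hA.
  rewrite sumEFin lee_fin sumr_const card_ffun !card_ord -[leLHS]mulr_natl natrX natrX.
  have pd : (2 ^+ n) ^+ d != 0 :> R by rewrite gt_eqF// exprn_gt0.
  by rewrite le_eqVlt; apply/orP; left; apply/eqP; rewrite exprS; field; rewrite pd gt_eqF.
apply/eqP; rewrite -measure_le0 leNgt; apply/negP => m0.
have mfin : (mu (eball x0 rho) < +oo)%E by apply: le_lt_trans (step 0%N) _; rewrite ltry.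
have [m mE] : exists m : R, mu (eball x0 rho) = m%:E.
  by exists (fine (mu (eball x0 rho))); rewrite fineK// ge0_fin_numE.
have {}m0 : 0 < m by rewrite -lte_fin -mE.
have Am0 : 0 <= A / m by rewrite divr_ge0// ltW.
have : m <= A / 2 ^+ Num.bound (A / m) by rewrite -lee_fin -mE; exact: step.
rewrite leNgt => /negP; apply.
rewrite ltr_pdivrMr ?exprn_gt0// mulrC -ltr_pdivrMr//.
apply: (lt_trans (archi_boundP Am0)); rewrite -natrX ltr_nat; exact: ltn_expl.
Qed.

End Covering.

(** * Pointwise bound for the field on the support *)

Section FieldBound.
Context {R : realType} {d : nat}.
Local Notation Rd := (@Rdm R d).
Variable mu : {sigma_finite_measure set Rd -> \bar R}.
Variables (s Lam : R).
Hypothesis mu_nice : nice s Lam mu.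
Hypothesis s_gt0 : 0 < s.
Hypothesis Lam_ge0 : 0 <= Lam.
Hypothesis s_ltd : s < d%:R.
Implicit Types (x y : 'rV[R]_d) (t r : R) (c : 'I_d -> R).

(** The form in which reflectionlessness is used from here on: for the right constant c, the mean of
    the field against a tent is bounded by interactions, with truncations below some delta0. *)
Definition balanced c := forall j y (r u Q delta0 : R), 0 < r -> 0 < u -> 0 <= Q -> 0 < delta0 ->
  (forall delta, 0 < delta < delta0 -> forall x, eball y r x ->
    (\int[mu]_z (`|(x - (z : 'rV[R]_d)) ord0 j * (tker s delta (x - (z : 'rV[R]_d)) - ker s u (x - (z : 'rV[R]_d)))| *
       `|tent y r x - tent y r z|)%:E <= Q%:E)%E) ->
  `|\int[mu]_x (tent y r x * field mu s c u j x)| <= Q * fine (mu (eball y r)).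

Lemma reflectionless_balanced : reflectionless s mu -> (exists p, supp mu p) ->
  exists c, balanced c.
Proof.
move=> refl sp; have [c hc] := force_balance mu_nice s_gt0 Lam_ge0 refl sp.
exists c => j y r u Q delta0 r0 u0 Q0 d0 h.
apply: le_trans (hc j y r u Q delta0 r0 u0 Q0 d0 h).
suff -> : \int[mu]_x (tent y r x * field mu s c u j x) =
  \int[mu]_x (tent y r (x : Rd) * (rfield mu s u j x - c j)) by [].
apply: eq_Rintegral => x _.
by rewrite /field -(integral_supp mu_nice s_gt0 (dominated_riesz s_gt0 j x u0)).
Qed.

Lemma signed_lower (g a b K : R) : `|g| = 1 -> `|b| = g * b -> `|a - b| <= K -> `|b| - K <= g * a.
Proof.
move=> g1 eb h; have : `|g * (a - b)| <= K by rewrite normrM g1 mul1r.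
by rewrite mulrBr -eb ler_norml => /andP[+ _]; lra.
Qed.

Lemma gap_lower (a b e f g : R) : a + b < e -> e - f <= g -> f <= a -> b <= g.
Proof. lra. Qed.

Lemma half_assoc (p K w m : R) : 2 * p * K * w * (1 / 2 * m) = K * w * (p * m).
Proof. by field. Qed.

Lemma tent_field_integrable c u j y r : 0 < r -> 0 < u ->
  mu.-integrable setT (EFin \o (fun x => tent y r x * field mu s c u j x)).
Proof.
move=> r0 u0.
have mt := @measurable_tent R d y r r0.
have t1 x : `|tent y r x| <= 1 by rewrite ger0_norm ?tent_ge0 ?tent_le1.
have tout (x : Rd) : ~ eball y r x -> tent y r x = 0 by exact: tent_out.
have au : admissible_kernel s j (fun v => v ord0 j * ker s u v) by exact: admissible_ker.
have iu := kernel_field_integrable mu_nice s_gt0 Lam_ge0 au r0 mt ler01 t1 tout.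
have it := integrableZl measurableT (c j) (tent_integrable mu_nice y r0).
apply: eq_integrable (integrableB measurableT iu it) => // x _ /=.
rewrite -EFinB; congr EFin; rewrite /field -(integral_supp mu_nice s_gt0 (dominated_riesz s_gt0 j x u0)).
by rewrite mulrBr [c j * _]mulrC.
Qed.

(** K2 is the oscillation constant of [field_sub_le]. K3 collects the four terms of
    [interaction_bound], each measured against W = theta + theta^-s P, with the density at nearby
    points compared to that at x0 by 3^((s+1)/2). *)
Let K2 : R := 3 `^ ((s + 1) / 2) + (s + 1) / 2 * 3 `^ ((s + 1) / 2 + 1) * (3 + 1).
Let K3 : R := 2 `^ (s + 1) * Lam + 2 ^+ d * (2 ^+ d.+1 * 5 `^ ((s + 1) / 2)) +
  2 * 4 ^+ d * (2 ^+ d.+1 * 5 `^ ((s + 1) / 2)) +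
  (s + 1) / 2 * 5 `^ ((s + 1) / 2 + 1) * 3 `^ ((s + 1) / 2).

Lemma K3_gt0 : 0 < K3.
Proof.
have h : 0 < 2 ^+ d * (2 ^+ d.+1 * 5 `^ ((s + 1) / 2)) :> R.
  by rewrite !mulr_gt0 ?exprn_gt0 ?powR_gt0.
have a0 := exponent_ge0 s_gt0.
have h1 : 0 <= 2 `^ (s + 1) * Lam by nonneg.
have h2 : 0 <= 2 * 4 ^+ d * (2 ^+ d.+1 * 5 `^ ((s + 1) / 2)) :> R by nonneg.
have h3 : 0 <= (s + 1) / 2 * 5 `^ ((s + 1) / 2 + 1) * 3 `^ ((s + 1) / 2) by nonneg.
rewrite /K3; lra.
Qed.

(* If the field at x0, at scale t, is large compared with the density at that
   scale, the force balance makes the mass of B(y, r) decay like r^{d+1} near x0. *)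
Lemma mass_decay c x0 t theta (W P B0 : R) j : balanced c -> 0 < t -> 0 < theta -> theta <= 1 ->
  P = t * density mu s (t ^+ 2) x0 -> W = theta + theta `^ (- s) * P ->
  B0 = 2 ^+ d.+1 * 5 `^ ((s + 1) / 2) * P ->
  (K2 + 2 ^+ d.+2 * K3) * W < `|field mu s c (t ^+ 2) j x0| ->
  forall y, eball x0 (t / 4) y -> forall k i, (i <= k.+1)%N ->
    fine (mu (eball y (t / 2 ^+ i))) <= t `^ s * B0 / (2 ^+ i) ^+ d.+1.
Proof.
move=> bal t0 th0 th1 eP eW eB large y yx0.
have t20 : 0 < t ^+ 2 by exact: exprn_gt0.
have p n : 0 < 2 ^+ n :> R by rewrite exprn_gt0.
have P0 : 0 <= P by rewrite eP mulr_ge0 ?density_ge0// ltW.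
have B00 : 0 <= B0 by rewrite eB; nonneg.
have ths : 1 <= theta `^ (- s).
  by have := powRN_le (ltW s_gt0) th0 th1; rewrite powR1.
have PW : theta `^ (- s) * P <= W by rewrite eW; lra.
have PthP : P <= theta `^ (- s) * P by rewrite ler_peMl.
have thP0 : 0 <= theta `^ (- s) * P by nonneg.
have W0 : 0 < W by rewrite eW; lra.
have Bfin q x : 0 < q -> (mu (eball x q) < +oo)%E by move=> q0; exact: (eball_fin mu_nice).
have ball_mono x x' (q q' : R) : 0 < q' -> enorm (x - x') + q <= q' ->
    fine (mu (eball x q)) <= fine (mu (eball x' q')).
  move=> q'0 h; have [q0|q0] := ltP 0 q; last first.
    have -> : eball x q = set0.
      apply/seteqP; split => // z /=; rewrite /eball/= => hz.
      by have := enorm_ge0 (z - x); lra.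
    by rewrite measure0 fine_ge0.
  apply: fine_le; rewrite ?ge0_fin_numE ?Bfin//.
  apply: le_measure; rewrite ?inE; [exact: measurable_eball..|].
  by move=> z /=; rewrite /eball/= => hz; have := enorm_dist z x x'; lra.
have base (i : nat) : (i <= 1)%N -> fine (mu (eball y (t / 2 ^+ i))) <= t `^ s * B0 / (2 ^+ i) ^+ d.+1.
  move=> i1; apply: (@le_trans _ _ (fine (mu (eball x0 (2 * t))))).
    apply: ball_mono; first by rewrite mulr_gt0.
    have : t / 2 ^+ i <= t by rewrite ler_pdivrMr// ler_peMr ?(ltW t0)// exprn_ege1// ler1n.
    move: yx0; rewrite /eball/=; lra.
  apply: (le_trans (ball_le_density mu_nice s_gt0 x0 t0)); rewrite -eP eB.
  have -> : t `^ s * (2 ^+ d.+1 * 5 `^ ((s + 1) / 2) * P) / (2 ^+ i) ^+ d.+1 =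
     (5 `^ ((s + 1) / 2) * t `^ s * P) * (2 ^+ d.+1 / (2 ^+ i) ^+ d.+1) by ring.
  rewrite ler_peMr//; first by nonneg.
  rewrite ler_pdivlMr ?exprn_gt0// mul1r; apply: lerXn2r; [by rewrite nnegrE ltW|by rewrite nnegrE|].
  by case: i i1 => [|[|//]] _; rewrite ?expr0 ?expr1// ler1n.
(* Induction over scales: the bounds already known make the interactions of the tent of radius t /
   2^(k+1) at most K3 W, and the balance then yields the next scale. *)
elim=> [|k IH] i; first exact: base.
rewrite leq_eqVlt => /predU1P[->|]; last by rewrite ltnS; exact: IH.
set r := t / 2 ^+ k.+1.
have r0 : 0 < r by rewrite divr_gt0.
have rt : r <= t / 2.
  by rewrite /r ler_pM2l// lef_pV2 ?posrE// exprS ler_peMr// exprn_ege1// ler1n.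
have yx : enorm (y - x0) < t / 4 by [].
have near x : eball y r x -> enorm (x - x0) <= t.
  by rewrite /eball/= => xy; have := enorm_dist x y x0; lra.
have dens x : eball y r x -> t * density mu s (t ^+ 2) x <= 3 `^ ((s + 1) / 2) * P.
  move=> /near xx0; rewrite eP mulrCA; apply: ler_wpM2l; first exact: ltW.
  have mS := measurable_supp mu.
  rewrite /density -(IntM mu_nice s_gt0 mS _ (dominatedS _ (dominated_ker s_gt0 x0 t20))).
  apply: (Int_le mu_nice s_gt0 mS).
  - exact: dominatedS (dominated_ker s_gt0 x t20).
  - exact: dominatedM (dominatedS _ (dominated_ker s_gt0 x0 t20)).
  move=> z _; apply: ker_comparable => //.
  - by have := dotp_ge0 (x - (z : 'rV[R]_d)); lra.
  - by have := dotp_ge0 (x0 - (z : 'rV[R]_d)); lra.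
  - apply: weight_comparable; first by lra.
    by rewrite -enorm_sqr enormB; have := ler_sqr_ge0 (enorm_ge0 _) xx0; lra.
have inter : `|\int[mu]_x (tent y r x * field mu s c (t ^+ 2) j x)| <= (K3 * W) * fine (mu (eball y r)).
  apply: (bal j y r (t ^+ 2) (K3 * W) (theta * r)) => //.
  - by rewrite mulr_ge0 ?ltW// K3_gt0.
  - by rewrite mulr_gt0.
  move=> delta /andP[d0 dr] x xB.
  have := interaction_bound mu_nice s_gt0 s_ltd j t0 th0 th1 d0 dr B00 xB.
  move=> /(_ (fun i ik => IH i (leqW ik))) h; apply: (le_trans h); rewrite lee_fin.
  have far0 := far_const_ge0 s_gt0.
  have hd := dens x xB.
  have e1 : 2 `^ (s + 1) * Lam * theta <= 2 `^ (s + 1) * Lam * W.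
    apply: ler_wpM2l; first by nonneg.
    by rewrite eW lerDl; nonneg.
  have e2 : 2 ^+ d * theta `^ (- s) * B0 <= 2 ^+ d * (2 ^+ d.+1 * 5 `^ ((s + 1) / 2)) * W.
    rewrite eB [leLHS](_ : _ = 2 ^+ d * (2 ^+ d.+1 * 5 `^ ((s + 1) / 2)) * (theta `^ (- s) * P)); last by ring.
    by apply: ler_wpM2l => //; nonneg.
  have PW' : P <= W by exact: le_trans PthP PW.
  have e3 : 2 * 4 ^+ d * B0 <= 2 * 4 ^+ d * (2 ^+ d.+1 * 5 `^ ((s + 1) / 2)) * W.
    rewrite eB [leLHS](_ : _ = 2 * 4 ^+ d * (2 ^+ d.+1 * 5 `^ ((s + 1) / 2)) * P); last by ring.
    by apply: ler_wpM2l => //; nonneg.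
  have e4 : (s + 1) / 2 * 5 `^ ((s + 1) / 2 + 1) * (t * density mu s (t ^+ 2) x) <=
      (s + 1) / 2 * 5 `^ ((s + 1) / 2 + 1) * 3 `^ ((s + 1) / 2) * W.
    rewrite -[leRHS]mulrA; apply: ler_wpM2l => //; apply: (le_trans hd).
    by apply: ler_wpM2l => //; exact: powR_ge0.
  apply: (le_trans (lerD (lerD (lerD e1 e2) e3) e4)).
  by rewrite -!(mulrDl _ _ W).
(* On the tent the field keeps its sign and stays above H, its oscillation being at most K2 W. Of
   the factor 2^(d+2), one 2 pays for the tent being only 1/2 on the half ball; 2^(d+1) is the gain
   per dyadic step. *)
pose H := 2 ^+ d.+2 * K3 * W.
have K30 := K3_gt0.
have KW : 0 < K3 * W by exact: mulr_gt0.
have H0 : 0 < H by rewrite /H -mulrA; apply: mulr_gt0 => //; exact: exprn_gt0.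
have [sg sg1 esg] : exists2 sg : R, sg ^+ 2 = 1 & `|field mu s c (t ^+ 2) j x0| = sg * field mu s c (t ^+ 2) j x0.
  have [f0|f0] := leP 0 (field mu s c (t ^+ 2) j x0).
    by exists 1; rewrite ?expr1n// mul1r ger0_norm.
  by exists (-1); rewrite ?sqrrN ?expr1n// mulN1r ltr0_norm.
have sgn : `|sg| = 1 by apply/eqP; rewrite -(@eqrXn2 _ 2)// ?expr1n ?real_normK ?num_real// sg1.
have fH x : eball y r x -> H <= sg * field mu s c (t ^+ 2) j x.
  move=> xB; have := field_sub_le mu_nice s_gt0 c j t0 (near x xB); rewrite -/K2 -eP => hs.
  have h := signed_lower sgn esg hs.
  have K20 : 0 <= K2 by rewrite /K2; have a0 := exponent_ge0 s_gt0; nonneg.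
  have : K2 * P <= K2 * W by apply: ler_wpM2l => //; exact: le_trans PthP PW.
  by move=> KP; move: large; rewrite mulrDl => /gap_lower -/(_ _ _ h KP).
have it := tent_integrable mu_nice y r0.
have itf := tent_field_integrable c j y r0 t20.
have low : H * (\int[mu]_x tent y r (x : Rd)) <= (K3 * W) * fine (mu (eball y r)).
  apply: le_trans inter; rewrite -[leRHS]mul1r -sgn -normrM -!RintegralZl//.
  apply: le_trans (ler_norm _); apply: le_Rintegral => //.
  - exact: (integrableZl measurableT H it).
  - exact: (integrableZl measurableT sg itf).
  move=> x _; have [xB|nxB] := pselect (eball y r x); last first.
    by rewrite tent_out// !(mul0r, mulr0).
  by rewrite mulrCA mulrC; apply: ler_wpM2l; [exact: tent_ge0|exact: fH].
have low2 := tent_integral_ge mu_nice y r0.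
have low3 : H * (1 / 2 * fine (mu (eball y (r / 2)))) <= (K3 * W) * fine (mu (eball y r)).
  by apply: le_trans low; apply: ler_wpM2l => //; exact: ltW.
have er : r / 2 = t / 2 ^+ k.+2 by rewrite /r [in RHS]exprS; field; rewrite gt_eqF.
have low4 : 2 ^+ d.+1 * fine (mu (eball y (r / 2))) <= fine (mu (eball y r)).
  rewrite -(ler_pM2l KW); apply: le_trans low3.
  by rewrite /H [2 ^+ d.+2]exprS half_assoc.
rewrite er in low4.
have := IH k.+1 (leqnn _); rewrite -/r => low5.
have pd : 0 < 2 ^+ d.+1 :> R by [].
rewrite -(ler_pM2l pd); apply: (le_trans low4); apply: (le_trans low5).
have pk : (2 ^+ k.+1) ^+ d.+1 != 0 :> R by rewrite gt_eqF// exprn_gt0.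
have pd' : 2 ^+ d.+1 != 0 :> R by rewrite gt_eqF.
rewrite le_eqVlt; apply/orP; left; apply/eqP.
by rewrite [2 ^+ k.+2]exprS exprMn; field; rewrite pk pd'.
Qed.

(** If the bound failed at x0, [mass_decay] would supply the hypothesis of [null_ball], and a ball
    around a point of the support would be null. *)
Lemma field_bound c : balanced c -> exists2 C : R, 0 <= C &
  forall theta, 0 < theta -> theta <= 1 -> forall x0, supp mu x0 -> forall t, 0 < t -> forall j,
    `|field mu s c (t ^+ 2) j x0| <= C * (theta + theta `^ (- s) * (t * density mu s (t ^+ 2) x0)).
Proof.
move=> bal; exists (K2 + 2 ^+ d.+2 * K3).
  have K30 := ltW K3_gt0.
  have K20 : 0 <= K2 by rewrite /K2; have a0 := exponent_ge0 s_gt0; nonneg.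
  by nonneg.
move=> theta th0 th1 x0 sx0 t t0 j; rewrite leNgt; apply/negP => large.
have decay := mass_decay bal t0 th0 th1 erefl erefl erefl large.
have r0 : 0 < t / (8 * d.+1%:R) by rewrite divr_gt0// mulr_gt0// ltr0n.
have null := @null_ball R d mu x0 t
  (t `^ s * (2 ^+ d.+1 * 5 `^ ((s + 1) / 2) * (t * density mu s (t ^+ 2) x0))) t0.
have := sx0 _ r0; rewrite null ?ltxx// => n y yx; rewrite -[leLHS]fineK; last first.
  rewrite ge0_fin_numE//; apply: (eball_fin mu_nice).
  by rewrite divr_gt0// exprn_gt0.
by rewrite lee_fin; apply: (decay y yx n).
Qed.

End FieldBound.

(** * Second-order jets *)

Section Taylor.
Context {R : realType}.
Implicit Types (a h t M : R) (k : nat).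

(** A primitive vanishing at 0 gains one order; applied repeatedly, it produces the Taylor
    expansions below. *)
Lemma primitive_bound (G g : R -> R) M k : 0 <= M -> G 0 = 0 ->
  (forall t, `|t| <= 1 / 2 -> is_derive t 1 G (g t)) ->
  (forall t, `|t| <= 1 / 2 -> `|g t| <= M * `|t| ^+ k) ->
  forall t, `|t| <= 1 / 2 -> `|G t| <= M * `|t| ^+ k.+1.
Proof.
move=> M0 G0 dG gM t th.
have bnd z : `|z| <= `|t| -> `|g z * t| <= M * `|t| ^+ k.+1.
  move=> zt; rewrite normrM exprSr mulrA; apply: ler_wpM2r => //.
  apply: le_trans (gM _ (le_trans zt th)) _; apply: ler_wpM2l => //.
  by apply: lerXn2r; rewrite ?nnegrE.
have [t0|t0] := leP 0 t.
  have [z|z /andP[z0 zt]] := @mean_value R G g 0 t t0.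
    move=> /andP[z0 zt]; apply: dG; apply: le_trans th.
    by rewrite !ger0_norm// (le_trans z0).
  rewrite G0 !subr0 => ->; apply: bnd.
  by rewrite !ger0_norm// (le_trans z0).
have [z|z /andP[z0 zt]] := @mean_value R G g t 0 (ltW t0).
  move=> /andP[z0 zt]; apply: dG; apply: le_trans th.
  by rewrite !ler0_norm ?lerN2// ltW.
rewrite G0 !sub0r mulrN => /oppr_inj ->; apply: bnd.
by rewrite !ler0_norm ?lerN2// ltW.
Qed.

Let F a h := (1 + h) `^ (- a).

Lemma is_derive_F a h : `|h| <= 1 / 2 -> is_derive h 1 (F a) (- a * F (a + 1) h).
Proof.
rewrite ler_norml => /andP[h1 h2]; have p : 0 < 1 + h by lra.
have e : - a * F (a + 1) h = - a * (1 + h) `^ (- a - 1) * 1.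
  by rewrite mulr1 /F opprD.
rewrite e; apply: (@is_derive1_comp _ (fun z => z `^ (- a)) (fun z => 1 + z)).
  exact: is_derive1_powR.
have := @is_deriveD R R^o R^o (cst 1) id h 1 0 1 (is_derive_cst _ _ _) (is_derive_id _ _).
by rewrite add0r.
Qed.

Lemma powRN_taylor0 a : 0 <= a -> exists2 M, 0 <= M &
  forall h, `|h| <= 1 / 2 -> `|F a h - 1| <= M * `|h|.
Proof.
move=> a0; exists (a * (1 / 2) `^ (- (a + 1))); first by rewrite mulr_ge0// powR_ge0.
move=> h hh; rewrite -[X in _ * X]expr1.
apply: (@primitive_bound (fun h => F a h - 1) (fun h => - a * F (a + 1) h)) => //.
- by rewrite mulr_ge0// powR_ge0.
- by rewrite /F addr0 powR1 subrr.
- move=> t ht; have := @is_derive_F a t ht => ?.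
  by rewrite -[X in is_derive _ _ _ X]subr0; apply: is_deriveB.
move=> t; rewrite ler_norml => /andP[t1 t2].
rewrite expr0 mulr1 normrM normrN !ger0_norm ?powR_ge0//; apply: ler_wpM2l => //.
by apply: powRN_le; lra.
Qed.

Lemma powRN_taylor1 a : 0 <= a -> exists2 M, 0 <= M &
  forall h, `|h| <= 1 / 2 -> `|F a h - (1 - a * h)| <= M * `|h| ^+ 2.
Proof.
move=> a0; have a1 : 0 <= a + 1 by lra.
have [M M0 hM] := powRN_taylor0 a1.
exists (a * M); first exact: mulr_ge0.
apply: (@primitive_bound (fun h => F a h - (1 - a * h)) (fun h => - a * F (a + 1) h - (0 - a)) (a * M) 1).
- exact: mulr_ge0.
- by rewrite /F addr0 powR1 mulr0 subr0 subrr.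
- move=> t ht; have := @is_derive_F a t ht => ?.
  apply: is_deriveB; apply: is_deriveB.
  by rewrite -[X in is_derive _ _ _ X]mulr1; apply: is_deriveZ.
move=> t ht; rewrite (_ : _ - _ = - a * (F (a + 1) t - 1)); last by ring.
by rewrite normrM normrN (ger0_norm a0) -mulrA; apply: ler_wpM2l => //; exact: hM.
Qed.

Lemma powRN_taylor2 a : 0 <= a -> exists2 M, 0 <= M &
  forall h, `|h| <= 1 / 2 ->
  `|F a h - (1 - a * h + a * (a + 1) / 2 * h ^+ 2)| <= M * `|h| ^+ 3.
Proof.
move=> a0; have a1 : 0 <= a + 1 by lra.
have [M M0 hM] := powRN_taylor1 a1.
exists (a * M); first exact: mulr_ge0.
apply: (@primitive_bound (fun h => F a h - (1 - a * h + a * (a + 1) / 2 * h ^+ 2))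
   (fun h => - a * F (a + 1) h - (0 - a + a * (a + 1) / 2 * (2 * h))) (a * M) 2).
- exact: mulr_ge0.
- by rewrite /F addr0 powR1 mulr0 expr0n mulr0 subr0 addr0 subrr.
- move=> t ht; have := @is_derive_F a t ht => ?.
  apply: is_deriveB; apply: is_deriveD.
    by apply: is_deriveB; rewrite -[X in is_derive _ _ _ X]mulr1; apply: is_deriveZ.
  apply: is_deriveZ; rewrite -[2 * t]mulr1.
  by have := @is_deriveX R R^o id 2 t 1 1 (is_derive_id _ _); rewrite expr1.
move=> t ht; rewrite (_ : _ - _ = - a * (F (a + 1) t - (1 - (a + 1) * t))); last by field.
by rewrite normrM normrN (ger0_norm a0) -mulrA; apply: ler_wpM2l => //; exact: hM.
Qed.

(** The scale-free model of both kernels along a line: dividing lengths by sqrt(w) leaves (p + e z)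
    (1 + b z + c z^2)^-a with bounded coefficients. The scalar kernel is p = 1, e = 0. The radius
    keeps |b z + c z^2| <= 1/2. *)
Lemma quadratic_jet a (B : R) : 0 <= a -> 0 <= B -> exists2 K, 0 <= K &
  forall b c p e z : R, `|b| <= B -> `|c| <= 1 -> `|p| <= 1 -> `|e| <= 1 ->
  `|z| <= (2 * (B + 1))^-1 -> `|b * z + c * z ^+ 2| <= 1 / 2 /\
  `|(p + e * z) * F a (b * z + c * z ^+ 2) - (p + (e - a * b * p) * z +
     (p * (a * (a + 1) / 2 * b ^+ 2 - a * c) - a * b * e) * z ^+ 2)| <= K * `|z| ^+ 3.
Proof.
move=> a0 B0; have [M M0 hM] := powRN_taylor2 a0.
have A0 : 0 <= a * (a + 1) / 2 by apply: divr_ge0 => //; apply: mulr_ge0; lra.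
set A := a * (a + 1) / 2 in hM A0 *.
exists (2 * (M * (B + 1) ^+ 3) + (A * (2 * B + 1) + (a + A * (B ^+ 2 + 2 * B + 1)))).
  have : 0 <= M * (B + 1) ^+ 3 by rewrite mulr_ge0// exprn_ge0//; lra.
  have : 0 <= A * (2 * B + 1) by rewrite mulr_ge0//; lra.
  have : 0 <= A * (B ^+ 2 + 2 * B + 1) by rewrite mulr_ge0// !addr_ge0// ?exprn_ge0// mulr_ge0.
  lra.
move=> b c p e z bB c1 p1 e1 zr.
have B1 : 0 < 2 * (B + 1) by lra.
have zB : `|z| * (B + 1) <= 1 / 2.
  by move: zr; rewrite -[leRHS]mul1r ler_pdivlMr// mulrCA; lra.
have z0 := normr_ge0 z.
have z1 : `|z| <= 1.
  apply: (le_trans zr); rewrite invf_le1//; lra.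
have zz : `|z| ^+ 2 <= `|z| by rewrite expr2 ler_piMl.
have hz : `|b * z + c * z ^+ 2| <= (B + 1) * `|z|.
  apply: (le_trans (ler_normD _ _)); rewrite mulrDl mul1r (normrM b) (normrM c) normrX; apply: lerD.
    exact: ler_wpM2r.
  by apply: le_trans zz; rewrite ler_piMl// exprn_ge0.
have hh : `|b * z + c * z ^+ 2| <= 1 / 2 by apply: (le_trans hz); rewrite mulrC.
split=> //.
have hF := hM _ hh.
set f := F a _ in hF *.
have -> : (p + e * z) * f - (p + (e - a * b * p) * z +
     (p * (A * b ^+ 2 - a * c) - a * b * e) * z ^+ 2) =
   (p + e * z) * (f - (1 - a * (b * z + c * z ^+ 2) + A * (b * z + c * z ^+ 2) ^+ 2)) +
   (p * (A * (2 * b * c + c ^+ 2 * z)) + e * (- (a * c) + A * (b ^+ 2 + 2 * b * c * z + c ^+ 2 * z ^+ 2))) * z ^+ 3.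
  by ring.
apply: (le_trans (ler_normD _ _)); rewrite [leRHS]mulrDl; apply: lerD.
  rewrite normrM -[leRHS]mulrA; apply: ler_pM => //.
    apply: (le_trans (ler_normD _ _)); rewrite normrM.
    have : `|e| * `|z| <= 1 * 1 by apply: ler_pM.
    lra.
  apply: (le_trans hF); rewrite -mulrA; apply: ler_wpM2l => //; rewrite -exprMn.
  by apply: lerXn2r; rewrite ?nnegrE//; exact: le_trans hz.
rewrite normrM normrX; apply: ler_wpM2r; first by rewrite exprn_ge0.
have bb : `|b| ^+ 2 <= B ^+ 2 by apply: lerXn2r; rewrite ?nnegrE.
have cc : `|c| ^+ 2 <= 1 by apply: exprn_ile1.
have z2 : `|z| ^+ 2 <= 1 by apply: exprn_ile1.
have bc : `|2 * b * c| <= 2 * B.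
  rewrite -mulrA normrM ger0_norm//; apply: ler_wpM2l => //.
  by rewrite normrM -[leRHS]mulr1; apply: ler_pM.
have ccz : `|c ^+ 2 * z| <= 1 by rewrite normrM normrX mulr_ile1// exprn_ge0.
have cczz : `|c ^+ 2 * z ^+ 2| <= 1 by rewrite normrM !normrX mulr_ile1// exprn_ge0.
have bcz : `|2 * b * c * z| <= 2 * B.
  by rewrite normrM -[leRHS]mulr1; apply: ler_pM.
have ac : `|- (a * c)| <= a.
  by rewrite normrN normrM ger0_norm// ler_piMr.
apply: (le_trans (ler_normD _ _)); rewrite (normrM p) (normrM A) (normrM e) (ger0_norm A0); apply: lerD.
  rewrite -[leRHS]mul1r; apply: ler_pM => //; first exact: mulr_ge0.
  by apply: ler_wpM2l => //; apply: (le_trans (ler_normD _ _)); exact: lerD.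
rewrite -[leRHS]mul1r; apply: ler_pM => //; apply: (le_trans (ler_normD _ _)).
apply: lerD => //; rewrite normrM (ger0_norm A0); apply: ler_wpM2l => //.
apply: (le_trans (ler_normD _ _)); apply: lerD => //.
by apply: (le_trans (ler_normD _ _)); apply: lerD => //; rewrite normrX.
Qed.

End Taylor.

(** * Jets of the smoothed kernels *)

Section KernelJets.
Context {R : realType} {d : nat}.
Local Notation Rd := (@Rdm R d).
Variable s : R.
Hypothesis s_gt0 : 0 < s.
Implicit Types (u om m t : R) (v x y xi : 'rV[R]_d).

Let a : R := (s + 1) / 2.

(* First and second order coefficients at t = 0 of the kernels w^(-a) and
   v_j w^(-a), w = |v|^2 + u, along (v, u) + t (xi, om). *)
Definition ker_d1 xi om u v : R :=
  - a * (2 * dotp v xi + om) / (dotp v v + u) * ker s u v.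

Definition ker_d2 xi om u v : R :=
  (a * (a + 1) / 2 * (2 * dotp v xi + om) ^+ 2 / (dotp v v + u) - a * dotp xi xi) /
    (dotp v v + u) * ker s u v.

Definition riesz_d1 xi om j u v : R :=
  (xi ord0 j - a * (2 * dotp v xi + om) * v ord0 j / (dotp v v + u)) * ker s u v.

Definition riesz_d2 xi om j u v : R :=
  (v ord0 j * (a * (a + 1) / 2 * (2 * dotp v xi + om) ^+ 2 / (dotp v v + u) - a * dotp xi xi) -
    a * (2 * dotp v xi + om) * xi ord0 j) / (dotp v v + u) * ker s u v.

(** Rescaling by sqrt(w) >= m reduces to [quadratic_jet]. The vector kernel carries one length more
    than the scalar one, hence m^-2 instead of m^-3 in the error. *)
Lemma kernel_jet (B : R) : 0 <= B -> exists2 K, 0 <= K &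
  forall m u v xi om t, 0 < m -> m ^+ 2 <= dotp v v + u -> 0 <= u -> enorm xi <= 1 ->
  `|om| <= B * m -> `|t| <= (2 * (B + 3))^-1 * m ->
  [/\ (dotp v v + u) / 2 <= dotp (v + t *: xi) (v + t *: xi) + (u + t * om),
   `|ker s (u + t * om) (v + t *: xi) - (ker s u v + t * ker_d1 xi om u v + t ^+ 2 * ker_d2 xi om u v)|
      <= K * `|t| ^+ 3 / m ^+ 3 * ker s u v &
   forall j, `|(v + t *: xi) ord0 j * ker s (u + t * om) (v + t *: xi) -
      (v ord0 j * ker s u v + t * riesz_d1 xi om j u v + t ^+ 2 * riesz_d2 xi om j u v)|
      <= K * `|t| ^+ 3 / m ^+ 2 * ker s u v].
Proof.
move=> B0; have a0 : 0 <= a := exponent_ge0 s_gt0.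
have B20 : 0 <= B + 2 by lra.
(* B + 2 bounds the slope (2 v.xi + om) / sqrt(w), because |v| <= sqrt(w), |xi| <= 1 and |om| <= B
   m. *)
have [K K0 hK] := quadratic_jet a0 B20; exists K => // m u v xi om t m0 mw u0 xi1 omB tm.
set w := dotp v v + u in mw *.
have w0 : 0 < w by apply: lt_le_trans mw; exact: exprn_gt0.
pose sg := Num.sqrt w.
have sg0 : 0 < sg by rewrite sqrtr_gt0.
have sg2 : sg ^+ 2 = w by rewrite sqr_sqrtr// ltW.
have sgm : m <= sg.
  by rewrite -(ler_pXn2r (_ : (0 < 2)%N)) ?nnegrE ?sg2// ltW.
have vsg : enorm v <= sg.
  by rewrite -(ler_pXn2r (_ : (0 < 2)%N)) ?nnegrE ?sg2 ?(ltW sg0)// enorm_sqr /w; lra.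
pose b := 2 * dotp v xi + om.
have bB : `|b / sg| <= B + 2.
  rewrite normrM normfV (gtr0_norm sg0) ler_pdivrMr//.
  apply: (le_trans (ler_normD _ _)); rewrite (mulrDl B) [leRHS]addrC; apply: lerD.
    rewrite normrM ger0_norm//; apply: ler_wpM2l => //; apply: (le_trans (cauchy_schwarz _ _)).
    by rewrite -[sg]mulr1; apply: ler_pM.
  by apply: (le_trans omB); apply: ler_wpM2l.
have c1 : `|dotp xi xi| <= 1.
  by rewrite ger0_norm ?dotp_ge0// -enorm_sqr; apply: exprn_ile1.
have zr : `|t / sg| <= (2 * (B + 2 + 1))^-1.
  rewrite normrM normfV (gtr0_norm sg0) ler_pdivrMr//; apply: (le_trans tm).
  rewrite (_ : B + 2 + 1 = B + 3); last by ring.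
  by apply: ler_wpM2l => //; rewrite invr_ge0; lra.
set h := b / sg * (t / sg) + dotp xi xi * (t / sg) ^+ 2 in hK.
have ew : dotp (v + t *: xi) (v + t *: xi) + (u + t * om) = w * (1 + h).
  rewrite !(dotpDl, dotpDr, dotpZl, dotpZr) (dotpC xi v) /h -sg2 /b.
  have := sg2; rewrite /w => e; have -> : u = sg ^+ 2 - dotp v v by rewrite e; ring.
  by field; rewrite gt_eqF.
have z3 : `|t / sg| ^+ 3 = `|t| ^+ 3 / sg ^+ 3.
  by rewrite normrM normfV (gtr0_norm sg0) exprMn exprVn.
have k0 := ker_ge0 s u v.
have ek : `|h| <= 1 / 2 -> ker s (u + t * om) (v + t *: xi) = ker s u v * (1 + h) `^ (- a).
  rewrite ler_norml => /andP[h1 h2]; rewrite /ker ew powRM ?(ltW w0)//; lra.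
have sgn0 : sg != 0 by rewrite gt_eqF.
have wE : dotp v v + u = sg ^+ 2 by rewrite sg2.
split.
- have n1 : `|1 : R| <= 1 by rewrite normr1.
  have n0 : `|0 : R| <= 1 by rewrite normr0.
  have [hh _] := hK (b / sg) _ 1 0 (t / sg) bB c1 n1 n0 zr.
  move: hh; rewrite -/h ler_norml ew => /andP[h1 _]; rewrite ler_pM2l//; lra.
- have n1 : `|1 : R| <= 1 by rewrite normr1.
  have n0 : `|0 : R| <= 1 by rewrite normr0.
  have [hh] := hK (b / sg) _ 1 0 (t / sg) bB c1 n1 n0 zr; rewrite -/h => hF.
  rewrite (ek hh) /ker_d1 /ker_d2 wE -/b.
  set k := ker s u v in k0 *; set F := _ `^ _ in hF *.
  have -> : k * F - (k + t * (- a * b / sg ^+ 2 * k) +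
     t ^+ 2 * ((a * (a + 1) / 2 * b ^+ 2 / sg ^+ 2 - a * dotp xi xi) / sg ^+ 2 * k)) =
     k * ((1 + 0 * (t / sg)) * F - (1 + (0 - a * (b / sg) * 1) * (t / sg) +
     (1 * (a * (a + 1) / 2 * (b / sg) ^+ 2 - a * dotp xi xi) - a * (b / sg) * 0) * (t / sg) ^+ 2)).
    by field.
  rewrite normrM (ger0_norm k0) [leRHS]mulrC; apply: ler_wpM2l => //; apply: (le_trans hF).
  rewrite z3 mulrA; apply: ler_wpM2l; first by apply: mulr_ge0 => //; exact: exprn_ge0.
  by rewrite lef_pV2 ?posrE ?exprn_gt0//; apply: lerXn2r; rewrite ?nnegrE ?(ltW m0) ?(ltW sg0).
move=> j.
have np : `|v ord0 j / sg| <= 1.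
  rewrite normrM normfV (gtr0_norm sg0) ler_pdivrMr// mul1r.
  exact: le_trans (coord_le _ _) vsg.
have ne : `|xi ord0 j| <= 1 by exact: le_trans (coord_le _ _) xi1.
have [hh] := hK (b / sg) _ _ _ (t / sg) bB c1 np ne zr; rewrite -/h => hF.
rewrite (ek hh) /riesz_d1 /riesz_d2 wE -/b !mxE.
set k := ker s u v in k0 *; set F := _ `^ _ in hF *.
set p := v ord0 j in hF *; set e := xi ord0 j in hF *; set c := dotp xi xi in hF *.
have -> : (p + t * e) * (k * F) - (p * k + t * ((e - a * b * p / sg ^+ 2) * k) +
   t ^+ 2 * ((p * (a * (a + 1) / 2 * b ^+ 2 / sg ^+ 2 - a * c) - a * b * e) / sg ^+ 2 * k)) =
   (sg * k) * ((p / sg + e * (t / sg)) * F - (p / sg + (e - a * (b / sg) * (p / sg)) * (t / sg) +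
     (p / sg * (a * (a + 1) / 2 * (b / sg) ^+ 2 - a * c) - a * (b / sg) * e) * (t / sg) ^+ 2)).
  by field.
rewrite normrM (ger0_norm (mulr_ge0 (ltW sg0) k0)).
have sk0 : 0 <= sg * k by apply: mulr_ge0 => //; exact: ltW.
apply: (le_trans (ler_wpM2l sk0 hF)); rewrite z3.
have -> : sg * k * (K * (`|t| ^+ 3 / sg ^+ 3)) = K * `|t| ^+ 3 / sg ^+ 2 * k by field.
apply: ler_wpM2r => //; apply: ler_wpM2l; first by apply: mulr_ge0 => //; exact: exprn_ge0.
by rewrite lef_pV2 ?posrE ?exprn_gt0//; apply: lerXn2r; rewrite ?nnegrE ?(ltW m0) ?(ltW sg0).
Qed.

Lemma jet_coef_le (B : R) : 0 <= B -> exists2 K, 0 <= K &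
  forall m u v xi om, 0 < m -> m ^+ 2 <= dotp v v + u -> 0 <= u -> enorm xi <= 1 ->
  `|om| <= B * m ->
  [/\ `|ker_d1 xi om u v| <= K / m * ker s u v, `|ker_d2 xi om u v| <= K / m ^+ 2 * ker s u v,
   forall j, `|riesz_d1 xi om j u v| <= K * ker s u v &
   forall j, `|riesz_d2 xi om j u v| <= K / m * ker s u v].
Proof.
move=> B0; have a0 : 0 <= a := exponent_ge0 s_gt0.
set A := a * (a + 1) / 2.
have A0 : 0 <= A by apply: divr_ge0 => //; apply: mulr_ge0 => //; exact: addr_ge0.
have B20 : 0 <= B + 2 by lra.
have aB0 : 0 <= a * (B + 2) by exact: mulr_ge0.
have AB0 : 0 <= A * (B + 2) ^+ 2 by apply: mulr_ge0 => //; exact: exprn_ge0.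
pose K := 1 + a * (B + 2) + (A * (B + 2) ^+ 2 + a).
exists K; first by rewrite /K; lra.
move=> m u v xi om m0 mw u0 xi1 omB.
set w := dotp v v + u in mw *.
have w0 : 0 < w by apply: lt_le_trans mw; exact: exprn_gt0.
pose sg := Num.sqrt w.
have sg0 : 0 < sg by rewrite sqrtr_gt0.
have sg2 : sg ^+ 2 = w by rewrite sqr_sqrtr// ltW.
have sgm : m <= sg.
  by rewrite -(ler_pXn2r (_ : (0 < 2)%N)) ?nnegrE ?sg2// ltW.
have vsg : enorm v <= sg.
  by rewrite -(ler_pXn2r (_ : (0 < 2)%N)) ?nnegrE ?sg2 ?(ltW sg0)// enorm_sqr /w; lra.
pose b := (2 * dotp v xi + om) / sg.
have bB : `|b| <= B + 2.
  rewrite normrM normfV (gtr0_norm sg0) ler_pdivrMr//.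
  apply: (le_trans (ler_normD _ _)); rewrite (mulrDl B) [leRHS]addrC; apply: lerD.
    rewrite normrM ger0_norm//; apply: ler_wpM2l => //; apply: (le_trans (cauchy_schwarz _ _)).
    by rewrite -[sg]mulr1; apply: ler_pM.
  by apply: (le_trans omB); apply: ler_wpM2l.
have c1 : `|dotp xi xi| <= 1.
  by rewrite ger0_norm ?dotp_ge0// -enorm_sqr; apply: exprn_ile1.
have eb : 2 * dotp v xi + om = b * sg by rewrite /b divfK// gt_eqF.
have k0 := ker_ge0 s u v.
have sgn0 : sg != 0 by rewrite gt_eqF.
have wE : dotp v v + u = sg ^+ 2 by rewrite sg2.
have im : sg^-1 <= m^-1 by rewrite lef_pV2.
have sgV0 : 0 <= sg^-1 by rewrite invr_ge0 ltW.
have ab : `|a * b| <= a * (B + 2) by rewrite normrM (ger0_norm a0); exact: ler_wpM2l.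
have bb : `|A * b ^+ 2 - a * dotp xi xi| <= A * (B + 2) ^+ 2 + a.
  apply: (le_trans (ler_normB _ _)); rewrite (normrM A) (normrM a) (ger0_norm A0) (ger0_norm a0).
  apply: lerD; last by rewrite ler_piMr.
  by apply: ler_wpM2l => //; rewrite normrX; apply: lerXn2r; rewrite ?nnegrE.
have np j : `|v ord0 j / sg| <= 1.
  rewrite normrM normfV (gtr0_norm sg0) ler_pdivrMr// mul1r.
  exact: le_trans (coord_le _ _) vsg.
have ne j : `|xi ord0 j| <= 1 by exact: le_trans (coord_le _ _) xi1.
split.
- rewrite /ker_d1 wE eb normrM (ger0_norm k0); apply: ler_wpM2r => //.
  rewrite (_ : _ / _ = - (a * b) / sg); last by field.
  rewrite normrM normrN normfV (gtr0_norm sg0); apply: ler_pM => //; rewrite /K; lra.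
- rewrite /ker_d2 wE eb normrM (ger0_norm k0); apply: ler_wpM2r => //.
  rewrite -/A (_ : _ / _ = (A * b ^+ 2 - a * dotp xi xi) / sg ^+ 2); last by field.
  rewrite normrM normfV (ger0_norm (exprn_ge0 2 (ltW sg0))); apply: ler_pM => //.
  + by rewrite invr_ge0 exprn_ge0// ltW.
  + by rewrite /K; lra.
  by rewrite lef_pV2 ?posrE ?exprn_gt0//; apply: lerXn2r; rewrite ?nnegrE ?(ltW m0) ?(ltW sg0).
- move=> j; rewrite /riesz_d1 wE eb normrM (ger0_norm k0); apply: ler_wpM2r => //.
  rewrite (_ : _ - _ = xi ord0 j - a * b * (v ord0 j / sg)); last by field.
  apply: (le_trans (ler_normB _ _)); have := ne j.
  have : `|a * b * (v ord0 j / sg)| <= a * (B + 2) * 1 by rewrite normrM; exact: ler_pM.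
  rewrite /K; lra.
move=> j; rewrite /riesz_d2 wE eb normrM (ger0_norm k0); apply: ler_wpM2r => //.
rewrite -/A (_ : _ / _ = (v ord0 j / sg * (A * b ^+ 2 - a * dotp xi xi) - a * b * xi ord0 j) / sg); last by field.
rewrite normrM normfV (gtr0_norm sg0); apply: ler_pM => //.
apply: (le_trans (ler_normB _ _)).
have : `|v ord0 j / sg * (A * b ^+ 2 - a * dotp xi xi)| <= 1 * (A * (B + 2) ^+ 2 + a).
  by rewrite normrM; exact: ler_pM.
have : `|a * b * xi ord0 j| <= a * (B + 2) * 1 by rewrite normrM; exact: ler_pM.
rewrite /K; lra.
Qed.

End KernelJets.

Section FieldJets.
Context {R : realType} {d : nat}.
Local Notation Rd := (@Rdm R d).
Variables (mu : {measure set Rd -> \bar R}) (s Lam : R).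
Hypothesis mu_nice : nice s Lam mu.
Hypothesis s_gt0 : 0 < s.
Implicit Types (u om m t : R) (x y v xi : 'rV[R]_d) (c : 'I_d -> R).

Local Notation S := (supp mu : set Rd).
Local Notation Int f := (\int[mu]_(y in S) f y).
Local Notation dom := (@dominated R d s S).

(** With sqrt(u) as height, (x, u) is at distance at least m from the support placed at height 0.
    Off the support u = 0 is allowed. *)
Definition regular m u x := [/\ 0 < m, 0 <= u &
  forall y, supp mu y -> m ^+ 2 <= dotp (x - y) (x - y) + u].

Lemma regular_gt0 m u x : regular m u x -> forall y, S y -> 0 < dotp (x - (y : 'rV[R]_d)) (x - (y : 'rV[R]_d)) + u.
Proof. by move=> [m0 _ h] y Sy; apply: lt_le_trans (h y Sy); exact: exprn_gt0. Qed.

Lemma dominated_ker_le m u x (f : Rd -> R) (C : R) : regular m u x -> measurable_fun setT f -> 0 <= C ->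
  (forall y, S y -> `|f y| <= C * ker s u (x - (y : 'rV[R]_d))) -> dom f.
Proof.
move=> reg mf C0 hf; split => //; have [m0 u0 hm] := reg.
have m20 : 0 < m ^+ 2 by exact: exprn_gt0.
pose b : R := 2 + (2 * dotp x x + 1) / m ^+ 2.
have x0 := dotp_ge0 x.
have q0 : 0 <= (2 * dotp x x + 1) / m ^+ 2 by apply: divr_ge0; lra.
have b0 : 0 < b by rewrite /b; lra.
exists (C * b `^ ((s + 1) / 2)); first by nonneg.
move=> y Sy; apply: (le_trans (hf y Sy)); rewrite -mulrA; apply: ler_wpM2l => //.
have w0 := regular_gt0 reg Sy.
apply: ker_comparable => //; first by have := dotp_ge0 (y : 'rV[R]_d); lra.
have h1 := dotp_shift (y : 'rV[R]_d) x 0; move: h1; rewrite !subr0 => h1.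
have h2 : 2 * dotp x x + 1 <= (2 * dotp x x + 1) / m ^+ 2 * (dotp (x - (y : 'rV[R]_d)) (x - (y : 'rV[R]_d)) + u).
  rewrite mulrAC ler_pdivlMr//; apply: ler_wpM2l; first lra.
  exact: hm.
have h3 : dotp ((y : 'rV[R]_d) - x) ((y : 'rV[R]_d) - x) = dotp (x - (y : 'rV[R]_d)) (x - (y : 'rV[R]_d)).
  by rewrite -opprB dotpNl dotpNr opprK.
rewrite h3 in h1; rewrite /b mulrDl; lra.
Qed.

Lemma regular_dominated_ker m u x : regular m u x -> dom (fun y => ker s u (x - (y : 'rV[R]_d))).
Proof.
move=> reg; apply: (@dominated_ker_le m u x _ 1) => //.
  by apply: measurable_ker => i; exact: measurable_coordB.
by move=> y _; rewrite mul1r ger0_norm ?ker_ge0.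
Qed.

Lemma regular_dominated_riesz m u x j : regular m u x ->
  dom (fun y => (x - (y : 'rV[R]_d)) ord0 j * ker s u (x - (y : 'rV[R]_d)) + offset s j y).
Proof.
move=> reg; have [m0 u0 hm] := reg.
have m20 : 0 < m ^+ 2 by exact: exprn_gt0.
have x0 := dotp_ge0 x.
have q0 : 0 <= (2 * dotp x x + 1) / m ^+ 2 by apply: divr_ge0; lra.
pose b : R := 2 + (2 * dotp x x + 1) / m ^+ 2 + (2 * dotp x x + u).
have b1 : 1 <= b by rewrite /b; lra.
have b10 : 0 <= b + 1 by lra.
split.
  apply: measurable_funD; last exact: measurable_offset.
  apply: measurable_funM; first exact: measurable_coordB.
  by apply: measurable_ker => i; exact: measurable_coordB.
exists ((b `^ ((s + 1) / 2) + (s + 1) / 2 * b `^ ((s + 1) / 2 + 1) * (b + 1)) * (enorm x + `|u - 1| / 1)).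
  by have a0 := exponent_ge0 s_gt0; rewrite divr1; nonneg.
move=> y Sy.
have kE : ker s 1 (y : 'rV[R]_d) = ker s 1 (0 - (y : 'rV[R]_d)) by rewrite /ker sub0r dotpNl dotpNr opprK.
have oE : offset s j y = - ((0 - (y : 'rV[R]_d)) ord0 j * ker s 1 (0 - (y : 'rV[R]_d))).
  by rewrite /offset -kE sub0r mxE mulNr opprK.
rewrite oE kE.
have yy : dotp (0 - (y : 'rV[R]_d)) (0 - (y : 'rV[R]_d)) = dotp (y : 'rV[R]_d) y by rewrite sub0r dotpNl dotpNr opprK.
have y0 := dotp_ge0 (y : 'rV[R]_d).
have w0 := hm y Sy.
have s1 := dotp_shift x 0 (y : 'rV[R]_d); rewrite yy subr0 in s1.
have s2 := dotp_shift 0 x (y : 'rV[R]_d); rewrite yy sub0r dotpNl dotpNr opprK in s2.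
set w := dotp (x - _) _ in w0 s1 s2 *.
have w00 : 0 <= w by exact: dotp_ge0.
apply: (le_trans (@riesz_sub_le _ _ _ s_gt0 b 1 u 1 _ _ j b1 ltr01 u0 ler01 _ _ _ _)).
- by rewrite yy; lra.
- by rewrite -/w; lra.
- rewrite -/w yy.
  have h1 : 0 <= (2 * dotp x x + 1) / m ^+ 2 * (dotp (y : 'rV[R]_d) y + 1) by apply: mulr_ge0 => //; lra.
  have h2 : 0 <= (2 * dotp x x + u) * dotp (y : 'rV[R]_d) y by apply: mulr_ge0 => //; lra.
  rewrite /b; nra.
- rewrite -/w yy.
  have h1 : 2 * dotp x x + 1 <= (2 * dotp x x + 1) / m ^+ 2 * (w + u).
    by rewrite mulrAC ler_pdivlMr//; apply: ler_wpM2l => //; lra.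
  have h2 : 0 <= (2 * dotp x x + u) * (w + u) by apply: mulr_ge0; lra.
  rewrite /b !(mulrDl _ _ (w + u)); lra.
by rewrite (_ : x - (y : 'rV[R]_d) - (0 - (y : 'rV[R]_d)) = x)//; rewrite sub0r opprK subrK.
Qed.

Lemma measurable_weightV u x : 0 <= u ->
  measurable_fun setT (fun y : Rd => (dotp (x - (y : 'rV[R]_d)) (x - (y : 'rV[R]_d)) + u)^-1).
Proof.
move=> u0; apply: (eq_measurable_fun (fun y : Rd => (dotp (x - (y : 'rV[R]_d)) (x - (y : 'rV[R]_d)) + u) `^ (-1))).
  by move=> y _; rewrite powR_inv1// addr_ge0// dotp_ge0.
apply: (@measurableT_comp _ _ _ _ _ _ (fun z : R => z `^ _)); first exact: measurable_powR.
apply: measurable_funD => //; apply: measurable_dotp => i; exact: measurable_coordB.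
Qed.

Lemma measurable_dotpB x xi : measurable_fun setT (fun y : Rd => dotp (x - (y : 'rV[R]_d)) xi).
Proof. by apply: measurable_dotp => i //; exact: measurable_coordB. Qed.

Let mker u x : measurable_fun setT (fun y : Rd => ker s u (x - (y : 'rV[R]_d))).
Proof. by apply: measurable_ker => i; exact: measurable_coordB. Qed.

Lemma measurable_ker_d1 xi om u x : 0 <= u ->
  measurable_fun setT (fun y : Rd => ker_d1 s xi om u (x - (y : 'rV[R]_d))).
Proof.
move=> u0; apply: measurable_funM => //; apply: measurable_funM; last exact: measurable_weightV.
apply: measurable_funM => //; apply: measurable_funD => //; apply: measurable_funM => //; exact: measurable_dotpB.
Qed.

Lemma measurable_ker_d2 xi om u x : 0 <= u ->
  measurable_fun setT (fun y : Rd => ker_d2 s xi om u (x - (y : 'rV[R]_d))).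
Proof.
move=> u0; have mw := measurable_weightV x u0.
apply: measurable_funM => //; apply: measurable_funM => //.
apply: measurable_funB => //; apply: measurable_funM => //.
apply: measurable_funM => //; apply: measurable_funX.
by apply: measurable_funD => //; apply: measurable_funM => //; exact: measurable_dotpB.
Qed.

Lemma measurable_riesz_d1 xi om j u x : 0 <= u ->
  measurable_fun setT (fun y : Rd => riesz_d1 s xi om j u (x - (y : 'rV[R]_d))).
Proof.
move=> u0; have mw := measurable_weightV x u0.
apply: measurable_funM => //; apply: measurable_funB => //.
apply: measurable_funM => //; apply: measurable_funM; last exact: measurable_coordB.
apply: measurable_funM => //.
by apply: measurable_funD => //; apply: measurable_funM => //; exact: measurable_dotpB.
Qed.

Lemma measurable_riesz_d2 xi om j u x : 0 <= u ->
  measurable_fun setT (fun y : Rd => riesz_d2 s xi om j u (x - (y : 'rV[R]_d))).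
Proof.
move=> u0; have mw := measurable_weightV x u0.
have mb : measurable_fun setT (fun y : Rd => 2 * dotp (x - (y : 'rV[R]_d)) xi + om).
  by apply: measurable_funD => //; apply: measurable_funM => //; exact: measurable_dotpB.
apply: measurable_funM => //; apply: measurable_funM => //; apply: measurable_funB.
  apply: measurable_funM; first exact: measurable_coordB.
  apply: measurable_funB => //; apply: measurable_funM => //.
  by apply: measurable_funM => //; exact: measurable_funX.
by apply: measurable_funM => //; apply: measurable_funM.
Qed.

Definition density_d1 xi om u x : R := Int (fun y => ker_d1 s xi om u (x - (y : 'rV[R]_d))).
Definition density_d2 xi om u x : R := Int (fun y => ker_d2 s xi om u (x - (y : 'rV[R]_d))).
Definition field_d1 xi om j u x : R := Int (fun y => riesz_d1 s xi om j u (x - (y : 'rV[R]_d))).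
Definition field_d2 xi om j u x : R := Int (fun y => riesz_d2 s xi om j u (x - (y : 'rV[R]_d))).

Lemma jet_dominated (B : R) m u x xi om : 0 <= B -> regular m u x -> enorm xi <= 1 -> `|om| <= B * m ->
  [/\ dom (fun y => ker_d1 s xi om u (x - (y : 'rV[R]_d))),
      dom (fun y => ker_d2 s xi om u (x - (y : 'rV[R]_d))),
      forall j, dom (fun y => riesz_d1 s xi om j u (x - (y : 'rV[R]_d))) &
      forall j, dom (fun y => riesz_d2 s xi om j u (x - (y : 'rV[R]_d)))].
Proof.
move=> B0 reg xi1 omB; have [K K0 hK] := @jet_coef_le R d s s_gt0 B B0; have [m0 u0 hm] := reg.
have m20 : 0 <= m ^+ 2 by rewrite exprn_ge0// ltW.
split.
- apply: (@dominated_ker_le m u x _ (K / m)) => //.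
  + exact: measurable_ker_d1.
  + by rewrite divr_ge0// ltW.
  by move=> y Sy; have [] := hK m u _ xi om m0 (hm y Sy) u0 xi1 omB.
- apply: (@dominated_ker_le m u x _ (K / m ^+ 2)) => //.
  + exact: measurable_ker_d2.
  + exact: divr_ge0.
  by move=> y Sy; have [] := hK m u _ xi om m0 (hm y Sy) u0 xi1 omB.
- move=> j; apply: (@dominated_ker_le m u x _ K) => //; first exact: measurable_riesz_d1.
  by move=> y Sy; have [_ _ h _] := hK m u _ xi om m0 (hm y Sy) u0 xi1 omB.
move=> j; apply: (@dominated_ker_le m u x _ (K / m)) => //.
- exact: measurable_riesz_d2.
- by rewrite divr_ge0// ltW.
by move=> y Sy; have [_ _ _ h] := hK m u _ xi om m0 (hm y Sy) u0 xi1 omB.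
Qed.

Lemma Int_jet_le (f f0 f1 f2 g : Rd -> R) (a b K : R) : dom f -> dom f0 -> dom f1 -> dom f2 -> dom g ->
  (forall y, S y -> `|f y - (f0 y + a * f1 y + b * f2 y)| <= K * g y) ->
  `|Int f - (Int f0 + a * Int f1 + b * Int f2)| <= K * Int g.
Proof.
move=> df df0 df1 df2 dg h; have mS := measurable_supp mu.
have d1 : dom (fun y => f0 y + a * f1 y) by apply: dominatedD => //; exact: dominatedM.
have d2 : dom (fun y => f0 y + a * f1 y + b * f2 y) by apply: dominatedD => //; exact: dominatedM.
rewrite -!(IntM mu_nice s_gt0 mS)// -(IntD mu_nice s_gt0 mS df0 (dominatedM _ df1)).
rewrite -(IntD mu_nice s_gt0 mS d1 (dominatedM _ df2)) -(IntB mu_nice s_gt0 mS df d2).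
by apply: (Int_norm_le mu_nice s_gt0 mS) => //; [exact: dominatedB|exact: dominatedM].
Qed.

(** On the support regularity bounds w below, so the pointwise jets have uniform constants there and
    can be integrated; the density is the common error scale. *)
Lemma field_jet (B : R) : 0 <= B -> exists2 K, 0 <= K &
  forall m u x xi om t, regular m u x -> enorm xi <= 1 -> `|om| <= B * m ->
  `|t| <= (2 * (B + 3))^-1 * m -> 0 <= u + t * om ->
  [/\ regular (m / 2) (u + t * om) (x + t *: xi),
   `|density mu s (u + t * om) (x + t *: xi) -
       (density mu s u x + t * density_d1 xi om u x + t ^+ 2 * density_d2 xi om u x)|
      <= K * `|t| ^+ 3 / m ^+ 3 * density mu s u x &
   forall c j, `|field mu s c (u + t * om) j (x + t *: xi) -
      (field mu s c u j x + t * field_d1 xi om j u x + t ^+ 2 * field_d2 xi om j u x)|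
      <= K * `|t| ^+ 3 / m ^+ 2 * density mu s u x].
Proof.
move=> B0; have [K K0 hK] := @kernel_jet R d s s_gt0 B B0; exists K => // m u x xi om t reg xi1 omB tm ut.
have [m0 u0 hm] := reg.
have mS := measurable_supp mu.
have [dk1 dk2 dr1 dr2] := jet_dominated B0 reg xi1 omB.
have dk := regular_dominated_ker reg.
have hy y (Sy : S y) := hK m u _ xi om t m0 (hm y Sy) u0 xi1 omB tm.
have xt (y : 'rV[R]_d) : x + t *: xi - y = x - y + t *: xi by rewrite addrAC.
have reg' : regular (m / 2) (u + t * om) (x + t *: xi).
  split => //; first exact: divr_gt0.
  move=> y Sy; rewrite xt; have [h _ _] := hy y Sy; have := hm y Sy; rewrite expr_div_n.
  have := exprn_gt0 2 m0; lra.
have dk' := regular_dominated_ker reg'.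
have p2 : 0 <= `|t| ^+ 3 by exact: exprn_ge0.
split => //.
  apply: Int_jet_le => // y Sy.
  by rewrite xt; have [_ h _] := hy y Sy.
move=> c j; have dr := regular_dominated_riesz j reg.
have dr' := regular_dominated_riesz j reg'.
rewrite /field (_ : forall a b e f g : R, a - b - (e - b + f + g) = a - (e + f + g)); last by move=> *; ring.
apply: Int_jet_le => // y Sy.
rewrite (_ : forall a b e f g : R, a + b - (e + b + f + g) = a - (e + f + g)); last by move=> *; ring.
by rewrite xt; have [_ _ h] := hy y Sy; exact: h.
Qed.

End FieldJets.

(** * Supports with interior, s <= d - 1 *)

Section Grid.
Context {R : realType} {d : nat}.
Variables (y0 : 'rV[R]_d) (r : R) (N : nat).
Hypothesis r_gt0 : 0 < r.
Implicit Types (x y : 'rV[R]_d) (k : {ffun 'I_d -> 'I_N.+1}) (i : 'I_d) (f g : 'rV[R]_d -> R).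

Definition mesh : R := 6 * r / N.+1%:R.
Definition grid k : 'rV[R]_d := \row_i (y0 ord0 i - 3 * r + mesh * (k i)%:R).
(** The shift is cyclic, hence a bijection of the index set, and sums are exactly invariant; the
    wrap-around only happens where the tents vanish. *)
Definition shift i k : {ffun 'I_d -> 'I_N.+1} :=
  [ffun j => if j == i then ordS (k i) else k j].
(** A Riemann sum for the Lebesgue integral over the cube of side 6 r centred at y0. Being finite,
    it commutes with integration against mu. *)
Definition average (f : 'rV[R]_d -> R) : R := mesh ^+ d * \sum_k f (grid k).

Lemma mesh_gt0 : 0 < mesh.
Proof. by apply: divr_gt0; [apply: mulr_gt0|rewrite ltr0n]. Qed.
Hint Resolve mesh_gt0 : core.

Lemma mesh_mul : mesh * N.+1%:R = 6 * r.
Proof. by rewrite /mesh divfK// pnatr_eq0. Qed.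

Lemma shift_inj i : injective (shift i).
Proof.
move=> k k' e; apply/ffunP => j; have := congr1 (fun f : {ffun _ -> _} => f j) e.
rewrite !ffunE; case: eqP => [->|//]; exact: (can_inj (@ordSK _)).
Qed.

Lemma average_shift i f : mesh ^+ d * \sum_k f (grid (shift i k)) = average f.
Proof. by rewrite /average [in RHS](reindex_inj (@shift_inj i)). Qed.

Lemma average_le f g : (forall x, f x <= g x) -> average f <= average g.
Proof.
by move=> fg; apply: ler_wpM2l; [exact/exprn_ge0/ltW|apply: ler_sum => k _].
Qed.

Lemma averageD f g : average (fun x => f x + g x) = average f + average g.
Proof. by rewrite /average big_split mulrDr. Qed.

Lemma averageM (c : R) f : average (fun x => c * f x) = c * average f.
Proof. by rewrite /average -mulr_sumr mulrCA. Qed.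

Lemma average_cst (c : R) : average (fun=> c) = (6 * r) ^+ d * c.
Proof.
rewrite /average sumr_const card_ffun !card_ord -[_ *+ _]mulr_natl natrX mulrA.
by rewrite -exprMn mesh_mul.
Qed.

Lemma average_sum (I : finType) (f : I -> 'rV[R]_d -> R) :
  average (fun x => \sum_j f j x) = \sum_j average (f j).
Proof. by rewrite /average exchange_big/= mulr_sumr. Qed.

Lemma average_norm_le f g : (forall x, `|f x| <= g x) -> `|average f| <= average g.
Proof.
move=> fg; rewrite /average normrM ger0_norm ?exprn_ge0 ?(ltW mesh_gt0)//.
apply: ler_wpM2l; first exact/exprn_ge0/ltW.
by apply: (le_trans (ler_norm_sum _ _ _)); apply: ler_sum => k _.
Qed.

Lemma grid_shift i k : (k i < N)%N -> grid (shift i k) = grid k + mesh *: delta_mx ord0 i.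
Proof.
move=> ki; apply/rowP => j; rewrite !mxE ffunE eqxx/=; case: eqP => [->|_]; last by rewrite mulr0 addr0.
by rewrite /= modn_small ?ltnS// -(natr1 (k i)) mulrDr addrA.
Qed.

(** At the last index both the point and its cyclic successor differ from y0 by at least 3 r - mesh
    in coordinate i, beyond the reach of a tent of radius at most 2 r. *)
Lemma grid_edge i k (rho : R) : mesh <= r / 2 -> rho <= 2 * r -> (N <= k i)%N ->
  tent y0 rho (grid k) = 0 /\ tent y0 rho (grid (shift i k)) = 0 \/ rho <= 0.
Proof.
move=> hr rr Nk; have [rho0|] := ltP 0 rho; last by right.
have e : (k i : nat) = N by apply/eqP; rewrite eqn_leq Nk -ltnS ltn_ord.
have h0 := mesh_gt0; have hN := mesh_mul.
left; split; apply: tent_out => //; rewrite /eball/= => hx.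
  have := coord_le (grid k - y0) i; rewrite !mxE e.
  move: hN; rewrite -(natr1 N) mulrDr mulr1 => hN.
  rewrite (_ : _ - _ = mesh * N%:R - 3 * r); last by ring.
  move: (ler_norm (mesh * N%:R - 3 * r)); lra.
have := coord_le (grid (shift i k) - y0) i; rewrite !mxE ffunE eqxx/= e modnn mulr0 addr0.
rewrite (_ : _ - _ = - (3 * r)); last by ring.
by rewrite normrN; move: (ler_norm (3 * r)); lra.
Qed.

(** Summation by parts moves the difference quotient onto the tent, whose slope is at most 1/rho.
    The field is needed one mesh beyond the tent. *)
Lemma average_flux (rho : R) i (E M : 'rV[R]_d -> R) : 0 < rho -> rho <= 2 * r -> mesh <= r / 2 ->
  (forall x, 0 <= M x) -> (forall x, eball y0 (rho + mesh) x -> `|E x| <= M x) ->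
  `|average (fun x => tent y0 rho x * ((E (x + mesh *: delta_mx ord0 i) - E x) / mesh))| <= rho^-1 * average M.
Proof.
move=> rho0 rr hr M0 EM; have h0 := mesh_gt0.
have term k : `|(tent y0 rho (grid k) - tent y0 rho (grid (shift i k))) * (E (grid (shift i k)) / mesh)| <=
    rho^-1 * M (grid (shift i k)).
  have [ki|Nk] := ltnP (k i) N; last first.
    have [[-> ->]|] := grid_edge hr rr Nk; last by rewrite leNgt rho0.
    by rewrite subrr mul0r normr0 mulr_ge0// invr_ge0 ltW.
  have dist : enorm (grid k - grid (shift i k)) = mesh.
    by rewrite grid_shift// opprD addNKr enormN enormZ enorm_delta mulr1 gtr0_norm.
  have [inn|out] := ltP (enorm (grid (shift i k) - y0)) (rho + mesh).
    rewrite normrM [in leLHS]normrM normfV (gtr0_norm h0).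
    have := tent_lip y0 (grid k) (grid (shift i k)) rho0; rewrite dist => hl.
    have hE := EM _ inn.
    have -> : rho^-1 * M (grid (shift i k)) = rho^-1 * mesh * (M (grid (shift i k)) / mesh).
      by field; rewrite !gt_eqF.
    apply: ler_pM => //; first by rewrite divr_ge0// ltW.
    by apply: ler_wpM2r => //; rewrite invr_ge0 ltW.
  have := enorm_dist (grid (shift i k)) (grid k) y0; rewrite (enormB (grid (shift i k)) (grid k)) dist => hd.
  rewrite !tent_out ?subrr ?mul0r ?normr0 ?mulr_ge0 ?invr_ge0 ?(ltW rho0)// /eball/=; lra.
have -> : average (fun x => tent y0 rho x * ((E (x + mesh *: delta_mx ord0 i) - E x) / mesh)) =
   mesh ^+ d * \sum_k ((tent y0 rho (grid k) - tent y0 rho (grid (shift i k))) * (E (grid (shift i k)) / mesh)).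
  have e1 := average_shift i (fun x => tent y0 rho x * (E x / mesh)).
  have -> : average (fun x => tent y0 rho x * ((E (x + mesh *: delta_mx ord0 i) - E x) / mesh)) =
     mesh ^+ d * (\sum_k tent y0 rho (grid k) * (E (grid (shift i k)) / mesh)) -
     average (fun x => tent y0 rho x * (E x / mesh)).
    rewrite /average -mulrBr -sumrB; congr (_ * _); apply: eq_bigr => k _.
    have [ki|Nk] := ltnP (k i) N; first by rewrite grid_shift// -mulrBr mulrBl.
    have [[-> _]|] := grid_edge hr rr Nk; last by rewrite leNgt rho0.
    by rewrite !mul0r subrr.
  rewrite -e1 -mulrBr -sumrB; congr (_ * _); apply: eq_bigr => k _.
  by rewrite mulrBl.
rewrite -(average_shift i M) normrM ger0_norm ?exprn_ge0 ?(ltW h0)// [leRHS]mulrCA.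
apply: ler_wpM2l; first exact/exprn_ge0/ltW.
rewrite mulr_sumr; apply: (le_trans (ler_norm_sum _ _ _)).
by apply: ler_sum => k _; exact: term.
Qed.

(* At least (lam / (2 d mesh))^d grid points lie within distance lam of y. *)
Lemma average_ge y (lam c : R) (f : 'rV[R]_d -> R) : (0 < d)%N ->
  d%:R * mesh <= lam -> lam <= r -> eball y0 r y -> (forall x, 0 <= f x) ->
  (forall x, enorm (x - y) <= lam -> c <= f x) -> 0 <= c ->
  (lam / (2 * d%:R)) ^+ d * c <= average f.
Proof.
move=> d0 hl lr yy0 f0 fc c0; have h0 := mesh_gt0.
have dr : 0 < d%:R :> R by rewrite ltr0n.
have dr1 : 1 <= d%:R :> R by rewrite ler1n.
have lam0 : 0 < lam by apply: lt_le_trans hl; exact: mulr_gt0.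
(* M is the number of grid points per axis of a box of grid points inside the ball of radius lam
   about y; [k0] is its lower corner. *)
pose M := Num.truncn (lam / (d%:R * mesh)).
have q0 : 0 <= lam / (d%:R * mesh) by rewrite divr_ge0 ?(ltW lam0)// mulr_ge0// ltW.
have /andP[M1 M2] := truncn_itv q0; rewrite -/M in M1 M2.
have dh0 : 0 < d%:R * mesh by exact: mulr_gt0.
rewrite ler_pdivlMr// in M1; rewrite ltr_pdivrMr// in M2.
have M0 : (0 < M)%N.
  rewrite -(ltn_add2r 1) !addn1 -(ltr_nat R).
  apply: (@le_lt_trans _ _ (lam / (d%:R * mesh))); first by rewrite ler_pdivlMr// mul1r.
  by rewrite ltr_pdivrMr.
have Mr1 : 1 <= M%:R :> R by rewrite ler1n.
have Mh : lam / (2 * d%:R) <= M%:R * mesh.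
  rewrite ler_pdivrMr; last by rewrite mulr_gt0.
  move: M2; rewrite -addn1 natrD => M2.
  have : 0 <= (M%:R - 1) * (d%:R * mesh) by apply: mulr_ge0; [lra|exact: ltW].
  lra.
have Ml : M%:R * mesh * d%:R <= lam by rewrite -mulrA (mulrC mesh).
have Ml' : M%:R * mesh <= lam.
  apply: le_trans Ml; rewrite ler_peMr// mulr_ge0//; exact: ltW.
have yc i : `|y ord0 i - y0 ord0 i| < r.
  by apply: le_lt_trans yy0; have := coord_le (y - y0) i; rewrite !mxE.
have b0 i : 0 <= (y ord0 i - y0 ord0 i + 3 * r) / mesh.
  by apply: divr_ge0; [have := yc i; rewrite ltr_norml => /andP[]; lra|exact: ltW].
pose k0 i := Num.truncn ((y ord0 i - y0 ord0 i + 3 * r) / mesh).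
have k0h i : (k0 i)%:R * mesh <= y ord0 i - y0 ord0 i + 3 * r < ((k0 i)%:R + 1) * mesh.
  have /andP[h1 h2] := truncn_itv (b0 i); rewrite -/(k0 i) in h1 h2.
  by rewrite -ler_pdivlMr// h1 -ltr_pdivrMr// natr1.
have kN i (e : 'I_M) : (k0 i + e < N.+1)%N.
  rewrite -(ltr_nat R) -(ltr_pM2r h0) (mulrC N.+1%:R) mesh_mul natrD mulrDl.
  have /andP[h1 _] := k0h i.
  have : e%:R * mesh <= M%:R * mesh by apply: ler_wpM2r; [exact: ltW|rewrite ler_nat ltnW].
  by have := yc i; rewrite ltr_norml => /andP[]; lra.
pose j (g : {ffun 'I_d -> 'I_M}) : {ffun 'I_d -> 'I_N.+1} := [ffun i => Ordinal (kN i (g i))].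
have jinj : injective j.
  move=> g g' e; apply/ffunP => i; have := congr1 (fun f : {ffun _ -> _} => val (f i)) e.
  by rewrite !ffunE /= => /addnI/val_inj.
have jnear (g : {ffun 'I_d -> 'I_M}) : enorm (grid (j g) - y) <= lam.
  apply: (@le_trans _ _ (d%:R * (M%:R * mesh))); last by rewrite mulrC.
  apply: enorm_le_coord => [|i]; first by rewrite mulr_ge0// ltW.
  rewrite !mxE ffunE /= natrD; have /andP[h1 h2] := k0h i.
  have g1 : ((g i)%:R + 1) * mesh <= M%:R * mesh.
    by apply: ler_wpM2r; [exact: ltW|rewrite natr1 ler_nat].
  have g0 : 0 <= (g i)%:R * mesh by rewrite mulr_ge0// ltW.
  by rewrite ler_norml; apply/andP; split; lra.
apply: (@le_trans _ _ (mesh ^+ d * \sum_(g : {ffun 'I_d -> 'I_M}) f (grid (j g)))).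
  apply: (@le_trans _ _ (mesh ^+ d * \sum_(g : {ffun 'I_d -> 'I_M}) c)).
    rewrite sumr_const card_ffun !card_ord -[c *+ _]mulr_natl natrX mulrA -exprMn (mulrC mesh).
    by apply: ler_wpM2r => //; apply: lerXn2r; rewrite ?nnegrE// ?divr_ge0 ?mulr_ge0// ltW.
  apply: ler_wpM2l; first exact/exprn_ge0/ltW.
  by apply: ler_sum => g _; exact/fc/jnear.
apply: ler_wpM2l; first exact/exprn_ge0/ltW.
rewrite -(big_imset (fun k => f (grid k)) (in2W jinj))/=.
by rewrite [leRHS](bigID (mem [set j g | g in {: {ffun 'I_d -> 'I_M}}]%SET))/= lerDl sumr_ge0.
Qed.

End Grid.

(** * Divergence of the smoothed field *)

Section Divergence.
Context {R : realType} {d : nat}.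
Local Notation Rd := (@Rdm R d).
Variables (mu : {measure set Rd -> \bar R}) (s Lam : R).
Hypothesis mu_nice : nice s Lam mu.
Hypothesis s_gt0 : 0 < s.
Implicit Types (u t r : R) (x y v : 'rV[R]_d) (c : 'I_d -> R).

Local Notation S := (supp mu : set Rd).
Local Notation Int f := (\int[mu]_(y in S) f y).
Local Notation dom := (@dominated R d s S).

(** The divergence d w^-a - (s+1) |v|^2 w^(-a-1) of v w^-a, rewritten with |v|^2 = w - u so that
    both terms are nonnegative when s + 1 <= d and u >= 0. *)
Definition div_ker u v : R := (d%:R - (s + 1)) * ker s u v + (s + 1) * u * (ker s u v / (dotp v v + u)).
Definition divergence u x : R := \sum_(i < d) field_d1 mu s (delta_mx ord0 i) 0 i u x.
Definition steep_density u x : R :=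
  Int (fun y => ker s u (x - (y : 'rV[R]_d)) / (dotp (x - (y : 'rV[R]_d)) (x - (y : 'rV[R]_d)) + u)).

Lemma sum_riesz_d1 u v : 0 < dotp v v + u ->
  \sum_(i < d) riesz_d1 s (delta_mx ord0 i) 0 i u v = div_ker u v.
Proof.
move=> w0; rewrite /div_ker; set k := ker s u v.
have e i : riesz_d1 s (delta_mx ord0 i) 0 i u v = k - ((s + 1) * k / (dotp v v + u)) * (v ord0 i * v ord0 i).
  by rewrite /riesz_d1 dotp_delta mxE !eqxx -/k /=; field; rewrite gt_eqF.
rewrite (eq_bigr _ (fun i _ => e i)) sumrB sumr_const card_ord -mulr_sumr -/(dotp v v) -mulr_natl.
by field; rewrite gt_eqF.
Qed.

Lemma regular_sqr t x : 0 < t -> regular mu t (t ^+ 2) x.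
Proof.
move=> t0; split => //; first by rewrite exprn_ge0// ltW.
by move=> y _; rewrite lerDr dotp_ge0.
Qed.

Lemma steep_dominated m u x : regular mu m u x ->
  dom (fun y => ker s u (x - (y : 'rV[R]_d)) / (dotp (x - (y : 'rV[R]_d)) (x - (y : 'rV[R]_d)) + u)).
Proof.
move=> reg; have [m0 u0 hm] := reg; have m20 : 0 < m ^+ 2 by exact: exprn_gt0.
apply: (@dominated_ker_le _ _ mu s s_gt0 m u x _ (m ^+ 2)^-1) => //.
- apply: measurable_funM; last exact: measurable_weightV.
  by apply: measurable_ker => i; exact: measurable_coordB.
- by rewrite invr_ge0 ltW.
move=> y Sy; have w0 := regular_gt0 reg Sy.
rewrite normrM normfV (ger0_norm (ker_ge0 _ _ _)) (gtr0_norm w0) mulrC; apply: ler_wpM2r; first exact: ker_ge0.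
by rewrite lef_pV2 ?posrE//; exact: hm.
Qed.

Lemma divergence_Int m u x : regular mu m u x -> divergence u x = Int (fun y => div_ker u (x - (y : 'rV[R]_d))).
Proof.
move=> reg; have mS := measurable_supp mu; have [m0 _ _] := reg.
have dr i : dom (fun y => riesz_d1 s (delta_mx ord0 i) 0 i u (x - (y : 'rV[R]_d))).
  have xi1 : enorm (delta_mx ord0 i : 'rV[R]_d) <= 1 by rewrite enorm_delta.
  have om0 : `|0 : R| <= 0 * m by rewrite normr0 mul0r.
  by have [_ _ h _] := jet_dominated s_gt0 (lexx _) reg xi1 om0; exact: h.
rewrite /divergence /field_d1 -(Int_sum mu_nice s_gt0 mS)//.
apply: eq_Rintegral => y /set_mem Sy; rewrite sum_riesz_d1//; exact: regular_gt0 reg y Sy.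
Qed.

Lemma div_ker_dominated m u x : regular mu m u x -> dom (fun y => div_ker u (x - (y : 'rV[R]_d))).
Proof.
move=> reg; apply: dominatedD; apply: dominatedM; first exact: (regular_dominated_ker s_gt0 reg).
exact: steep_dominated reg.
Qed.

Lemma divergenceE m u x : regular mu m u x ->
  divergence u x = (d%:R - (s + 1)) * density mu s u x + (s + 1) * u * steep_density u x.
Proof.
move=> reg; have mS := measurable_supp mu; rewrite (divergence_Int reg).
have d1 := regular_dominated_ker s_gt0 reg; have d2 := steep_dominated reg.
rewrite /density /steep_density -!(IntM mu_nice s_gt0 mS)// -(IntD mu_nice s_gt0 mS)//; exact: dominatedM.
Qed.

(** Where w <= rho^2 the kernel is at most rho^2 times the steep one; where w > rho^2, smoothing at
    rho instead of t at most doubles the weight. *)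
Lemma density_split t rho x : 0 < t -> 0 < rho ->
  density mu s (t ^+ 2) x <= rho ^+ 2 * steep_density (t ^+ 2) x + 2 `^ ((s + 1) / 2) * density mu s (rho ^+ 2) x.
Proof.
move=> t0 r0; have mS := measurable_supp mu.
have rt := regular_sqr x t0; have rr := regular_sqr x r0.
have d1 := regular_dominated_ker s_gt0 rt; have d2 := steep_dominated rt.
have d3 := regular_dominated_ker s_gt0 rr.
rewrite /density /steep_density -!(IntM mu_nice s_gt0 mS)// -(IntD mu_nice s_gt0 mS); [|exact: dominatedM..].
apply: (Int_le mu_nice s_gt0 mS) => //; first by apply: dominatedD; exact: dominatedM.
move=> y Sy; have w0 := regular_gt0 rt Sy; have w0' := regular_gt0 rr Sy.
have k0 := ker_ge0 s (t ^+ 2) (x - (y : 'rV[R]_d)).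
have k0' := ker_ge0 s (rho ^+ 2) (x - (y : 'rV[R]_d)).
have p0 : 0 <= 2 `^ ((s + 1) / 2) :> R by exact: powR_ge0.
have [wr|rw] := leP (dotp (x - (y : 'rV[R]_d)) (x - (y : 'rV[R]_d)) + t ^+ 2) (rho ^+ 2).
  apply: (@le_trans _ _ (rho ^+ 2 * (ker s (t ^+ 2) (x - (y : 'rV[R]_d)) / (dotp (x - (y : 'rV[R]_d)) (x - (y : 'rV[R]_d)) + t ^+ 2)))).
    by rewrite mulrCA ler_peMr// ler_pdivlMr// mul1r.
  by rewrite lerDl mulr_ge0.
apply: (@le_trans _ _ (2 `^ ((s + 1) / 2) * ker s (rho ^+ 2) (x - (y : 'rV[R]_d)))).
  apply: ker_comparable => //; have := sqr_ge0 t; move: rw; lra.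
by rewrite lerDr; apply: mulr_ge0; [exact: sqr_ge0|apply: divr_ge0 => //; exact: ltW].
Qed.

(** The second-order term is at most a multiple of (h / t^2) (t q) with t q bounded, so h <= t^4
    makes it O(t^2). The 1/6 keeps h inside the radius of the jet. *)
Lemma difference_divergence : 0 <= Lam -> exists2 K, 0 <= K &
  forall c t h x, 0 < t -> t <= 1 -> 0 < h -> h <= t ^+ 4 / 6 ->
  `|divergence (t ^+ 2) x - \sum_(i < d) ((field mu s c (t ^+ 2) i (x + h *: delta_mx ord0 i) - field mu s c (t ^+ 2) i x) / h)|
   <= K * t ^+ 2.
Proof.
move=> Lam0; have [K K0 hK] := @field_jet _ _ mu s Lam mu_nice s_gt0 0 (lexx _).
have [K' K'0 hK'] := @jet_coef_le R d s s_gt0 0 (lexx _).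
pose C0 := 2 `^ (s + 2) * Lam.
have C00 : 0 <= C0 by rewrite /C0; nonneg.
exists (d%:R * ((K' + K) * C0)); first by nonneg.
move=> c t h x t0 t1 h0 ht; have reg := regular_sqr x t0; set u := t ^+ 2 in reg *.
have mS := measurable_supp mu.
have q0 : 0 <= density mu s u x by exact: density_ge0.
have tq : t * density mu s u x <= C0 by exact: density_le.
have dk := regular_dominated_ker s_gt0 reg.
have tt : t ^+ 4 <= t.
  by rewrite exprS ler_piMr ?(ltW t0)// exprn_ile1// ltW.
rewrite /divergence -sumrB; apply: (le_trans (ler_norm_sum _ _ _)).
rewrite -mulrA mulr_natl -[X in _ *+ X](card_ord d) -sumr_const; apply: ler_sum => i _.
have xi1 : enorm (delta_mx ord0 i : 'rV[R]_d) <= 1 by rewrite enorm_delta.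
have om0 : `|0 : R| <= 0 * t by rewrite normr0 mul0r.
have htm : `|h| <= (2 * (0 + 3))^-1 * t.
  by rewrite gtr0_norm// add0r (_ : 2 * 3 = 6); [lra|ring].
have hu : 0 <= u + h * 0 by rewrite mulr0 addr0 sqr_ge0.
have [_ _ hj] := hK t u x (delta_mx ord0 i) 0 h reg xi1 om0 htm hu.
have {hj} := hj c i; rewrite mulr0 addr0 => hj.
have d2le : `|field_d2 mu s (delta_mx ord0 i) 0 i u x| <= K' / t * density mu s u x.
  rewrite /field_d2 /density -(IntM mu_nice s_gt0 mS)//.
  have [_ _ _ d2] := jet_dominated s_gt0 (lexx _) reg xi1 om0.
  apply: (Int_norm_le mu_nice s_gt0 mS) => //; first exact: dominatedM.
  move=> y Sy; have [_ u0 hm] := reg.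
  by have [_ _ _ hb] := hK' t u _ _ _ t0 (hm y Sy) u0 xi1 om0; exact: hb.
set E1 := field _ _ _ _ _ (x + _) in hj *; set E0 := field _ _ _ _ _ x in hj *.
set D1 := field_d1 _ _ _ _ _ _ _ in hj *; set D2 := field_d2 _ _ _ _ _ _ _ in hj d2le *.
set q := density _ _ _ _ in hj d2le q0 tq *.
have -> : D1 - (E1 - E0) / h = - (E1 - (E0 + h * D1 + h ^+ 2 * D2)) / h - h * D2 by field; rewrite gt_eqF.
have b1 : `|- (E1 - (E0 + h * D1 + h ^+ 2 * D2)) / h| <= K * h ^+ 2 / t ^+ 2 * q.
  rewrite normrM normrN normfV (gtr0_norm h0) ler_pdivrMr//; apply: (le_trans hj).
  rewrite (gtr0_norm h0) le_eqVlt; apply/orP; left; apply/eqP; field; rewrite gt_eqF//.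
have b2 : `|h * D2| <= h * (K' / t * q) by rewrite normrM (gtr0_norm h0); apply: ler_wpM2l => //; exact: ltW.
apply: (le_trans (ler_normB _ _)); apply: (le_trans (lerD b1 b2)).
have ht4 : h <= t ^+ 4 by have := exprn_gt0 4 t0; lra.
have e1 : K * h ^+ 2 / t ^+ 2 * q <= K * C0 * t ^+ 2.
  have -> : K * h ^+ 2 / t ^+ 2 * q = K * (h / t ^+ 3 * h) * (t * q) by field; rewrite gt_eqF.
  rewrite [leRHS]mulrAC; apply: ler_pM => //.
  - by rewrite mulr_ge0// mulr_ge0 ?(ltW h0)// divr_ge0 ?exprn_ge0// ltW.
  - by rewrite mulr_ge0// ltW.
  apply: ler_wpM2l => //; rewrite -[leRHS]mul1r; apply: ler_pM.
  - by rewrite divr_ge0 ?exprn_ge0// ltW.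
  - exact: ltW.
  - rewrite ler_pdivrMr ?exprn_gt0// mul1r; apply: (le_trans ht4).
    by rewrite exprS ler_piMl// exprn_ge0// ltW.
  apply: (le_trans ht4); rewrite (_ : 4%N = (2 + 2)%N)// exprD ler_piMl// ?exprn_ge0 ?(ltW t0)//.
  by rewrite exprn_ile1// ltW.
have e2 : h * (K' / t * q) <= K' * C0 * t ^+ 2.
  have -> : h * (K' / t * q) = K' * (h / t ^+ 2) * (t * q) by field; rewrite gt_eqF.
  rewrite [leRHS]mulrAC; apply: ler_pM => //.
  - by rewrite mulr_ge0// divr_ge0 ?exprn_ge0// ltW.
  - by rewrite mulr_ge0// ltW.
  apply: ler_wpM2l => //; rewrite ler_pdivrMr ?exprn_gt0// -exprD; exact: ht4.
move: e1 e2; rewrite /u; lra.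
Qed.

End Divergence.

Section FluxLowerBound.
Context {R : realType} {d : nat}.
Local Notation Rd := (@Rdm R d).
Variables (mu : {measure set Rd -> \bar R}) (s Lam : R).
Hypothesis mu_nice : nice s Lam mu.
Hypothesis s_gt0 : 0 < s.
Hypothesis s_le : s + 1 <= d%:R.
Hypothesis d_gt0 : (0 < d)%N.
Implicit Types (u t r : R) (x y v : 'rV[R]_d) (c : 'I_d -> R).

Local Notation S := (supp mu : set Rd).
Local Notation Int f := (\int[mu]_(y in S) f y).
Local Notation dom := (@dominated R d s S).

Lemma dominated_indic y0 r : 0 < r -> dom (\1_(eball y0 r : set Rd) : Rd -> R).
Proof.
move=> r0; split; first by apply: measurable_indic; exact: measurable_eball.
pose b : R := 2 * dotp y0 y0 + 2 * r ^+ 2 + 1.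
have b0 : 0 < b by have := dotp_ge0 y0; have := sqr_ge0 r; rewrite /b; lra.
exists (b `^ ((s + 1) / 2)); first exact: powR_ge0.
move=> y _; rewrite indicE; have [By|nBy] := pselect (eball y0 r y); last first.
  by rewrite memNset// normr0 mulr_ge0 ?powR_ge0.
rewrite mem_set// normr1.
have kb : b `^ (- ((s + 1) / 2)) <= ker s 1 (y : 'rV[R]_d).
  apply: powRN_le; [exact: exponent_ge0| by have := dotp_ge0 (y : 'rV[R]_d); lra|].
  have := dotp_shift (y : 'rV[R]_d) y0 0; rewrite !subr0 -[dotp (_ - y0) _]enorm_sqr.
  have := ler_sqr_ge0 (enorm_ge0 _) (ltW By); rewrite /b; lra.
apply: (@le_trans _ _ (b `^ ((s + 1) / 2) * b `^ (- ((s + 1) / 2)))).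
  by rewrite -powRD ?subrr ?powRr0// (gt_eqF b0) implybT.
by apply: ler_wpM2l => //; exact: powR_ge0.
Qed.

Lemma div_ker_ge0 u v : 0 <= u -> 0 < dotp v v + u -> 0 <= div_ker s u v.
Proof.
move=> u0 w0; have k0 := ker_ge0 s u v; have h1 : 0 <= d%:R - (s + 1) by rewrite subr_ge0.
have h2 : 0 <= s + 1 by have := s_gt0; lra.
by apply: addr_ge0; apply: mulr_ge0 => //; [exact: mulr_ge0|apply: divr_ge0 => //; exact: ltW].
Qed.

(** A lower bound independent of t. If s + 1 < d, the first term of the divergence is bounded below
    on a ball of fixed radius. If s + 1 = d, only the second term is left: it is of order t^-d on a
    ball of radius t, whose share of the average is of order t^d. *)
Lemma average_div_ker_ge y0 r : 0 < r -> exists2 c0, 0 < c0 &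
  forall N t y, 0 < t -> t <= 1 -> t <= r / 8 -> d%:R * mesh r N <= t -> eball y0 (r / 8) y ->
  c0 <= average y0 r N (fun x => tent y0 (r / 2) x * div_ker s (t ^+ 2) (x - y)).
Proof.
move=> r0; have dr : 0 < d%:R :> R by rewrite ltr0n.
have r80 : 0 < r / 8 by exact: divr_gt0.
have a0 := exponent_ge0 s_gt0; have s10 : 0 < s + 1 by have := s_gt0; lra.
have common N t y lam b : 0 < t -> d%:R * mesh r N <= lam -> lam <= r / 8 -> eball y0 (r / 8) y -> 0 <= b ->
    (forall v, enorm v <= lam -> b <= div_ker s (t ^+ 2) v) ->
    (lam / (2 * d%:R)) ^+ d * (1 / 2 * b) <= average y0 r N (fun x => tent y0 (r / 2) x * div_ker s (t ^+ 2) (x - y)).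
  move=> t0 hl lr yB b0 hb; have t20 : 0 < t ^+ 2 by exact: exprn_gt0.
  apply: (average_ge r0 (y := y) d_gt0 hl) => //.
  - by lra.
  - by move: yB; rewrite /eball/=; lra.
  - move=> x; apply: mulr_ge0; first exact: tent_ge0.
    by apply: div_ker_ge0; [exact: ltW|rewrite ltr_wpDl// dotp_ge0].
  - move=> x xy; apply: ler_pM => //; last exact: hb.
    apply: tent_half; first exact: divr_gt0.
    move: yB; rewrite /eball/=; have := enorm_dist x y y0; lra.
  - by apply: mulr_ge0 => //; lra.
have [sd|ds] := ltP (s + 1) (d%:R : R).
  pose b : R := (d%:R - (s + 1)) * ((r / 8) ^+ 2 + 1) `^ (- ((s + 1) / 2)).
  have w1 : 0 < (r / 8) ^+ 2 + 1 by rewrite ltr_wpDl// sqr_ge0.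
  have b0 : 0 < b by apply: mulr_gt0; [lra|exact: powR_gt0].
  exists ((r / 8 / (2 * d%:R)) ^+ d * (1 / 2 * b)).
    by apply: mulr_gt0; [apply: exprn_gt0; apply: divr_gt0 => //; exact: mulr_gt0|lra].
  move=> N t y t0 t1 tr ht yB; have t20 : 0 < t ^+ 2 by exact: exprn_gt0.
  apply: common => //; [exact: le_trans tr|exact: ltW|].
  move=> v vl; have w0 : 0 < dotp v v + t ^+ 2 by rewrite ltr_wpDl// dotp_ge0.
  apply: (@le_trans _ _ ((d%:R - (s + 1)) * ker s (t ^+ 2) v)).
    apply: ler_wpM2l; first lra.
    apply: powRN_le => //; apply: lerD; first by rewrite -enorm_sqr; exact: ler_sqr_ge0.
    by rewrite exprn_ile1// ltW.
  rewrite /div_ker lerDl; have k0 := ker_ge0 s (t ^+ 2) v.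
  by apply: mulr_ge0; [apply: mulr_ge0; exact: ltW|apply: divr_ge0 => //; exact: ltW].
have {ds} sd : s + 1 = d%:R by apply/eqP; rewrite eq_le s_le.
pose b : R := (s + 1) / 2 * 2 `^ (- ((s + 1) / 2)).
have b0 : 0 < b by apply: mulr_gt0; [exact: divr_gt0|exact: powR_gt0].
exists ((1 / (2 * d%:R)) ^+ d * (1 / 2 * b)).
  by apply: mulr_gt0; [apply: exprn_gt0; apply: divr_gt0 => //; exact: mulr_gt0|lra].
move=> N t y t0 t1 tr ht yB; have t20 : 0 < t ^+ 2 by exact: exprn_gt0.
apply: (@le_trans _ _ ((t / (2 * d%:R)) ^+ d * (1 / 2 * (b * t `^ (- (s + 1)))))).
  rewrite le_eqVlt; apply/orP; left; apply/eqP.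
  have td : t ^+ d * t `^ (- (s + 1)) = 1.
    by rewrite -powR_mulrn ?(ltW t0)// -powRD ?(gt_eqF t0) ?implybT// sd subrr powRr0.
  have -> : (t / (2 * d%:R)) ^+ d = t ^+ d * (1 / (2 * d%:R)) ^+ d by rewrite -exprMn mulrA mulr1.
  move: (t ^+ d) (t `^ _) td ((1 / _) ^+ d) (1 / 2 : R) => p q pq z h.
  by rewrite -[LHS]mulr1 -[X in _ * X = _]pq; ring.
apply: common => //; first by rewrite mulr_ge0 ?powR_ge0// ltW.
move=> v vt; have w0 : 0 < dotp v v + t ^+ 2 by rewrite ltr_wpDl// dotp_ge0.
have wt : dotp v v + t ^+ 2 <= 2 * t ^+ 2.
  have := ler_sqr_ge0 (enorm_ge0 _) vt; rewrite enorm_sqr; lra.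
have kt : 2 `^ (- ((s + 1) / 2)) * t `^ (- (s + 1)) <= ker s (t ^+ 2) v.
  rewrite (_ : t `^ (- (s + 1)) = (t ^+ 2) `^ (- ((s + 1) / 2))); last first.
    by rewrite powR_sqr ?(ltW t0)//; congr (_ `^ _); lra.
  rewrite -powRM ?(ltW t20)//; exact: (powRN_le a0 w0 wt).
rewrite /div_ker sd subrr mul0r add0r -sd /b -mulrA.
rewrite (_ : (s + 1) * t ^+ 2 * _ = (s + 1) * (ker s (t ^+ 2) v * (t ^+ 2 / (dotp v v + t ^+ 2)))); last first.
  by field; rewrite gt_eqF.
rewrite -[leLHS]mulrA; apply: ler_wpM2l; first exact: ltW.
rewrite mulrC; apply: ler_pM => //.
- by rewrite mulr_ge0 ?powR_ge0.
- by rewrite ler_pdivlMr// ; lra.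
Qed.

(** The finite average is exchanged with the integral over mu, and only the contribution of the y in
    B(y0, r/8) is kept. *)
Lemma average_divergence_ge y0 r : 0 < r -> supp mu y0 -> eball y0 r `<=` supp mu ->
  exists2 c0, 0 < c0 & forall N t, 0 < t -> t <= 1 -> t <= r / 8 -> d%:R * mesh r N <= t ->
  c0 <= average y0 r N (fun x => tent y0 (r / 2) x * divergence mu s (t ^+ 2) x).
Proof.
move=> r0 Sy0 BS; have [c0 c00 hc] := average_div_ker_ge y0 r0.
have r80 : 0 < r / 8 by exact: divr_gt0.
have mS := measurable_supp mu.
have mB := @measurable_eball R d y0 (r / 8).
have BS' : (eball y0 (r / 8) : set Rd) `<=` S.
  by move=> z zB; apply: BS; move: zB; rewrite /eball/=; lra.
have mfin : (mu (eball y0 (r / 8)) < +oo)%E.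
  by apply: le_lt_trans (mu_nice y0 r80) _; rewrite ltry.
have m0 : 0 < fine (mu (eball y0 (r / 8))) by apply: fine_gt0; rewrite mfin (Sy0 _ r80).
exists (c0 * fine (mu (eball y0 (r / 8)))); first exact: mulr_gt0.
move=> N t t0 t1 tr ht.
have di := dominated_indic y0 r80.
have IE : Int (\1_(eball y0 (r / 8) : set Rd)) = fine (mu (eball y0 (r / 8))).
  by rewrite /Rintegral integral_indic// setIidl.
rewrite -IE -(IntM mu_nice s_gt0 mS)//.
have reg x := @regular_sqr R d mu t x t0.
have dk x := div_ker_dominated s_gt0 (reg x).
have -> : average y0 r N (fun x => tent y0 (r / 2) x * divergence mu s (t ^+ 2) x) =
   Int (fun y : Rd => average y0 r N (fun x => tent y0 (r / 2) x * div_ker s (t ^+ 2) (x - (y : 'rV[R]_d)))).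
  rewrite /average (IntM mu_nice s_gt0 mS); last by apply: dominated_sum => k; exact: dominatedM.
  congr (_ * _); rewrite (Int_sum mu_nice s_gt0 mS); last by move=> k; exact: dominatedM.
  apply: eq_bigr => k _; rewrite (IntM mu_nice s_gt0 mS)//.
  by rewrite (divergence_Int mu_nice s_gt0 (reg _)).
apply: (Int_le mu_nice s_gt0 mS).
- exact: dominatedM.
- by apply: dominatedM; apply: dominated_sum => k; exact: dominatedM.
move=> y Sy; rewrite indicE; have [By|nBy] := pselect (eball y0 (r / 8) y); last first.
  rewrite memNset// mulr0; apply: mulr_ge0; first by apply: exprn_ge0; exact/ltW/mesh_gt0.
  apply: sumr_ge0 => k _; apply: mulr_ge0; first exact: tent_ge0.
  apply: div_ker_ge0; first exact: sqr_ge0.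
  by rewrite ltr_wpDl ?dotp_ge0// exprn_gt0.
by rewrite mem_set// mulr1; exact: hc.
Qed.

End FluxLowerBound.

(** * No ball in the support, by a flux argument *)

Section NoBall.
Context {R : realType} {d : nat}.
Local Notation Rd := (@Rdm R d).
Variable mu : {sigma_finite_measure set Rd -> \bar R}.
Variables (s Lam : R).
Hypothesis mu_nice : nice s Lam mu.
Hypothesis s_gt0 : 0 < s.
Hypothesis Lam_ge0 : 0 <= Lam.
Hypothesis s_le : s + 1 <= d%:R.
Variable c : 'I_d -> R.
Hypothesis bal : balanced mu s c.
Implicit Types (u t r : R) (x y : 'rV[R]_d).

Lemma mesh_small (r e : R) : 0 < r -> 0 < e -> exists N, mesh r N <= e.
Proof.
move=> r0 e0; exists (Num.bound (6 * r / e)); rewrite /mesh ler_pdivrMr ?ltr0n// [leRHS]mulrC -ler_pdivrMr//.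
have q0 : 0 <= 6 * r / e by rewrite divr_ge0 ?mulr_ge0// ltW.
by rewrite ltW// (lt_trans (archi_boundP q0))// ltr_nat.
Qed.

Lemma small_factor (e A b : R) : 0 < e -> 0 <= A -> 0 < b ->
  exists2 z, 0 < z & (z <= b) && (A * z <= e / 4).
Proof.
move=> e0 A0 b0; have A1 : 0 < 4 * (A + 1) by lra.
exists (Num.min b (e / (4 * (A + 1)))); first by rewrite lt_min b0 divr_gt0.
rewrite ge_min lexx/=; apply: (@le_trans _ _ (A * (e / (4 * (A + 1))))).
  by apply: ler_wpM2l => //; rewrite ge_min lexx orbT.
rewrite mulrA ler_pdivrMr// mulrAC; have : 0 <= e by exact: ltW.
nra.
Qed.

(* As t -> 0 the field tends to 0 on average over a ball contained in the support,
   so its average divergence must vanish; but the divergence charges the ball. *)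
Lemma support_no_ball y0 r : 0 < r -> ~ (eball y0 (4 * r) `<=` supp mu).
Proof.
move=> r0 BS; have s_lt : s < d%:R by have := s_le; lra.
have rr2 : r / 2 <= 2 * r by lra.
have half_in h x : h <= r / 2 -> eball y0 (r / 2 + h) x -> eball y0 r x by rewrite /eball/=; lra.
have twice_in h x : h <= r / 2 -> eball y0 (2 * r + h) x -> eball y0 (4 * r) x by rewrite /eball/=; lra.
have double (z T P : R) : 1 / 2 <= T -> 0 <= P -> 0 <= z -> z + P <= 2 * (z + T * P).
  by move=> hT P0 z0; have := ler_wpM2r P0 hT; lra.
have d_gt0 : (0 < d)%N by rewrite -(ltr_nat R); apply: lt_trans s_lt.
have Sy0 : supp mu y0 by apply: BS; rewrite /eball/= subrr enorm0 mulr_gt0.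
have BS1 : eball y0 r `<=` supp mu by move=> z zB; apply: BS; move: zB; rewrite /eball/=; lra.
have [c0 c00 lower] := average_divergence_ge mu_nice s_gt0 s_le d_gt0 r0 Sy0 BS1.
have [Cb Cb0 fb] := field_bound mu_nice s_gt0 Lam_ge0 s_lt bal.
have [Kd Kd0 taylor] := difference_divergence mu_nice s_gt0 Lam_ge0.
pose V : R := (6 * r) ^+ d.
have V0 : 0 <= V by rewrite /V exprn_ge0// mulr_ge0// ltW.
pose C0 : R := 2 `^ (s + 2) * Lam.
have C00 : 0 <= C0 by rewrite /C0; nonneg.
have s1 : 0 < s + 1 by have := s_gt0; lra.
pose A2 : R := 2 `^ ((s + 1) / 2).
have A20 : 0 <= A2 by exact: powR_ge0.
have flux N t rho (M : 'rV[R]_d -> R) : 0 < t -> t <= 1 -> mesh r N <= t ^+ 4 / 6 -> mesh r N <= r / 2 ->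
    0 < rho -> rho <= 2 * r -> (forall x, 0 <= M x) ->
    (forall x, eball y0 (rho + mesh r N) x -> forall i, `|field mu s c (t ^+ 2) i x| <= M x) ->
    average y0 r N (fun x => tent y0 rho x * divergence mu s (t ^+ 2) x) <=
      rho^-1 * (d%:R * average y0 r N M) + V * (Kd * t ^+ 2).
  move=> t0 t1 hN hr rho0 rr M0 hM; have h0 := mesh_gt0 N r0.
  pose D x i := (field mu s c (t ^+ 2) i (x + mesh r N *: delta_mx ord0 i) - field mu s c (t ^+ 2) i x) / mesh r N.
  have -> : average y0 r N (fun x => tent y0 rho x * divergence mu s (t ^+ 2) x) =
     \sum_i average y0 r N (fun x => tent y0 rho x * D x i) +
     average y0 r N (fun x => tent y0 rho x * (divergence mu s (t ^+ 2) x - \sum_i D x i)).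
    rewrite -average_sum -averageD; congr average; apply/funext => x.
    by rewrite -mulr_sumr -mulrDr addrC subrK.
  apply: lerD.
    rewrite mulrCA mulr_natl -[X in _ *+ X](card_ord d) -sumr_const; apply: ler_sum => i _.
    apply: le_trans (ler_norm _) _.
    by apply: average_flux => // x xB; exact: hM.
  rewrite -(average_cst y0 r N).
  apply: (le_trans (ler_norm _)).
  apply: (@average_norm_le R d y0 r N r0 (fun x => tent y0 rho x * (divergence mu s (t ^+ 2) x - \sum_i D x i))
    (fun=> Kd * t ^+ 2)) => x.
  rewrite normrM ger0_norm ?tent_ge0// -[leRHS]mul1r; apply: ler_pM => //; first exact: tent_ge0.
    exact: tent_le1.
  exact: taylor.
pose C1 : R := (2 * r)^-1 * (d%:R * (V * (Cb * (1 + C0)))) + V * Kd.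
have C10 : 0 <= C1 by rewrite /C1; nonneg.
pose C2 : R := C1 / (s + 1) + V * (A2 * C0).
have C20 : 0 <= C2 by rewrite /C2; nonneg.
have tqle t x : 0 < t -> t * density mu s (t ^+ 2) x <= C0 by move=> t0; exact: density_le.
have step (tau theta : R) : 0 < tau -> tau <= 1 -> tau ^+ 3 <= r / 8 -> 0 < theta -> theta <= 1 ->
    c0 <= (r / 2)^-1 * (d%:R * (2 * Cb * (V * theta + theta `^ (- s) * (C2 * tau)))) + V * (Kd * tau).
  move=> tau0 tau1 taur th0 th1.
  (* The density is split at rho = tau^2: with t = tau^3 one has t rho^2 = tau t^2, and t times the
     density at scale rho is tau times the bounded quantity rho q. Both parts gain a factor tau. *)
  set t := tau ^+ 3 in taur *.
  have t0 : 0 < t by exact: exprn_gt0.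
  have t1 : t <= 1 by apply: exprn_ile1 => //; exact: ltW.
  have ttau : t <= tau by rewrite /t exprS ler_piMr ?(ltW tau0)// exprn_ile1// ltW.
  have e0 : 0 < Num.min (t ^+ 4 / 6) (Num.min (r / 2) (t / d%:R)).
    rewrite !lt_min; apply/and3P; split; [by rewrite divr_gt0// exprn_gt0|exact: divr_gt0|].
    by rewrite divr_gt0// ltr0n.
  have [N hN] := mesh_small r0 e0; move: hN; rewrite !le_min => /and3P[h1 h2 h3].
  rewrite ler_pdivlMr ?ltr0n// mulrC in h3.
  apply: (le_trans (lower N t t0 t1 taur h3)).
  have reg x := @regular_sqr R d mu t x t0.
  have q0 x : 0 <= density mu s (t ^+ 2) x by exact: density_ge0.
  (* With theta = 1 the field is bounded on B(y0, 4 r), so the flux through the outer tent is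
     bounded independently of t. *)
  have B1 : average y0 r N (fun x => tent y0 (2 * r) x * divergence mu s (t ^+ 2) x) <= C1.
    have CC0 : 0 <= Cb * (1 + C0) by nonneg.
    apply: (le_trans (flux N t (2 * r) (fun=> Cb * (1 + C0)) t0 t1 h1 h2 _ (lexx _) _ _)) => //.
    - exact: mulr_gt0.
    - move=> x xB i; have Sx : supp mu x by exact/BS/(twice_in _ _ h2).
      apply: (le_trans (fb 1 ltr01 (lexx _) x Sx t t0 i)); apply: ler_wpM2l => //.
      by rewrite powR1 mul1r lerD2l; exact: tqle.
    rewrite average_cst// /C1 lerD2l; apply: ler_wpM2l => //; apply: ler_piMr => //.
    by rewrite exprn_ile1// ltW.
  have B2 : (s + 1) * average y0 r N (fun x => tent y0 (2 * r) x * (t ^+ 2 * steep_density mu s (t ^+ 2) x)) <= C1.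
    rewrite -averageM; apply: le_trans B1; apply: average_le => // x.
    rewrite mulrCA; apply: ler_wpM2l; first exact: tent_ge0.
    rewrite (divergenceE mu_nice s_gt0 (reg x)) mulrA lerDr; apply: mulr_ge0 => //.
    by rewrite subr_ge0.
  have pw x : t * density mu s (t ^+ 2) x <= tau * (t ^+ 2 * steep_density mu s (t ^+ 2) x) + tau * (A2 * C0).
    have tau20 : 0 < tau ^+ 2 by exact: exprn_gt0.
    apply: (le_trans (ler_wpM2l (ltW t0) (density_split mu_nice s_gt0 x t0 tau20))).
    rewrite mulrDr; apply: lerD.
      by rewrite le_eqVlt; apply/orP; left; apply/eqP; rewrite /t; ring.
    have -> : t * (2 `^ ((s + 1) / 2) * density mu s ((tau ^+ 2) ^+ 2) x) =
       tau * (A2 * (tau ^+ 2 * density mu s ((tau ^+ 2) ^+ 2) x)) by rewrite /t /A2; ring.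
    by apply: ler_wpM2l; [exact: ltW|apply: ler_wpM2l => //; exact: tqle].
  have B3 : average y0 r N (fun x => tent y0 (2 * r) x * (t * density mu s (t ^+ 2) x)) <= C2 * tau.
    apply: (@le_trans _ _ (average y0 r N (fun x => tau * (tent y0 (2 * r) x * (t ^+ 2 * steep_density mu s (t ^+ 2) x)) + tau * (A2 * C0)))).
      apply: average_le => // x; have T0 := tent_ge0 y0 (2 * r) x.
      apply: (le_trans (ler_wpM2l T0 (pw x))); rewrite mulrDr mulrCA; apply: lerD => //.
      apply: ler_piMl; first by nonneg.
      by apply: tent_le1; exact: mulr_gt0.
    rewrite averageD averageM average_cst// -/V /C2 (mulrDl (C1 / (s + 1))); apply: lerD.
      by rewrite [leLHS]mulrC; apply: ler_wpM2r; [exact: ltW|rewrite ler_pdivlMr// mulrC].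
    by rewrite le_eqVlt; apply/orP; left; apply/eqP; ring.
  (* The outer tent is at least 1/2 on B(y0, r), so the factor 2 allows the density to be weighted
     by it, where its average is already known to be O(tau). *)
  pose M x : R := 2 * Cb * (theta + theta `^ (- s) * (tent y0 (2 * r) x * (t * density mu s (t ^+ 2) x))).
  have M0 x : 0 <= M x.
    by have := tent_ge0 y0 (2 * r) x; have := q0 x; rewrite /M => q0x T0; nonneg.
  apply: (le_trans (flux N t (r / 2) M t0 t1 h1 h2 _ _ M0 _)).
  - exact: divr_gt0.
  - exact: rr2.
  - move=> x xB i; have xr : eball y0 r x by exact: half_in h2 xB.
    apply: (le_trans (fb theta th0 th1 x (BS1 x xr) t t0 i)).
    rewrite /M (mulrC 2) -[leRHS]mulrA; apply: ler_wpM2l => //.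
    have T : 1 / 2 <= tent y0 (2 * r) x.
      by apply: tent_half; [exact: mulr_gt0|rewrite mulrAC divff// mul1r].
    have P0 : 0 <= theta `^ (- s) * (t * density mu s (t ^+ 2) x).
      by have := q0 x => q0x; nonneg.
    by rewrite [in leRHS]mulrCA; apply: double => //; exact: ltW.
  apply: lerD; last first.
    apply: ler_wpM2l => //; apply: ler_wpM2l => //; apply: le_trans ttau.
    by rewrite expr2 ler_piMr// ltW.
  apply: ler_wpM2l; first by rewrite invr_ge0 divr_ge0// ltW.
  apply: ler_wpM2l => //; rewrite /M averageM; apply: ler_wpM2l; first by nonneg.
  rewrite averageD averageM average_cst// -/V lerD2l; apply: ler_wpM2l => //; exact: powR_ge0.
pose A1 : R := (r / 2)^-1 * (d%:R * (2 * Cb * V)).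
have r2 : 0 <= (r / 2)^-1 by rewrite invr_ge0 divr_ge0// ltW.
have A10 : 0 <= A1 by rewrite /A1; nonneg.
(* The order of choice matters: theta makes its own term small, and tau is chosen afterwards because
   its coefficient contains theta^-s. *)
have [theta th0 /andP[th1 thA]] := small_factor c00 A10 ltr01.
pose A3 : R := (r / 2)^-1 * (d%:R * (2 * Cb * (theta `^ (- s) * C2))) + V * Kd.
have A30 : 0 <= A3 by rewrite /A3; nonneg.
have b0 : 0 < Num.min 1 (r / 8) by rewrite lt_min ltr01 divr_gt0.
have [tau tau0 /andP[taub tauA]] := small_factor c00 A30 b0.
move: taub; rewrite le_min => /andP[tau1 taur].
have tau3 : tau ^+ 3 <= r / 8.
  by apply: le_trans taur; rewrite exprS ler_piMr ?(ltW tau0)// exprn_ile1// ltW.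
have := step tau theta tau0 tau1 tau3 th0 th1.
have -> : (r / 2)^-1 * (d%:R * (2 * Cb * (V * theta + theta `^ (- s) * (C2 * tau)))) + V * (Kd * tau) =
  A1 * theta + A3 * tau by rewrite /A1 /A3; ring.
move: thA tauA c00; clear; lra.
Qed.

End NoBall.

(** * The Bessel operator, s > d - 1 *)

Section BesselIdentities.
Context {R : realType} {d : nat}.
Local Notation Rd := (@Rdm R d).
Variables (mu : {measure set Rd -> \bar R}) (s Lam : R).
Hypothesis mu_nice : nice s Lam mu.
Hypothesis s_gt0 : 0 < s.
Implicit Types (u om m t : R) (x y v xi : 'rV[R]_d) (i j : 'I_d).

Local Notation S := (supp mu : set Rd).
Local Notation Int f := (\int[mu]_(y in S) f y).
Local Notation dom := (@dominated R d s S).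
Local Notation e_ i := (delta_mx ord0 i : 'rV[R]_d).

Lemma dotp0 v : dotp v 0 = 0.
Proof. by rewrite -(scale0r (0 : 'rV[R]_d)) dotpZr mul0r. Qed.

Lemma dotp_weight u v : 0 < dotp v v + u -> dotp v v = dotp v v + u - u.
Proof. by rewrite addrK. Qed.

Let beta : R := s + 1 - d%:R.

(** This is L applied to the kernel of E. The second-order coefficients are half second derivatives,
    hence the factors 2 and 8 u in place of 1 and 4 u. *)
Lemma riesz_bessel u v j : 0 < dotp v v + u ->
  2 * (\sum_i riesz_d2 s (e_ i) 0 j u v) + (8 * u * riesz_d2 s 0 1 j u v + 2 * beta * riesz_d1 s 0 1 j u v) = 0.
Proof.
move=> w0; set k := ker s u v; set a := (s + 1) / 2.
have e i : riesz_d2 s (e_ i) 0 j u v =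
   (2 * a * (a + 1) * v ord0 j * k / (dotp v v + u) ^+ 2) * (v ord0 i * v ord0 i) - a * v ord0 j / (dotp v v + u) * k -
     (if i == j then 2 * a * v ord0 j / (dotp v v + u) * k else 0).
  rewrite /riesz_d2 !dotp_delta !mxE !eqxx -/k -/a /= eq_sym; case: eqP => [->|_] /=; by field; rewrite gt_eqF.
rewrite (eq_bigr _ (fun i _ => e i)) !sumrB sumr_const card_ord -mulr_sumr -/(dotp v v) -mulr_natl.
rewrite -big_mkcond big_pred1_eq /riesz_d2 /riesz_d1 !dotp0 !mxE -/k -/a (dotp_weight w0) subrK.
move: (dotp v v + u) w0 => w w0.
by rewrite /beta (_ : s = 2 * a - 1); [field; rewrite gt_eqF|rewrite /a; lra].
Qed.

(** Up to a factor w^-a is the u-derivative of the potential annihilated by L, and d_u does not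
    commute with L: the commutator -4 d_uu leaves the right-hand side. *)
Lemma ker_bessel u v : 0 < dotp v v + u ->
  2 * (\sum_i ker_d2 s (e_ i) 0 u v) + (8 * u * ker_d2 s 0 1 u v + 2 * beta * ker_d1 s 0 1 u v) = - 4 * ker_d1 s 0 1 u v.
Proof.
move=> w0; set k := ker s u v; set a := (s + 1) / 2.
have e i : ker_d2 s (e_ i) 0 u v =
   (2 * a * (a + 1) * k / (dotp v v + u) ^+ 2) * (v ord0 i * v ord0 i) - a / (dotp v v + u) * k.
  rewrite /ker_d2 !dotp_delta !mxE !eqxx -/k -/a /=; by field; rewrite gt_eqF.
rewrite (eq_bigr _ (fun i _ => e i)) !sumrB sumr_const card_ord -mulr_sumr -/(dotp v v) -mulr_natl.
rewrite /ker_d2 /ker_d1 !dotp0 -/k -/a (dotp_weight w0) subrK.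
move: (dotp v v + u) w0 => w w0.
by rewrite /beta (_ : s = 2 * a - 1); [field; rewrite gt_eqF|rewrite /a; lra].
Qed.

Let xi_e i : enorm (e_ i) <= 1. Proof. by rewrite enorm_delta. Qed.
Let xi_0 : enorm (0 : 'rV[R]_d) <= 1. Proof. by rewrite enorm0. Qed.
Let om_0 m : `|0 : R| <= 0 * m. Proof. by rewrite normr0 mul0r. Qed.

(** The choice B = 1/m admits om = 1 in the jet lemmas. The constants then depend on m, which is
    harmless for exact identities and local expansions. *)
Lemma vertical_le m : 0 < m -> `|1 : R| <= m^-1 * m.
Proof. by move=> m0; rewrite mulVf ?gt_eqF// normr1. Qed.

Section At.
Variables (m u : R) (x : 'rV[R]_d).
Hypothesis reg : regular mu m u x.

Let m0 : 0 < m. Proof. by case: reg. Qed.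
Let mV : 0 <= m^-1. Proof. by rewrite invr_ge0 ltW. Qed.
Let mS := measurable_supp mu.
Let he i := jet_dominated s_gt0 (lexx 0) reg (xi_e i) (om_0 m).
Let hu := jet_dominated s_gt0 mV reg xi_0 (vertical_le m0).

Lemma field_bessel j : 2 * (\sum_i field_d2 mu s (e_ i) 0 j u x) +
  (8 * u * field_d2 mu s 0 1 j u x + 2 * beta * field_d1 mu s 0 1 j u x) = 0.
Proof.
have d1 i : dom (fun y => riesz_d2 s (e_ i) 0 j u (x - (y : 'rV[R]_d))) by have [_ _ _] := he i; exact.
have [_ _ /(_ j) d2 /(_ j) d3] := hu.
rewrite /field_d2 /field_d1 -(Int_sum mu_nice s_gt0 mS)//.
rewrite -!(IntM mu_nice s_gt0 mS)//; last exact: dominated_sum.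
rewrite -(IntD mu_nice s_gt0 mS); [|exact: dominatedM..].
rewrite -(IntD mu_nice s_gt0 mS); [|exact/dominatedM/dominated_sum|by apply: dominatedD; exact: dominatedM].
transitivity (Int (fun=> 0 : R)); last by rewrite Rintegral_cst// mul0r.
apply: eq_Rintegral => y /set_mem Sy; apply: riesz_bessel; exact: regular_gt0 reg y Sy.
Qed.

Lemma density_bessel : 2 * (\sum_i density_d2 mu s (e_ i) 0 u x) +
  (8 * u * density_d2 mu s 0 1 u x + 2 * beta * density_d1 mu s 0 1 u x) = - 4 * density_d1 mu s 0 1 u x.
Proof.
have d1 i : dom (fun y => ker_d2 s (e_ i) 0 u (x - (y : 'rV[R]_d))) by have [_ h _ _] := he i.
have [d2 d3 _ _] := hu.
rewrite /density_d2 /density_d1 -(Int_sum mu_nice s_gt0 mS)//.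
rewrite -!(IntM mu_nice s_gt0 mS)//; last exact: dominated_sum.
rewrite -(IntD mu_nice s_gt0 mS); [|exact: dominatedM..].
rewrite -(IntD mu_nice s_gt0 mS); [|exact/dominatedM/dominated_sum|by apply: dominatedD; exact: dominatedM].
apply: eq_Rintegral => y /set_mem Sy; apply: ker_bessel; exact: regular_gt0 reg y Sy.
Qed.

(** Both sides are mixed derivatives of one potential: E is a multiple of its x-gradient and q of
    its u-derivative. *)
Lemma density_gradient i : density_d1 mu s (e_ i) 0 u x = 2 * field_d1 mu s 0 1 i u x.
Proof.
have [_ _ /(_ i) d2 _] := hu.
rewrite /density_d1 /field_d1 -(IntM mu_nice s_gt0 mS)//; apply: eq_Rintegral => y /set_mem Sy.
have w0 := regular_gt0 reg Sy.
by rewrite /ker_d1 /riesz_d1 dotp0 dotp_delta !mxE; field; rewrite gt_eqF.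
Qed.

Lemma field_divergence : \sum_i field_d1 mu s (e_ i) 0 i u x =
  - beta * density mu s u x - 2 * u * density_d1 mu s 0 1 u x.
Proof.
have [d2 _ _ _] := hu; have dk := regular_dominated_ker s_gt0 reg.
rewrite -/(divergence mu s u x) (divergence_Int mu_nice s_gt0 reg) /density /density_d1.
rewrite -!(IntM mu_nice s_gt0 mS)// -(IntB mu_nice s_gt0 mS); [|exact: dominatedM..].
apply: eq_Rintegral => y /set_mem Sy; have w0 := regular_gt0 reg Sy.
by rewrite /div_ker /ker_d1 dotp0 /beta; field; rewrite gt_eqF.
Qed.

End At.

(** The best regularity constant is the distance itself, the root of the infimum of the weights. A
    point p of the support attains that infimum up to a factor 2. *)
Lemma regular_scale m u x : regular mu m u x -> (exists p, supp mu p) ->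
  exists r p, [/\ regular mu r u x, supp mu p & dotp (x - p) (x - p) + u <= 2 * r ^+ 2].
Proof.
move=> [m0 u0 hm] [p0 Sp0].
pose W := [set z : R | exists2 y, supp mu y & z = dotp (x - y) (x - y) + u].
have lbW : lbound W (m ^+ 2) by move=> _ [y Sy ->]; exact: hm.
have hW : has_inf W by split; [exists (dotp (x - p0) (x - p0) + u); exists p0|exists (m ^+ 2)].
have i0 : m ^+ 2 <= inf W by apply: lb_le_inf => //; case: hW.
have i1 : 0 < inf W by apply: lt_le_trans i0; exact: exprn_gt0.
have [_ [p Sp ->] hp] := inf_adherent i1 hW.
have s2 : Num.sqrt (inf W) ^+ 2 = inf W by rewrite sqr_sqrtr// ltW.
exists (Num.sqrt (inf W)), p; split => //; last by rewrite s2; lra.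
split => //; first by rewrite sqrtr_gt0.
by move=> y Sy; rewrite s2; apply: ge_inf; [exists (m ^+ 2)|exists y].
Qed.

End BesselIdentities.

(** * Field bounds away from the support *)

Section FieldBoundOff.
Context {R : realType} {d : nat}.
Local Notation Rd := (@Rdm R d).
Variable mu : {sigma_finite_measure set Rd -> \bar R}.
Variables (s Lam : R).
Hypothesis mu_nice : nice s Lam mu.
Hypothesis s_gt0 : 0 < s.
Hypothesis Lam_ge0 : 0 <= Lam.
Hypothesis s_ltd : s < d%:R.
Variable c : 'I_d -> R.
Hypothesis bal : balanced mu s c.
Implicit Types (u t r m : R) (x y p : 'rV[R]_d).

Lemma shift_bound (z u m : R) : 0 < m -> 0 <= u -> u <= 25 * m ^+ 2 -> z <= 5 * m ->
  z + `|u - m ^+ 2| / m <= 31 * m.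
Proof.
move=> m0 u0 um zm; have : `|u - m ^+ 2| / m <= 25 * m.
  by rewrite ler_pdivrMr// ler_norml -mulrA -expr2; have := sqr_ge0 m => ?; apply/andP; split; lra.
lra.
Qed.

Lemma combine_bounds (e1 e2 e3 k A B D theta T P P' : R) : e1 <= e2 + e3 -> e2 <= k * P' ->
  e3 <= B * (theta + T * P') -> P' <= A * P -> 1 <= T -> 0 <= theta -> 0 <= P ->
  0 <= k -> 0 <= A -> 0 <= B -> 0 <= D -> e1 <= (D + (k * A + B + B * A)) * (theta + T * P).
Proof.
move=> h1 h2 h3 h4 T1 th0 P0 k0 A0 B0 D0; have T0 : 0 <= T by lra.
have TP : 0 <= T * P by exact: mulr_ge0.
have g1 : k * P' <= k * A * (T * P).
  rewrite -mulrA; apply: ler_wpM2l => //; apply: (le_trans h4).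
  by apply: ler_wpM2l => //; rewrite ler_peMl.
have g2 : B * (T * P') <= B * A * (T * P).
  by rewrite -mulrA; apply: ler_wpM2l => //; rewrite (mulrCA A); apply: ler_wpM2l.
have g3 : 0 <= k * A * theta by nonneg.
have g4 : 0 <= D * (theta + T * P) by nonneg.
have g5 : 0 <= B * (T * P) by nonneg.
have g6 : 0 <= B * A * theta by nonneg.
by apply: (le_trans h1); lra.
Qed.

(** A point (x, u) whose distance to the support is comparable with m is exchanged for (p, m^2) with
    p in the support: the weights are comparable, so the densities are too and the fields differ by
    O(m q). *)
Lemma field_bound_off : exists2 C : R, 0 <= C & forall m u x p,
  regular mu m u x -> supp mu p -> enorm (x - p) <= 5 * m -> u <= 25 * m ^+ 2 ->
  m * density mu s u x <= C /\
  forall theta, 0 < theta -> theta <= 1 -> forall j,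
    `|field mu s c u j x| <= C * (theta + theta `^ (- s) * (m * density mu s u x)).
Proof.
have [Cb Cb0 fb] := field_bound mu_nice s_gt0 Lam_ge0 s_ltd bal.
(* Comparing the weights at x and p takes 2 * 25 + 25 = 75; the reverse comparison takes less. *)
pose b : R := 78.
have b1 : 1 <= b by rewrite /b; lra.
have b0 : 0 < b by rewrite /b; lra.
pose K := b `^ ((s + 1) / 2) + (s + 1) / 2 * b `^ ((s + 1) / 2 + 1) * (b + 1).
have a0 := exponent_ge0 s_gt0.
have K0 : 0 <= K by rewrite /K; have := ltW b0; move=> ?; nonneg.
pose A := b `^ ((s + 1) / 2).
have A0 : 0 <= A by exact: powR_ge0.
pose C0 := 2 `^ (s + 2) * Lam.
have C00 : 0 <= C0 by rewrite /C0; nonneg.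
exists (A * C0 + (K * 31 * A + Cb + Cb * A)); first by nonneg.
move=> m u x p reg Sp xp um; have [m0 u0 hm] := reg.
have regp := @regular_sqr R d mu m p m0.
have mS := measurable_supp mu.
have m20 : 0 < m ^+ 2 by exact: exprn_gt0.
have xp2 : dotp (x - p) (x - p) <= 25 * m ^+ 2.
  by have := ler_sqr_ge0 (enorm_ge0 _) xp; rewrite enorm_sqr; lra.
have px2 : dotp (p - x) (p - x) <= 25 * m ^+ 2.
  by rewrite -enorm_sqr enormB enorm_sqr.
have dk := regular_dominated_ker s_gt0 reg; have dkp := regular_dominated_ker s_gt0 regp.
have cmp1 y : dotp (x - y) (x - y) + u <= b * (dotp (p - y) (p - y) + m ^+ 2).
  by apply: weight_comparable; rewrite /b; lra.
have cmp2 y : supp mu y -> dotp (p - y) (p - y) + m ^+ 2 <= b * (dotp (x - y) (x - y) + u).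
  move=> Sy; have := dotp_shift p x y; have := hm y Sy; have := dotp_ge0 (x - y); rewrite /b; lra.
have wp y : 0 < dotp (p - y) (p - y) + m ^+ 2 by rewrite ltr_wpDl// dotp_ge0.
have qle : density mu s (m ^+ 2) p <= A * density mu s u x.
  rewrite /density -(IntM mu_nice s_gt0 mS)//; apply: (Int_le mu_nice s_gt0 mS) => //; first exact: dominatedM.
  move=> y Sy; apply: ker_comparable => //; exact: regular_gt0 reg y Sy.
have qge : density mu s u x <= A * density mu s (m ^+ 2) p.
  rewrite /density -(IntM mu_nice s_gt0 mS)//; apply: (Int_le mu_nice s_gt0 mS) => //; first exact: dominatedM.
  move=> y Sy; apply: ker_comparable => //; [exact: regular_gt0 reg y Sy|exact: cmp2].
have q0 : 0 <= density mu s u x by exact: density_ge0.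
have P0 : 0 <= m * density mu s u x by rewrite mulr_ge0// ltW.
split.
  apply: (@le_trans _ _ (A * C0)); last by rewrite lerDl; nonneg.
  apply: (le_trans (ler_wpM2l (ltW m0) qge)); rewrite mulrCA; apply: ler_wpM2l => //.
  exact: density_le.
move=> theta th0 th1 j.
have ths : 1 <= theta `^ (- s).
  by have := powRN_le (ltW s_gt0) th0 th1; rewrite powR1.
have diff : `|field mu s c u j x - field mu s c (m ^+ 2) j p| <= K * 31 * (m * density mu s (m ^+ 2) p).
  rewrite /field (_ : forall a b e : R, a - e - (b - e) = a - b); last by move=> *; ring.
  have d1 := regular_dominated_riesz s_gt0 j reg; have d2 := regular_dominated_riesz s_gt0 j regp.
  rewrite -(IntB mu_nice s_gt0 mS)// /density mulrA -(IntM mu_nice s_gt0 mS)//.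
  apply: (Int_norm_le mu_nice s_gt0 mS) => //; [exact: dominatedB|exact: dominatedM|].
  move=> y Sy; rewrite (_ : forall a b e : R, a + e - (b + e) = a - b); last by move=> *; ring.
  have mp : m ^+ 2 <= dotp (p - (y : 'rV[R]_d)) (p - (y : 'rV[R]_d)) + m ^+ 2 by rewrite lerDr dotp_ge0.
  apply: (le_trans (@riesz_sub_le _ _ _ s_gt0 b m _ _ _ _ j b1 m0 u0 (ltW m20) mp (regular_gt0 reg Sy) (cmp1 y) (cmp2 y Sy))).
  apply: ler_wpM2r; first exact: ker_ge0.
  rewrite -/K -mulrA; apply: ler_wpM2l => //.
  rewrite (_ : x - (y : 'rV[R]_d) - (p - (y : 'rV[R]_d)) = x - p); last by rewrite opprB addrA subrK.
  exact: (shift_bound m0 u0 um xp).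
have f1 := fb theta th0 th1 p Sp m m0 j.
set E := field mu s c u j x in diff *; set E' := field _ _ _ _ _ _ in diff f1.
set q := density mu s u x in qle q0 P0 *; set q' := density _ _ _ _ in qle diff f1.
have q'm : m * q' <= A * (m * q) by rewrite mulrCA; apply: ler_wpM2l => //; exact: ltW.
have h1 : `|E| <= `|E - E'| + `|E'| by rewrite -{1}(subrK E' E); exact: ler_normD.
have K310 : 0 <= K * 31 by exact: mulr_ge0.
exact: (combine_bounds h1 diff f1 q'm ths (ltW th0) P0 K310 A0 Cb0 (mulr_ge0 A0 C00)).
Qed.

End FieldBoundOff.

(** * One-variable jets and their maxima *)

Section Jets.
Context {R : realType}.
Implicit Types (f g : R -> R) (D : R -> Prop) (a b c t r K M : R).

(** A second-order expansion at 0 with cubic error; c is half a second derivative. The domain D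
    makes it one-sided at u = 0, where only upward steps are allowed. *)
Definition jet D f a b c := exists K r, [/\ 0 <= K, 0 < r &
  forall t, D t -> `|t| <= r -> `|f t - (a + b * t + c * t ^+ 2)| <= K * `|t| ^+ 3].

Lemma jet_quadratic D a b c : jet D (fun t => a + b * t + c * t ^+ 2) a b c.
Proof. by exists 0, 1; split => // t _ _; rewrite subrr normr0 mul0r. Qed.

Lemma jet_ext D f g a b c a' b' c' : (forall t, f t = g t) -> a = a' -> b = b' -> c = c' ->
  jet D f a b c -> jet D g a' b' c'.
Proof. by move=> fg -> -> -> [K [r [K0 r0 h]]]; exists K, r; split => // t Dt tr; rewrite -fg h. Qed.

Lemma jetD D f g a b c a' b' c' : jet D f a b c -> jet D g a' b' c' ->
  jet D (fun t => f t + g t) (a + a') (b + b') (c + c').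
Proof.
move=> [K [r [K0 r0 h]]] [K' [r' [K'0 r'0 h']]].
exists (K + K'), (Num.min r r'); split; [exact: addr_ge0|by rewrite lt_min r0|].
move=> t Dt; rewrite le_min => /andP[tr tr'].
rewrite (_ : _ - _ = (f t - (a + b * t + c * t ^+ 2)) + (g t - (a' + b' * t + c' * t ^+ 2))); last by ring.
by rewrite mulrDl (le_trans (ler_normD _ _))// lerD ?h ?h'.
Qed.

Lemma jetM D f g a b c a' b' c' : jet D f a b c -> jet D g a' b' c' ->
  jet D (fun t => f t * g t) (a * a') (a * b' + b * a') (a * c' + b * b' + c * a').
Proof.
move=> [K [r [K0 r0 h]]] [K' [r' [K'0 r'0 h']]].
pose N := `|a| + `|b| + `|c|; pose N' := `|a'| + `|b'| + `|c'|.
have N0 : 0 <= N by rewrite /N !addr_ge0.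
have N'0 : 0 <= N' by rewrite /N' !addr_ge0.
exists (K * (N' + K') + N * K' + (`|b * c'| + `|c * b'| + `|c * c'|)), (Num.min 1 (Num.min r r')); split.
- by rewrite !addr_ge0// mulr_ge0// addr_ge0.
- by rewrite !lt_min ltr01 r0.
move=> t Dt; rewrite !le_min => /and3P[t1 tr tr'].
have tt : `|t| ^+ 2 <= 1 by apply: exprn_ile1.
have ttt : `|t| ^+ 3 <= 1 by apply: exprn_ile1.
have bnd x y z : `|x + y * t + z * t ^+ 2| <= `|x| + `|y| + `|z|.
  apply: (le_trans (ler_normD _ _)); apply: lerD.
    by apply: (le_trans (ler_normD _ _)); rewrite lerD2l normrM ler_piMr.
  by rewrite normrM normrX ler_piMr.
have {}h := h t Dt tr; have {}h' := h' t Dt tr'.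
have P1 := bnd a b c; have P2 := bnd a' b' c'.
set P := a + _ + _ in h P1; set P' := a' + _ + _ in h' P2.
have gN : `|g t| <= N' + K'.
  rewrite -[g t](subrK P') addrC; apply: (le_trans (ler_normD _ _)); apply: lerD => //.
  by apply: (le_trans h'); rewrite ler_piMr.
rewrite (_ : _ - _ = (f t - P) * g t + P * (g t - P') + (b * c' + c * b' + c * c' * t) * t ^+ 3); last first.
  by rewrite /P /P'; ring.
rewrite !(mulrDl _ _ (`|t| ^+ 3)); apply: (le_trans (ler_normD _ _)).
have e1 : `|(f t - P) * g t| <= K * (N' + K') * `|t| ^+ 3.
  by rewrite normrM mulrAC; apply: ler_pM.
have e2 : `|P * (g t - P')| <= N * K' * `|t| ^+ 3.
  by rewrite normrM -mulrA; apply: ler_pM.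
have e3 : `|(b * c' + c * b' + c * c' * t) * t ^+ 3| <= (`|b * c'| + `|c * b'| + `|c * c'|) * `|t| ^+ 3.
  rewrite normrM normrX; apply: ler_wpM2r; first exact: exprn_ge0.
  apply: (le_trans (ler_normD _ _)); apply: lerD; first exact: ler_normD.
  by rewrite normrM ler_piMr.
rewrite -!(mulrDl _ _ (`|t| ^+ 3)) mulrDl; apply: lerD => //; rewrite mulrDl.
by apply: (le_trans (ler_normD _ _)); exact: lerD.
Qed.

Lemma jetZ D z f a b c : jet D f a b c -> jet D (fun t => z * f t) (z * a) (z * b) (z * c).
Proof.
move=> jf; apply: (jet_ext _ _ _ _ (jetM (jet_quadratic D z 0 0) jf)) => [t|||]; ring.
Qed.

Lemma jet_sum (I : Type) (s : seq I) D (f : I -> R -> R) (a b c : I -> R) :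
  (forall i, jet D (f i) (a i) (b i) (c i)) ->
  jet D (fun t => \sum_(i <- s) f i t) (\sum_(i <- s) a i) (\sum_(i <- s) b i) (\sum_(i <- s) c i).
Proof.
move=> jf; elim: s => [|i s IH].
  by apply: (jet_ext _ _ _ _ (jet_quadratic D 0 0 0)) => [t|||]; rewrite !big_nil//; ring.
by apply: (jet_ext _ _ _ _ (jetD (jf i) IH)) => [t|||]; rewrite big_cons.
Qed.

Lemma le0_of_linear b M r : 0 < r -> (forall t, 0 < t -> t <= r -> b <= M * t) -> b <= 0.
Proof.
move=> r0 h; rewrite leNgt; apply/negP => b0.
pose t := Num.min r (b / (2 * (`|M| + 1))).
have M1 : 0 < 2 * (`|M| + 1) by have := normr_ge0 M; lra.
have t0 : 0 < t by rewrite lt_min r0 divr_gt0.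
have := h t t0; rewrite ge_min lexx => /(_ isT).
have tb : t * (2 * (`|M| + 1)) <= b by rewrite -ler_pdivlMr// ge_min lexx orbT.
have : M * t <= `|M| * t by apply: ler_wpM2r; [exact: ltW|exact: ler_norm].
have : 0 <= `|M| * t by rewrite mulr_ge0// ltW.
lra.
Qed.

(** For the boundary u = 0: one-sided maximality controls only the first-order coefficient. *)
Lemma jet_max_forward D f a b c r : 0 < r -> jet D f a b c -> (forall t, 0 <= t -> t <= r -> D t) -> f 0 = a ->
  (forall t, 0 <= t -> t <= r -> f t <= f 0) -> b <= 0.
Proof.
move=> r0 [K [r' [K0 r'0 h]]] Dr f0 hm.
apply: (@le0_of_linear b (`|c| + K) (Num.min 1 (Num.min r r'))); first by rewrite !lt_min ltr01 r0.
move=> t t0; rewrite !le_min => /and3P[t1 tr tr'].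
have := h t (Dr t (ltW t0) tr); rewrite gtr0_norm// => /(_ tr'); rewrite ler_norml => /andP[h1 _].
have := hm t (ltW t0) tr; rewrite f0 => h2.
have h3 : b * t <= (`|c| + K) * t * t.
  have : - (c * t ^+ 2) <= `|c| * (t * t).
    rewrite -mulNr expr2; apply: ler_wpM2r; first by rewrite mulr_ge0// ltW.
    by rewrite -normrN ler_norm.
  have : K * t ^+ 3 <= K * (t * t).
    apply: ler_wpM2l => //; rewrite exprS expr2; apply: ler_piMl => //; by rewrite mulr_ge0// ltW.
  lra.
by rewrite -(ler_pM2r t0).
Qed.

Lemma jet_max D f a b c r : 0 < r -> jet D f a b c -> (forall t, `|t| <= r -> D t) -> f 0 = a ->
  (forall t, `|t| <= r -> f t <= f 0) -> b = 0 /\ c <= 0.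
Proof.
move=> r0 jf Dr f0 hm.
have b0 : b <= 0.
  by apply: (jet_max_forward r0 jf) => // t t0 tr; [apply: Dr|apply: hm]; rewrite ger0_norm.
have b1 : - b <= 0.
  have jf' : jet (fun t => D (- t)) (fun t => f (- t)) a (- b) c.
    move: jf => [K [r' [K0 r'0 h]]]; exists K, r'; split => // t Dt tr.
    by have := h (- t) Dt; rewrite normrN sqrrN mulrN mulNr => /(_ tr).
  apply: (jet_max_forward r0 jf'); rewrite ?oppr0//.
    by move=> t t0 tr; apply: Dr; rewrite normrN ger0_norm.
  by move=> t t0 tr; apply: hm; rewrite normrN ger0_norm.
have {b1}bb : b = 0 by apply/eqP; rewrite eq_le b0; rewrite oppr_le0 in b1.
split=> //; move: jf => [K [r' [K0 r'0 h]]].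
apply: (@le0_of_linear c K (Num.min r r')); first by rewrite lt_min r0.
move=> t t0; rewrite le_min => /andP[tr tr'].
have := h t; rewrite gtr0_norm// => /(_ _ tr'); rewrite ler_norml bb => h1.
have /h1/andP[{}h1 _] : D t by apply: Dr; rewrite gtr0_norm.
have := hm t; rewrite gtr0_norm// f0 => /(_ tr) h2.
have t20 : 0 < t ^+ 2 by exact: exprn_gt0.
rewrite -(ler_pM2r t20); move: h1; rewrite mul0r addr0 (exprS t 2); lra.
Qed.

Lemma jet_derive f a b c t : jet (fun=> True) (fun h => f (t + h)) a b c -> f t = a -> is_derive t 1 f b.
Proof.
move=> [K [r [K0 r0 h]]] ft; rewrite -ft in h.
have lim : h0^-1 *: (f (h0 *: 1 + t) - f t) @[h0 --> (0 : R)^'] --> b.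
  apply/cvgrPdist_le => /= e e0.
  pose M := `|c| + K + 1.
  have M0 : 0 < M by rewrite /M; have := normr_ge0 c; lra.
  have q0 : 0 < Num.min (Num.min 1 r) (e / M) by rewrite !lt_min ltr01 r0 divr_gt0.
  near=> z.
  have z0 : z != 0 by near: z; exact: nbhs_dnbhs_neq.
  have zq : `|z| < Num.min (Num.min 1 r) (e / M).
    by near: z; apply: dnbhs0_lt.
  move: zq; rewrite !lt_min => /andP[/andP[z1 zr] ze].
  have := h z I (ltW zr); rewrite (addrC t z) => hz.
  rewrite [z *: 1]mulr1 /GRing.scale/=.
  have -> : b - z^-1 * (f (z + t) - f t) = - z^-1 * (f (z + t) - (f t + b * z + c * z ^+ 2)) - c * z.
    by field.
  have nz : 0 < `|z| by rewrite normr_gt0.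
  have e1 : `|- z^-1 * (f (z + t) - (f t + b * z + c * z ^+ 2))| <= K * `|z|.
    rewrite normrM normrN normfV mulrC ler_pdivrMr//; apply: (le_trans hz).
    rewrite -mulrA; apply: ler_wpM2l => //; rewrite exprS expr2; apply: ler_piMl; [exact: mulr_ge0|exact: ltW].
  have e2 : `|c * z| <= `|c| * `|z| by rewrite normrM.
  apply: (le_trans (ler_normB _ _)); apply: (le_trans (lerD e1 e2)).
  move: ze; rewrite ltr_pdivlMr// /M; lra.
apply: DeriveDef; first by apply/cvg_ex; exists b.
by rewrite /derive; apply: cvg_lim.
Unshelve. all: by end_near. Qed.

End Jets.

Section LocalLipschitz.
Context {R : realType} {d : nat}.
Local Notation Rd := (@Rdm R d).
Variables (mu : {measure set Rd -> \bar R}) (s Lam : R).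
Hypothesis mu_nice : nice s Lam mu.
Hypothesis s_gt0 : 0 < s.
Implicit Types (u om m t : R) (x y v xi : 'rV[R]_d) (i j : 'I_d) (c : 'I_d -> R).

Lemma jet_coef_int_le (B : R) : 0 <= B -> exists2 K, 0 <= K &
  forall m u x xi om, regular mu m u x -> enorm xi <= 1 -> `|om| <= B * m ->
  [/\ `|density_d1 mu s xi om u x| <= K / m * density mu s u x,
   `|density_d2 mu s xi om u x| <= K / m ^+ 2 * density mu s u x,
   forall j, `|field_d1 mu s xi om j u x| <= K * density mu s u x &
   forall j, `|field_d2 mu s xi om j u x| <= K / m * density mu s u x].
Proof.
move=> B0; have [K K0 hK] := @jet_coef_le R d s s_gt0 B B0; exists K => // m u x xi om reg xi1 omB.
have mS := measurable_supp mu; have [m0 u0 hm] := reg.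
have [d1 d2 d3 d4] := jet_dominated s_gt0 B0 reg xi1 omB.
have dk := regular_dominated_ker s_gt0 reg.
have h y (Sy : supp mu y) := hK m u _ xi om m0 (hm y Sy) u0 xi1 omB.
rewrite /density_d1 /density_d2 /field_d1 /field_d2 /density.
split=> [||j|j]; rewrite -(IntM mu_nice s_gt0 mS)//; apply: (Int_norm_le mu_nice s_gt0 mS) => //;
  try exact: dominatedM; move=> y Sy; have [h1 h2 h3 h4] := h y Sy => //.
Qed.

Lemma field_local_lip m u x : regular mu m u x -> exists L r, 0 < r /\
  forall x' u', 0 <= u' -> enorm (x' - x) + `|u' - u| <= r ->
  `|density mu s u' x' - density mu s u x| <= L * (enorm (x' - x) + `|u' - u|) /\
  forall c j, `|field mu s c u' j x' - field mu s c u j x| <= L * (enorm (x' - x) + `|u' - u|).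
Proof.
move=> reg; have [m0 u0 hm] := reg.
have B0 : 0 <= m^-1 by rewrite invr_ge0 ltW.
have [K K0 hK] := @field_jet _ _ mu s Lam mu_nice s_gt0 _ B0.
have [K' K'0 hK'] := jet_coef_int_le B0.
set q := density mu s u x.
have q0 : 0 <= q by exact: density_ge0.
pose r := Num.min 1 ((2 * (m^-1 + 3))^-1 * m).
have r0 : 0 < r by rewrite lt_min ltr01 mulr_gt0// invr_gt0; lra.
pose L := K' / m * q + K' / m ^+ 2 * q + K / m ^+ 3 * q + (K' * q + K' / m * q + K / m ^+ 2 * q).
have mm n : 0 <= (m ^+ n)^-1 by rewrite invr_ge0 exprn_ge0// ltW.
have g1 : 0 <= K' / m * q by nonneg.
have g2 : 0 <= K' / m ^+ 2 * q by nonneg.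
have g3 : 0 <= K / m ^+ 3 * q by nonneg.
have g4 : 0 <= K' * q by nonneg.
have g5 : 0 <= K / m ^+ 2 * q by nonneg.
exists L, r; split => // x' u' u'0; set t := enorm _ + _ => tr.
have t0 : 0 <= t by rewrite addr_ge0.
have [tz|tz] := eqVneq t 0.
  have /eqP := tz; rewrite paddr_eq0// enorm_eq0 subr_eq0 normr_eq0 subr_eq0 => /andP[/eqP-> /eqP->].
  by split=> [|c j]; rewrite subrr normr0 tz mulr0.
have tp : 0 < t by rewrite lt_neqAle eq_sym tz.
pose xi := t^-1 *: (x' - x); pose om := (u' - u) / t.
have xi1 : enorm xi <= 1.
  by rewrite enormZ normfV (gtr0_norm tp) mulrC ler_pdivrMr// mul1r lerDl.
have om1 : `|om| <= m^-1 * m.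
  by rewrite mulVf ?gt_eqF// normrM normfV (gtr0_norm tp) ler_pdivrMr// mul1r lerDr.
move: tr; rewrite le_min => /andP[t1 tr].
have tn : `|t| = t by rewrite ger0_norm.
have ex : x + t *: xi = x' by rewrite scalerA divff// scale1r addrC subrK.
have eu : u + t * om = u' by rewrite mulrC divfK// addrC subrK.
have := hK m u x xi om t reg xi1 om1; rewrite tn ex eu => /(_ tr u'0)[_ h1 h2].
have [k1 k2 k3 k4] := hK' m u x xi om reg xi1 om1.
have tt2 : t ^+ 2 <= t by rewrite expr2 ler_piMl.
have tt3 : t ^+ 3 <= t by rewrite exprS ler_piMr// exprn_ile1.
have final (F' F D1 D2 a b e : R) : 0 <= a -> 0 <= b -> 0 <= e -> `|F' - (F + t * D1 + t ^+ 2 * D2)| <= e * t ^+ 3 ->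
    `|D1| <= a -> `|D2| <= b -> `|F' - F| <= (a + b + e) * t.
  move=> a0 b0 e0 hF hD1 hD2.
  rewrite (_ : F' - F = (F' - (F + t * D1 + t ^+ 2 * D2)) + (t * D1 + t ^+ 2 * D2)); last by ring.
  apply: (le_trans (ler_normD _ _)); rewrite (mulrDl (a + b)) [leRHS]addrC; apply: lerD.
    by apply: (le_trans hF); apply: ler_wpM2l.
  rewrite (mulrDl a); apply: (le_trans (ler_normD _ _)); rewrite (normrM t) (normrM (t ^+ 2)) normrX tn; apply: lerD.
    by rewrite mulrC; apply: ler_wpM2r.
  by rewrite mulrC; apply: ler_pM => //; rewrite exprn_ge0.
split=> [|c j].
  apply: (@le_trans _ _ ((K' / m * q + K' / m ^+ 2 * q + K / m ^+ 3 * q) * t)).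
    apply: final k1 k2 => //.
    by apply: (le_trans h1); rewrite le_eqVlt; apply/orP; left; apply/eqP; rewrite -/q; ring.
  by apply: ler_wpM2r => //; rewrite /L lerDl !addr_ge0.
apply: (@le_trans _ _ ((K' * q + K' / m * q + K / m ^+ 2 * q) * t)).
  apply: final (k3 j) (k4 j) => //.
  by apply: (le_trans (h2 c j)); rewrite le_eqVlt; apply/orP; left; apply/eqP; rewrite -/q; ring.
by apply: ler_wpM2r => //; rewrite /L lerDr !addr_ge0.
Qed.

Lemma lip_within (D : set ('rV[R]_d * R)) (F : 'rV[R]_d * R -> R) :
  (forall z, D z -> exists L r, 0 < r /\ forall z', D z' ->
    enorm (z'.1 - z.1) + `|z'.2 - z.2| <= r -> `|F z' - F z| <= L * (enorm (z'.1 - z.1) + `|z'.2 - z.2|)) ->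
  {within D, continuous F}.
Proof.
move=> lip; apply/subspace_continuousP => z Dz.
have [L [r [r0 h]]] := lip z Dz.
apply/cvgrPdist_le => /= e e0.
have L1 : 0 < `|L| + 1 by have := normr_ge0 L; lra.
pose del := Num.min r (e / (`|L| + 1)).
have del0 : 0 < del / 2 by rewrite divr_gt0// lt_min r0 divr_gt0.
exists (eball z.1 (del / 2), ball z.2 (del / 2)) => /=.
  split; last by apply: nbhsx_ballx.
  have /= := @open_nbhs_nbhs _ z.1 (eball z.1 (del / 2)); apply; split; first exact: open_eball.
  by rewrite /eball/= subrr enorm0.
move=> z' [/= z1]; rewrite /ball/= distrC => z2 Dz'.
have hd : enorm (z'.1 - z.1) + `|z'.2 - z.2| <= del by move: z1; rewrite /eball/=; lra.
have n0 : 0 <= enorm (z'.1 - z.1) + `|z'.2 - z.2| by rewrite addr_ge0.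
rewrite distrC; apply: (le_trans (h z' Dz' _)); first by apply: (le_trans hd); rewrite ge_min lexx.
have : enorm (z'.1 - z.1) + `|z'.2 - z.2| <= e / (`|L| + 1) by apply: (le_trans hd); rewrite ge_min lexx orbT.
rewrite ler_pdivlMr//; move: (enorm _ + _) n0 => n n0.
have := ler_wpM2r n0 (ler_norm L); lra.
Qed.

Lemma field_is_jet m u x xi om c j : regular mu m u x -> enorm xi <= 1 -> (om = 0 \/ om = 1) ->
  jet (fun t => 0 <= u + t * om) (fun t => field mu s c (u + t * om) j (x + t *: xi))
    (field mu s c u j x) (field_d1 mu s xi om j u x) (field_d2 mu s xi om j u x) /\
  jet (fun t => 0 <= u + t * om) (fun t => density mu s (u + t * om) (x + t *: xi))
    (density mu s u x) (density_d1 mu s xi om u x) (density_d2 mu s xi om u x).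
Proof.
move=> reg xi1 om01; have [m0 u0 hm] := reg.
have B0 : 0 <= m^-1 by rewrite invr_ge0 ltW.
have [K K0 hK] := @field_jet _ _ mu s Lam mu_nice s_gt0 _ B0.
have omB : `|om| <= m^-1 * m.
  by rewrite mulVf ?gt_eqF//; case: om01 => ->; rewrite ?normr0 ?normr1.
have q0 : 0 <= density mu s u x by exact: density_ge0.
have mm n : 0 <= (m ^+ n)^-1 by rewrite invr_ge0 exprn_ge0// ltW.
have r0 : 0 < (2 * (m^-1 + 3))^-1 * m by rewrite mulr_gt0// invr_gt0; lra.
split.
  exists (K / m ^+ 2 * density mu s u x), ((2 * (m^-1 + 3))^-1 * m); split => //; first by nonneg.
  move=> t Dt tr; have [_ _ h] := hK m u x xi om t reg xi1 omB tr Dt.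
  rewrite (mulrC (field_d1 _ _ _ _ _ _ _)) (mulrC (field_d2 _ _ _ _ _ _ _)); apply: (le_trans (h c j)).
  by rewrite le_eqVlt; apply/orP; left; apply/eqP; ring.
exists (K / m ^+ 3 * density mu s u x), ((2 * (m^-1 + 3))^-1 * m); split => //; first by nonneg.
move=> t Dt tr; have [_ h _] := hK m u x xi om t reg xi1 omB tr Dt.
rewrite (mulrC (density_d1 _ _ _ _ _ _)) (mulrC (density_d2 _ _ _ _ _ _)); apply: (le_trans h).
by rewrite le_eqVlt; apply/orP; left; apply/eqP; ring.
Qed.

End LocalLipschitz.

(** * Algebra of the differential inequality *)

Section BesselInequality.
Context {R : realType} {d : nat}.
Implicit Types (E Pu Qu qi qqi : 'I_d -> R) (P Q : 'I_d -> 'I_d -> R).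

Lemma sum_sqr_ge (a : 'I_d -> R) : (0 < d)%N -> (\sum_i a i) ^+ 2 / d%:R <= \sum_i a i ^+ 2.
Proof.
move=> d0; have dr : 0 < d%:R :> R by rewrite ltr0n.
set A := \sum_i a i.
have : 0 <= \sum_i (a i - A / d%:R) ^+ 2 by apply: sumr_ge0 => i _; exact: sqr_ge0.
have -> : \sum_i (a i - A / d%:R) ^+ 2 = \sum_i a i ^+ 2 - A ^+ 2 / d%:R.
  have e i : (a i - A / d%:R) ^+ 2 = a i ^+ 2 + ((- 2 * A / d%:R) * a i + A ^+ 2 / d%:R ^+ 2).
    by field; rewrite gt_eqF.
  rewrite (eq_bigr _ (fun i _ => e i)) !big_split/= sumr_const card_ord -mulr_sumr -/A -[_ *+ d]mulr_natl.
  by field; rewrite gt_eqF.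
by rewrite subr_ge0.
Qed.

(** Here X stands for 2 u q_u and - (beta q + X) for div E. The negative terms from lam u q^2 are
    absorbed by (div E)^2 / D once lam is small against beta / D. *)
Lemma quadratic_form_ge (q X beta lam D : R) : 0 < beta -> beta < 1 -> 0 < lam -> 0 < D -> lam * (4 * D) <= beta ->
  lam * beta * (1 - beta) * q ^+ 2 <=
  2 * ((beta * q + X) ^+ 2 / D) - lam * (4 * q * X + 2 * X ^+ 2 + 2 * beta * q ^+ 2).
Proof.
move=> b0 b1 l0 D0 hl; set Y := beta * q + X.
have eX : X = Y - beta * q by rewrite /Y; ring.
rewrite -subr_ge0 eX.
have bn : beta != 0 by rewrite gt_eqF.
have Dn : D != 0 by rewrite gt_eqF.
(* Completing the square in q; the smallness of lam makes the remaining coefficient of Y^2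
   nonnegative. *)
have -> : 2 * (Y ^+ 2 / D) - lam * (4 * q * (Y - beta * q) + 2 * (Y - beta * q) ^+ 2 + 2 * beta * q ^+ 2) -
   lam * beta * (1 - beta) * q ^+ 2 =
   lam * beta * (1 - beta) * (q - 2 * Y / beta) ^+ 2 + (2 / D - 2 * lam - 4 * lam * (1 - beta) / beta) * Y ^+ 2.
  by field; rewrite bn.
apply: addr_ge0.
  by apply: mulr_ge0; [rewrite !mulr_ge0//; lra|exact: sqr_ge0].
apply: mulr_ge0; last exact: sqr_ge0.
have h1 : lam <= beta / (4 * D) by rewrite ler_pdivlMr// mulr_gt0.
have h2 : 4 * lam * (1 - beta) / beta <= 1 / D.
  rewrite ler_pdivrMr// div1r [leRHS]mulrC ler_pdivlMr//.
  have : 0 <= lam * D * beta by rewrite !mulr_ge0// ltW.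
  lra.
have h3 : 2 * lam <= 1 / D.
  by rewrite ler_pdivlMr//; lra.
have : 2 / D = 1 / D + 1 / D by field.
lra.
Qed.

(** Pure algebra on jet coefficients: the right-hand side is L (|E|^2 - lam u q^2). The terms linear
    in second derivatives of E cancel by L E = 0, those of q by L q = -4 q_u. What is left is
    |grad_x E|^2 >= (div E)^2 / d and the vertical squares, which dominate the gradient of q as lam
    <= 1. *)
Lemma bessel_inequality E Pu Qu P Q (q qu quu u beta lam : R) qi qqi : (0 < d)%N ->
  0 <= u -> 0 < beta -> beta < 1 -> 0 < lam -> lam * (4 * d%:R) <= beta ->
  (forall j, 2 * (\sum_i Q i j) + (8 * u * Qu j + 2 * beta * Pu j) = 0) ->
  2 * (\sum_i qqi i) + (8 * u * quu + 2 * beta * qu) = - 4 * qu ->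
  (forall i, qi i = 2 * Pu i) -> \sum_i P i i = - beta * q - 2 * u * qu ->
  lam * beta * (1 - beta) * q ^+ 2 <=
  2 * (\sum_i (\sum_j (P i j ^+ 2 + 2 * (E j * Q i j)) - lam * (u * (qi i ^+ 2 + 2 * (q * qqi i))))) +
  8 * u * (\sum_j (Pu j ^+ 2 + 2 * (E j * Qu j)) - lam * (2 * (q * qu) + u * (qu ^+ 2 + 2 * (q * quu)))) +
  2 * beta * (\sum_j (2 * (E j * Pu j)) - lam * (q ^+ 2 + u * (2 * (q * qu)))).
Proof.
move=> d0 u0 b0 b1 l0 hl H1 H2 H3 H4.
have dr1 : 1 <= d%:R :> R by rewrite ler1n.
have dr : 0 < d%:R :> R by rewrite ltr0n.
have := quadratic_form_ge q (2 * u * qu) b0 b1 l0 dr hl.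
have e1 : \sum_i (\sum_j (P i j ^+ 2 + 2 * (E j * Q i j)) - lam * (u * (qi i ^+ 2 + 2 * (q * qqi i)))) =
   \sum_i \sum_j P i j ^+ 2 + 2 * (\sum_j E j * (\sum_i Q i j)) - lam * u * (4 * (\sum_j Pu j ^+ 2) + 2 * q * \sum_i qqi i).
  rewrite sumrB; congr (_ - _).
    under eq_bigr do rewrite big_split/=.
    rewrite big_split/=; congr (_ + _); rewrite mulr_sumr exchange_big/=; apply: eq_bigr => j _.
    by rewrite !mulr_sumr.
  rewrite !mulr_sumr -big_split/= mulr_sumr; apply: eq_bigr => i _; rewrite H3; ring.
have e2 : \sum_j (Pu j ^+ 2 + 2 * (E j * Qu j)) = \sum_j Pu j ^+ 2 + 2 * (\sum_j E j * Qu j).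
  by rewrite big_split/= mulr_sumr.
have e3 : \sum_j (2 * (E j * Pu j)) = 2 * \sum_j E j * Pu j by rewrite mulr_sumr.
have e4 : 2 * (\sum_j E j * (\sum_i Q i j)) + (8 * u * (\sum_j E j * Qu j) + 2 * beta * (\sum_j E j * Pu j)) = 0.
  rewrite !mulr_sumr -!big_split/= big1// => j _.
  have := congr1 (fun z => E j * z) (H1 j); rewrite mulr0.
  by move: (\sum_(i < d) Q i j) => S <-; ring.
have e5 : (\sum_i P i i) ^+ 2 / d%:R <= \sum_i \sum_j P i j ^+ 2.
  apply: (le_trans (sum_sqr_ge (fun i => P i i) d0)); apply: ler_sum => i _.
  by rewrite (bigD1 i)//= lerDl; apply: sumr_ge0 => j _; exact: sqr_ge0.
have e6 : 0 <= (1 - lam) * (u * \sum_j Pu j ^+ 2).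
  rewrite mulr_ge0//; last by rewrite mulr_ge0// sumr_ge0// => j _; exact: sqr_ge0.
  rewrite subr_ge0; have : lam * 4 <= lam * (4 * d%:R) by apply: ler_wpM2l; [exact: ltW|lra].
  lra.
rewrite e1 e2 e3.
move: e5; rewrite H4 (_ : (- beta * q - 2 * u * qu) ^+ 2 = (beta * q + 2 * u * qu) ^+ 2); last by ring.
move: e4 e6 H2.
move: (\sum_i \sum_j P i j ^+ 2) (\sum_j Pu j ^+ 2) (\sum_j E j * (\sum_i Q i j)) (\sum_j E j * Qu j) (\sum_j E j * Pu j)
  (\sum_i qqi i) ((beta * q + 2 * u * qu) ^+ 2 / d%:R) => S1 S2 S3 S4 S5 S6 S7 e4 e6 H2 e5 hq.
rewrite -subr_ge0.
set lhs := (X in 0 <= X).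
have -> : lhs = (2 * S1 + 8 * ((1 - lam) * (u * S2)) + 2 * (2 * S3 + (8 * u * S4 + 2 * beta * S5))
   - 2 * lam * u * q * (2 * S6 + (8 * u * quu + 2 * beta * qu) + 4 * qu)
   - lam * (4 * q * (2 * u * qu) + 2 * (2 * u * qu) ^+ 2 + 2 * beta * q ^+ 2)) - lam * beta * (1 - beta) * q ^+ 2.
  by rewrite /lhs; ring.
rewrite e4 H2 (_ : - 4 * qu + 4 * qu = 0); last by ring.
lra.
Qed.

End BesselInequality.

(** * Penalized maximum principle *)

Section NearMaximum.
Context {R : realType} {d : nat}.
Local Notation Rd := (@Rdm R d).
Variables (mu : {measure set Rd -> \bar R}) (s Lam : R).
Hypothesis mu_nice : nice s Lam mu.
Hypothesis s_gt0 : 0 < s.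
Hypothesis s_ltd : s < d%:R.
Hypothesis s_gtd1 : d%:R < s + 1.
Hypothesis d_gt0 : (0 < d)%N.
Variables (c : 'I_d -> R) (lam : R).
Hypothesis lam_gt0 : 0 < lam.
Hypothesis lam_le : lam * (4 * d%:R) <= s + 1 - d%:R.
Implicit Types (u om m t : R) (x y v xi : 'rV[R]_d) (i j : 'I_d).
Local Notation e_ i := (delta_mx ord0 i : 'rV[R]_d).

Definition excess u x : R := \sum_j field mu s c u j x * field mu s c u j x -
  lam * (u * (density mu s u x * density mu s u x)).

Lemma within_sum (T : topologicalType) (D : set T) (I : Type) (l : seq I) (f : I -> T -> R) :
  (forall k, {within D, continuous (f k)}) -> {within D, continuous (fun z => \sum_(k <- l) f k z)}.
Proof.
move=> cf; elim: l => [|k l IH].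
  by under [X in continuous X]eq_fun do rewrite big_nil; move=> z; exact: cvg_cst.
by under [X in continuous X]eq_fun do rewrite big_cons; move=> z; apply: cvgD; [exact: cf|exact: IH].
Qed.

Lemma excess_within (D : set ('rV[R]_d * R)) (e2 R0 u0 : R) x0 :
  (forall z, D z -> exists m, regular mu m z.2 z.1) ->
  {within D, continuous (fun z => excess z.2 z.1 - e2 * ((enorm (z.1 - x0) ^+ 2 + (z.2 - u0) ^+ 2 / R0) / R0))}.
Proof.
move=> regD.
have cE j : {within D, continuous (fun z : 'rV[R]_d * R => field mu s c z.2 j z.1)}.
  apply: lip_within => z Dz; have [m reg] := regD z Dz.
  have [L [r [r0 h]]] := field_local_lip mu_nice s_gt0 reg; exists L, r; split => // z' Dz' zr.
  by have [m' [_ u0' _]] := regD z' Dz'; have [_ h2] := h z'.1 z'.2 u0' zr.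
have cq : {within D, continuous (fun z : 'rV[R]_d * R => density mu s z.2 z.1)}.
  apply: lip_within => z Dz; have [m reg] := regD z Dz.
  have [L [r [r0 h]]] := field_local_lip mu_nice s_gt0 reg; exists L, r; split => // z' Dz' zr.
  by have [m' [_ u0' _]] := regD z' Dz'; have [h2 _] := h z'.1 z'.2 u0' zr.
have cu : {within D, continuous (fun z : 'rV[R]_d * R => z.2)}.
  by apply: lip_within => z _; exists 1, 1; split => // z' _ _; rewrite mul1r lerDr.
have cx : {within D, continuous (fun z : 'rV[R]_d * R => enorm (z.1 - x0))}.
  apply: lip_within => z _; exists 1, 1; split => // z' _ _; rewrite mul1r.
  apply: (le_trans (enorm_lip _ _)); rewrite opprB addrA subrK lerDl//.
have cS : {within D, continuous (fun z : 'rV[R]_d * R => \sum_j field mu s c z.2 j z.1 * field mu s c z.2 j z.1)}.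
  by apply: within_sum => j z; apply: cvgM; exact: cE.
move=> z; apply: cvgB; first apply: cvgB.
- exact: cS.
- by apply: cvgM; [exact: cvg_cst|apply: cvgM; [exact: cu|apply: cvgM; exact: cq]].
apply: cvgM; first exact: cvg_cst.
apply: cvgM; last exact: cvg_cst.
apply: cvgD; first by apply: cvgM; exact: cx.
apply: cvgM; last exact: cvg_cst.
by apply: cvgM; apply: cvgB; [exact: cu|exact: cvg_cst|exact: cu|exact: cvg_cst].
Qed.

Lemma excess_jet m u x xi om (e2 R0 u0 : R) x0 : regular mu m u x -> enorm xi <= 1 -> (om = 0 \/ om = 1) ->
  let E j := field mu s c u j x in let P j := field_d1 mu s xi om j u x in
  let Q j := field_d2 mu s xi om j u x in
  let q := density mu s u x in let q1 := density_d1 mu s xi om u x in let q2 := density_d2 mu s xi om u x in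
  jet (fun t => 0 <= u + t * om)
    (fun t => excess (u + t * om) (x + t *: xi) -
      e2 * ((enorm (x + t *: xi - x0) ^+ 2 + (u + t * om - u0) ^+ 2 / R0) / R0))
    (excess u x - e2 * ((enorm (x - x0) ^+ 2 + (u - u0) ^+ 2 / R0) / R0))
    (\sum_j (2 * (E j * P j)) - lam * (om * q ^+ 2 + u * (2 * (q * q1))) -
      e2 * ((2 * dotp (x - x0) xi + 2 * (u - u0) * om / R0) / R0))
    (\sum_j (P j ^+ 2 + 2 * (E j * Q j)) - lam * (om * (2 * (q * q1)) + u * (q1 ^+ 2 + 2 * (q * q2))) -
      e2 * ((dotp xi xi + om ^+ 2 / R0) / R0)).
Proof.
move=> reg xi1 om01 E P Q q q1 q2; set D := fun t => _.
have jE j := (field_is_jet mu_nice s_gt0 c j reg xi1 om01).1.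
have jq := (field_is_jet mu_nice s_gt0 c (Ordinal d_gt0) reg xi1 om01).2.
have jS := jet_sum (index_enum 'I_d) (fun j => jetM (jE j) (jE j)).
have jQ := jetZ (- lam) (jetM (jet_quadratic D u om 0) (jetM jq jq)).
have jP := jetZ (- e2) (jet_quadratic D ((dotp (x - x0) (x - x0) + (u - u0) ^+ 2 / R0) / R0)
  ((2 * dotp (x - x0) xi + 2 * (u - u0) * om / R0) / R0) ((dotp xi xi + om ^+ 2 / R0) / R0)).
apply: (jet_ext _ _ _ _ (jetD (jetD jS jQ) jP)).
- move=> t; rewrite /excess enorm_sqr mulNr mulNr.
  have -> : x + t *: xi - x0 = (x - x0) + t *: xi by rewrite addrAC.
  rewrite (_ : u + om * t + 0 * t ^+ 2 = u + t * om); last by ring.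
  move: (x - x0) => b.
  have -> : dotp (b + t *: xi) (b + t *: xi) = dotp b b + 2 * t * dotp b xi + t ^+ 2 * dotp xi xi.
    by rewrite !dotpDl !dotpDr !dotpZl !dotpZr (dotpC xi b); ring.
  by congr (_ - _ * _); ring.
- by rewrite /excess enorm_sqr; ring.
- congr (_ + _); last by ring.
  congr (_ + _); last by rewrite -/q -/q1; ring.
  by apply: eq_bigr => j _; rewrite -/(E j) -/(P j); ring.
congr (_ + _); last by ring.
congr (_ + _); last by rewrite -/q -/q1 -/q2; ring.
by apply: eq_bigr => j _; rewrite -/(E j) -/(P j) -/(Q j); ring.
Qed.

(** In this box the weights lose at most r0^2 (2/9 + 1/8), so regularity drops by at most a factor
    2. *)
Lemma box_regular (r0 u0 u : R) x0 x : regular mu r0 u0 x0 -> enorm (x - x0) <= r0 / 3 -> 0 <= u ->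
  `|u - u0| <= r0 ^+ 2 / 8 -> regular mu (r0 / 2) u x.
Proof.
move=> [r00 u00 hr0] h1 h2; rewrite ler_norml => /andP[h3 h4]; split => //; first exact: divr_gt0.
move=> y Sy; have := hr0 y Sy; have := dotp_shift x0 x y.
have := ler_sqr_ge0 (enorm_ge0 _) h1; rewrite -enorm_sqr -(enorm_sqr (x - y)) -(enorm_sqr (x0 - x)) (enormB x0 x).
rewrite !expr_div_n; clear hr0; lra.
Qed.

(** The supremum of [excess] need not be attained. The penalty, scaled by r0 in x and r0^2 in u,
    confines the maximum to the interior of the box, apart from the boundary u = 0. *)
Definition penalized (e2 r0 u0 : R) x0 u x : R :=
  excess u x - e2 * ((enorm (x - x0) ^+ 2 + (u - u0) ^+ 2 / r0 ^+ 2) / r0 ^+ 2).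

Lemma box_maximum (e2 r0 u0 : R) x0 : regular mu r0 u0 x0 ->
  exists x1 u1, [/\ enorm (x1 - x0) <= r0 / 3, 0 <= u1, `|u1 - u0| <= r0 ^+ 2 / 8 &
    forall x u, enorm (x - x0) <= r0 / 3 -> 0 <= u -> `|u - u0| <= r0 ^+ 2 / 8 ->
    penalized e2 r0 u0 x0 u x <= penalized e2 r0 u0 x0 u1 x1].
Proof.
move=> reg0; have [r00 u00 hr0] := reg0; set R0 := r0 ^+ 2.
have R00 : 0 < R0 by exact: exprn_gt0.
pose D : set ('rV[R]_d * R) := [set x | enorm (x - x0) <= r0 / 3] `*` `[Num.max 0 (u0 - R0 / 8), u0 + R0 / 8]%classic.
have inD x u : D (x, u) <-> [/\ enorm (x - x0) <= r0 / 3, 0 <= u & `|u - u0| <= R0 / 8].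
  rewrite /D/= in_itv/= ge_max; split.
    by move=> [h1 /andP[/andP[h2 h3] h4]]; split => //; rewrite ler_norml; apply/andP; split; lra.
  by move=> [h1 h2]; rewrite ler_norml => /andP[h3 h4]; split => //; rewrite h2/=; apply/andP; split; lra.
have Dz0 : D (x0, u0).
  by apply/inD; rewrite subrr enorm0 subrr normr0; split => //; apply: divr_ge0 => //; exact: ltW.
have cD : compact D by apply: compact_setX; [exact: compact_closed_eball|exact: segment_compact].
have cG : {within D, continuous (fun z => penalized e2 r0 u0 x0 z.2 z.1)}.
  apply: excess_within => -[x u] /inD[h1 h2 h3]; exists (r0 / 2); exact: box_regular reg0 h1 h2 h3.
have [[x1 u1] /set_mem Dz1 hmax] := compact_EVT_max (ex_intro _ _ Dz0) cD cG.
have [h1 h2 h3] := (inD x1 u1).1 Dz1.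
exists x1, u1; split => // x u g1 g2 g3.
by have := hmax (x, u); apply; apply/mem_set/inD.
Qed.

(** The value at the centre is within e2 / 64 of the bound M, so the scaled penalty at the maximum
    is below 1/64 = (1/8)^2. *)
Lemma penalty_small (e2 r0 a b h0 h1 M : R) : 0 < e2 -> 0 < r0 -> 0 <= a -> M - e2 / 64 < h0 ->
  h0 <= h1 - e2 * ((a ^+ 2 + b ^+ 2 / r0 ^+ 2) / r0 ^+ 2) -> h1 <= M -> a < r0 / 8 /\ `|b| < r0 ^+ 2 / 8.
Proof.
move=> e20 r00 a0 hM h01 h1M; have R00 : 0 < r0 ^+ 2 by exact: exprn_gt0.
have a2 := sqr_ge0 a; have b2 : 0 <= b ^+ 2 / r0 ^+ 2 by apply: divr_ge0; exact: sqr_ge0.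
have : (a ^+ 2 + b ^+ 2 / r0 ^+ 2) / r0 ^+ 2 < 1 / 64 by rewrite -(ltr_pM2l e20); lra.
rewrite ltr_pdivrMr// => h.
have e64 : (8 : R) ^+ 2 = 64 by ring.
split.
  rewrite -(ltr_pXn2r (_ : (0 < 2)%N)) ?nnegrE ?divr_ge0 ?(ltW r00)// expr_div_n e64; lra.
rewrite -(ltr_pXn2r (_ : (0 < 2)%N)) ?nnegrE ?divr_ge0 ?(ltW R00)// real_normK ?num_real// expr_div_n e64.
have : b ^+ 2 / r0 ^+ 2 < r0 ^+ 2 / 64 by lra.
by rewrite ltr_pdivrMr// (expr2 (r0 ^+ 2)); lra.
Qed.

Lemma box_scale (r0 u0 u1 : R) x0 x1 p : 0 < r0 -> 0 <= u0 -> dotp (x0 - p) (x0 - p) + u0 <= 2 * r0 ^+ 2 ->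
  enorm (x1 - x0) <= r0 / 3 -> `|u1 - u0| <= r0 ^+ 2 / 8 ->
  [/\ enorm (x1 - p) <= 5 * (r0 / 2), u1 <= 25 * (r0 / 2) ^+ 2 & u1 <= 17 / 8 * r0 ^+ 2].
Proof.
move=> r00 u00 hp h1; rewrite ler_norml => /andP[_ h3]; have d0 := dotp_ge0 (x0 - p).
have e4 : (2 : R) ^+ 2 = 4 by ring.
have u1R : u1 <= 17 / 8 * r0 ^+ 2 by lra.
have R00 := exprn_gt0 2 r00.
split => //; last by rewrite expr_div_n e4; lra.
have : enorm (x0 - p) <= 2 * r0.
  by rewrite -(ler_pXn2r (_ : (0 < 2)%N)) ?nnegrE ?mulr_ge0 ?(ltW r00)// enorm_sqr exprMn e4; lra.
have := enorm_dist x1 x0 p; lra.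
Qed.

Lemma eighths_le_third (r a b : R) : 0 < r -> a < r / 8 -> b <= r / 8 -> a + b <= r / 3.
Proof. lra. Qed.

Lemma collect_bounds (x a b e n k : R) : x <= 2 * a + b + e -> a <= n * k -> b + e <= 18 * k ->
  x <= (2 * n + 18) * k.
Proof. lra. Qed.

(** At u1 = 0 the second derivative drops out of L and d_u <= 0 suffices. For u1 > 0 both maximum
    conditions hold, and 18 = 17 + 1 comes from 8 u1 <= 17 R0 and from the slope of the penalty. *)
Lemma vertical_bound (bu cu u1 u0 R0 e2 beta : R) : 0 < R0 -> 0 < e2 -> 0 < beta -> beta < 1 ->
  0 <= u1 -> u1 <= 17 / 8 * R0 -> `|u1 - u0| < R0 / 8 -> 0 <= u0 ->
  (u1 = 0 -> bu - e2 * (2 * (u1 - u0) / R0 / R0) <= 0) ->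
  (u1 != 0 -> bu - e2 * (2 * (u1 - u0) / R0 / R0) = 0 /\ cu - e2 * (1 / R0 / R0) <= 0) ->
  8 * u1 * cu + 2 * beta * bu <= 18 * (e2 / R0).
Proof.
move=> R00 e20 b0 b1 u10 u1R hu u00 hz hp.
have k0 : 0 < e2 / R0 by exact: divr_gt0.
have Rn : R0 != 0 by rewrite gt_eqF.
have [u1z|u1p] := eqVneq u1 0.
  have := hz u1z; rewrite u1z.
  have -> : e2 * (2 * (0 - u0) / R0 / R0) = - (e2 / R0 * (2 * u0 / R0)) by field.
  have : 0 <= e2 / R0 * (2 * u0 / R0).
    by apply: mulr_ge0; [exact: ltW|apply: divr_ge0; [exact: mulr_ge0|exact: ltW]].
  move=> h1 h2; have bu0 : bu <= 0 by lra.
  rewrite mulr0 mul0r add0r; apply: (@le_trans _ _ 0); last by apply: mulr_ge0 => //; exact: ltW.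
  by apply: mulr_ge0_le0 => //; apply: mulr_ge0 => //; exact: ltW.
have [bu0 cu0] := hp u1p.
have -> : bu = e2 / R0 * (2 * (u1 - u0) / R0).
  by move/eqP: bu0; rewrite subr_eq0 => /eqP ->; field.
have cu1 : cu <= e2 / R0 / R0.
  by move: cu0; rewrite (_ : e2 * (1 / R0 / R0) = e2 / R0 / R0); [lra|field].
have g1 : 8 * u1 * cu <= 17 * (e2 / R0).
  apply: (@le_trans _ _ (8 * u1 * (e2 / R0 / R0))).
    by apply: ler_wpM2l => //; rewrite mulr_ge0.
  by rewrite mulrA ler_pdivrMr//; move: (e2 / R0) k0 => k k0; have := ler_wpM2r (ltW k0) u1R; lra.
have g2 : 2 * beta * (e2 / R0 * (2 * (u1 - u0) / R0)) <= e2 / R0.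
  have h1 : (2 * (u1 - u0) / R0) <= 1 / 4.
    by rewrite ler_pdivrMr//; move: hu; rewrite ltr_norml => /andP[_]; lra.
  move: (e2 / R0) (2 * (u1 - u0) / R0) k0 h1 => k z k0 h1.
  have bk0 : 0 <= beta * k by apply: mulr_ge0; exact: ltW.
  have bk1 : beta * k <= k by apply: ler_piMl; exact: ltW.
  have := ler_wpM2l bk0 h1; lra.
lra.
Qed.

(* Maximum principle for L = Lap_x + 4 u d_uu + 2 beta d_u on a box of size
   comparable to the distance to the support; L degenerates at u = 0, where
   2 beta d_u <= 0 at a maximum suffices. *)
Lemma near_max : (exists p, supp mu p) -> exists2 C, 0 <= C &
  forall m u0 x0 e M, regular mu m u0 x0 -> 0 < e ->
  (forall m' u x, regular mu m' u x -> excess u x <= M) -> M - e ^+ 2 / 64 < excess u0 x0 ->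
  exists r u x p, [/\ regular mu r u x, supp mu p, enorm (x - p) <= 5 * r /\ u <= 25 * r ^+ 2,
    excess u0 x0 <= excess u x & (r * density mu s u x) ^+ 2 <= C * e ^+ 2].
Proof.
have := lam_le; set beta := s + 1 - d%:R => lam_le' ex.
have b0 : 0 < beta by rewrite /beta subr_gt0.
have b1 : beta < 1 by rewrite /beta; move: s_ltd; lra.
have dr : 0 < d%:R :> R by rewrite ltr0n.
have A0 : 0 < 4 * (lam * beta * (1 - beta)).
  by rewrite mulr_gt0// !mulr_gt0// subr_gt0.
exists ((2 * d%:R + 18) / (4 * (lam * beta * (1 - beta)))).
  by apply: divr_ge0; [lra|exact: ltW].
move=> m u0 x0 e M regm e0 hM hx0.
(* The given m may be far below the distance to the support; the box has to be as large as that
   distance. *)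
have [r0 [p [reg0 Sp hp]]] := regular_scale regm ex.
have [r00 u00 _] := reg0.
have R00 : 0 < r0 ^+ 2 by exact: exprn_gt0.
have e20 : 0 < e ^+ 2 by exact: exprn_gt0.
have [x1 [u1 [d1 u10 d2 hmax]]] := box_maximum (e ^+ 2) reg0.
have reg1 := box_regular reg0 d1 u10 d2.
have G0 : penalized (e ^+ 2) r0 u0 x0 u0 x0 = excess u0 x0.
  by rewrite /penalized !subrr enorm0 !expr0n/= mul0r addr0 mul0r mulr0 subr0.
have G1 : excess u0 x0 <= penalized (e ^+ 2) r0 u0 x0 u1 x1.
  rewrite -G0; apply: hmax => //; rewrite subrr ?enorm0 ?normr0; apply: divr_ge0 => //; exact: ltW.
have [x1x0 u1u0] := penalty_small e20 r00 (enorm_ge0 _) hx0 G1 (hM _ _ _ reg1).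
have [s1 s2 s3] := box_scale r00 u00 hp d1 d2.
exists (r0 / 2), u1, x1, p; split; [exact: reg1|exact: Sp|by split| |].
  apply: (le_trans G1); rewrite /penalized lerBlDr lerDl; apply: mulr_ge0; first exact: ltW.
  by apply: divr_ge0; [apply: addr_ge0; [exact: sqr_ge0|apply: divr_ge0; exact: sqr_ge0]|exact: sqr_ge0].
clear hM hx0 G0 G1 hp Sp s1 s2 regm reg0.
move: e20 R00 hmax d2 u1u0 s3; set e2 := e ^+ 2; set R0 := r0 ^+ 2 => e20 R00 hmax d2 u1u0 s3.
pose E j := field mu s c u1 j x1.
pose Pu j := field_d1 mu s 0 1 j u1 x1.
pose Qu j := field_d2 mu s 0 1 j u1 x1.
pose P i j := field_d1 mu s (e_ i) 0 j u1 x1.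
pose Q i j := field_d2 mu s (e_ i) 0 j u1 x1.
set q := density mu s u1 x1.
pose qu := density_d1 mu s 0 1 u1 x1.
pose quu := density_d2 mu s 0 1 u1 x1.
pose qi i := density_d1 mu s (e_ i) 0 u1 x1.
pose qqi i := density_d2 mu s (e_ i) 0 u1 x1.
(* The lower bound for L at the maximum; [ci] and [hu] bound the same expression above by the
   derivatives of the penalty, of order e2 / R0. *)
have := @bessel_inequality R d E Pu Qu P Q q qu quu u1 beta lam qi qqi d_gt0 u10 b0 b1 lam_gt0 lam_le'
  (field_bessel mu_nice s_gt0 reg1) (density_bessel mu_nice s_gt0 reg1)
  (density_gradient mu_nice s_gt0 reg1) (field_divergence mu_nice s_gt0 reg1).
have ci i : \sum_j (P i j ^+ 2 + 2 * (E j * Q i j)) - lam * (u1 * (qi i ^+ 2 + 2 * (q * qqi i))) <= e2 / R0.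
  have xi1 : enorm (e_ i) <= 1 by rewrite enorm_delta.
  have jG := excess_jet e2 R0 u0 x0 reg1 xi1 (or_introl erefl).
  have r80 : 0 < r0 / 8 by exact: divr_gt0.
  have [] := jet_max r80 jG.
  - by move=> t _; rewrite mulr0 addr0.
  - by rewrite mulr0 addr0 scale0r addr0.
  - move=> t tr; rewrite [0 * _]mul0r scale0r !addr0 mulr0 addr0; apply: (hmax (x1 + t *: e_ i) u1) => //.
    rewrite addrAC; apply: (le_trans (enormD _ _)); rewrite enormZ enorm_delta mulr1.
    exact: eighths_le_third r00 x1x0 tr.
  by move=> _; rewrite mul0r add0r expr0n mul0r addr0 dotp_delta mxE !eqxx subr_le0 div1r.
have hu : 8 * u1 * (\sum_j (Pu j ^+ 2 + 2 * (E j * Qu j)) - lam * (2 * (q * qu) + u1 * (qu ^+ 2 + 2 * (q * quu)))) +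
  2 * beta * (\sum_j (2 * (E j * Pu j)) - lam * (q ^+ 2 + u1 * (2 * (q * qu)))) <= 18 * (e2 / R0).
  have xi1 : enorm (0 : 'rV[R]_d) <= 1 by rewrite enorm0.
  have jG := excess_jet e2 R0 u0 x0 reg1 xi1 (or_intror erefl).
  (* The room left in the vertical direction inside the box. *)
  set t0 := R0 / 8 - `|u1 - u0|.
  have t00 : 0 < t0 by rewrite subr_gt0.
  have mx t : 0 <= u1 + t -> `|t| <= t0 -> penalized e2 r0 u0 x0 (u1 + t) x1 <= penalized e2 r0 u0 x0 u1 x1.
    move=> ut tt0; apply: hmax => //.
    by rewrite addrAC; apply: (le_trans (ler_normD _ _)); rewrite -lerBrDl.
  have fE t : penalized e2 r0 u0 x0 (u1 + t) x1 = excess (u1 + t * 1) (x1 + t *: 0) -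
     e2 * ((enorm (x1 + t *: 0 - x0) ^+ 2 + (u1 + t * 1 - u0) ^+ 2 / R0) / R0).
    by rewrite scaler0 addr0 mulr1.
  move: jG; cbv zeta; rewrite !mul1r !dotp0 mulr0 !add0r expr1n mulr1.
  rewrite -/qu -/quu -/q.
  set bu := \sum_j _ - lam * (q ^+ 2 + _); set cu := \sum_j _ - _ => /(jet_ext (fun t => esym (fE t)) erefl erefl erefl) jG.
  apply: (@vertical_bound bu cu u1 u0 R0 e2 beta) => //.
    move=> u1z; apply: (jet_max_forward t00 jG).
    - by move=> t tp _; rewrite mulr1 addr_ge0.
    - by rewrite addr0.
    move=> t tp tt; rewrite addr0; apply: mx; first by rewrite addr_ge0.
    by rewrite ger0_norm.
  move=> u1p; have u1pos : 0 < u1 by rewrite lt_neqAle eq_sym u1p.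
  have t10 : 0 < Num.min t0 u1 by rewrite lt_min t00.
  have uD t : `|t| <= Num.min t0 u1 -> 0 <= u1 + t.
    by rewrite le_min => /andP[_]; rewrite ler_norml => /andP[h _]; rewrite -lerBlDl sub0r.
  apply: (jet_max t10 jG).
  - by move=> t /uD; rewrite mulr1.
  - by rewrite addr0.
  move=> t tt; rewrite addr0; apply: mx; first exact: uD.
  by move: tt; rewrite le_min => /andP[].
have hs : \sum_i (\sum_j (P i j ^+ 2 + 2 * (E j * Q i j)) - lam * (u1 * (qi i ^+ 2 + 2 * (q * qqi i)))) <= d%:R * (e2 / R0).
  have -> : d%:R * (e2 / R0) = \sum_(i < d) (e2 / R0) by rewrite sumr_const card_ord mulr_natl.
  by apply: ler_sum => i _; exact: ci.
move: hs hu; set a1 := \sum_i _; set a2 := 8 * u1 * _; set a3 := 2 * beta * _ => hs hu hb.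
rewrite exprMn expr_div_n -/R0 -/q [leRHS]mulrAC ler_pdivlMr//.
have {}hb : lam * beta * (1 - beta) * q ^+ 2 <= (2 * d%:R + 18) * (e2 / R0).
  exact: collect_bounds hb hs hu.
have -> : R0 / 2 ^+ 2 * q ^+ 2 * (4 * (lam * beta * (1 - beta))) = R0 * (lam * beta * (1 - beta) * q ^+ 2) by field.
by move: hb; rewrite mulrA ler_pdivlMr// mulrC.
Qed.

End NearMaximum.

(** * Vanishing of the field, and contradiction for s > d - 1 *)

Section Codimension.
Context {R : realType} {d : nat}.
Local Notation Rd := (@Rdm R d).
Variable mu : {sigma_finite_measure set Rd -> \bar R}.
Variables (s Lam : R).
Hypothesis mu_nice : nice s Lam mu.
Hypothesis s_gt0 : 0 < s.
Hypothesis Lam_ge0 : 0 <= Lam.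
Hypothesis s_ltd : s < d%:R.
Hypothesis s_gtd1 : d%:R < s + 1.
Variable c : 'I_d -> R.
Hypothesis bal : balanced mu s c.
Implicit Types (u t r m lam theta e : R) (x y p : 'rV[R]_d) (i j : 'I_d).

Let d_gt0 : (0 < d)%N. Proof. by rewrite -(ltr_nat R); apply: lt_trans s_ltd. Qed.

(** At the scale given by [regular_scale], theta = 1 bounds the field uniformly, so the supremum of
    [excess] is finite. *)
Lemma regular_bound : (exists p, supp mu p) -> exists2 C, 0 <= C & forall m u x, regular mu m u x ->
  \sum_j field mu s c u j x * field mu s c u j x <= C.
Proof.
move=> ex; have [C C0 hC] := field_bound_off mu_nice s_gt0 Lam_ge0 s_ltd bal.
exists (d%:R * (C * (1 + C)) ^+ 2); first by nonneg.
move=> m u x regm; have [r [p [reg Sp hp]]] := regular_scale regm ex.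
have [r0 u0 _] := reg; have r20 := exprn_gt0 2 r0.
have xp : enorm (x - p) <= 5 * r.
  rewrite -(ler_pXn2r (_ : (0 < 2)%N)) ?nnegrE ?mulr_ge0 ?(ltW r0)// enorm_sqr exprMn.
  by rewrite (_ : (5 : R) ^+ 2 = 25); [lra|ring].
have ur : u <= 25 * r ^+ 2 by have := dotp_ge0 (x - p); lra.
have [P1 hf] := hC r u x p reg Sp xp ur.
have -> : d%:R * (C * (1 + C)) ^+ 2 = \sum_(j < d) (C * (1 + C)) ^+ 2 by rewrite sumr_const card_ord mulr_natl.
apply: ler_sum => j _; rewrite -expr2 -(real_normK (num_real _)).
apply: ler_sqr_ge0 => //; apply: (le_trans (hf 1 ltr01 (lexx _) j)); apply: ler_wpM2l => //.
by rewrite powR1 mul1r lerD2l.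
Qed.

Lemma supremum_contradiction (M A e theta T : R) : 0 < M -> 0 < theta -> theta <= 1 -> 0 <= A -> 0 < e -> e <= 1 ->
  e <= M -> A * theta <= M / 4 -> T <= theta -> 0 <= T ->
  M - e ^+ 2 / 64 <= A / 4 * (theta + T) ^+ 2 -> False.
Proof.
move=> M0 th0 th1 A0 e0 e1 eM Ath Tth T0 h.
have e2 : e ^+ 2 <= M by rewrite expr2; apply: le_trans eM; rewrite ler_piMl// ltW.
have t2 : (theta + T) ^+ 2 <= 4 * theta.
  apply: (@le_trans _ _ ((2 * theta) ^+ 2)).
    by apply: lerXn2r; rewrite ?nnegrE; lra.
  rewrite exprMn (_ : (2 : R) ^+ 2 = 4); last by ring.
  by rewrite ler_pM2l// expr2 ler_piMl// ltW.
have A40 : 0 <= A / 4 by apply: divr_ge0.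
have := ler_wpM2l A40 t2; lra.
Qed.

Lemma sqr_le_scale (P C e : R) : 0 <= P -> 0 <= C -> 0 < e -> P ^+ 2 <= C * e ^+ 2 -> P <= (C + 1) * e.
Proof.
move=> P0 C0 e0 h; have C1 : 0 <= C + 1 by lra.
rewrite -(ler_pXn2r (_ : (0 < 2)%N)) ?nnegrE ?mulr_ge0 ?(ltW e0)//.
apply: (le_trans h); rewrite exprMn; apply: ler_wpM2r; first exact/ltW/exprn_gt0.
by rewrite expr2; nra.
Qed.

(** If the supremum M were positive, at a suitable point with [excess] above M - e^2/64 the scaled
    density would be at most (C1 + 1) e. Taking theta small against M, and e small against theta,
    the field there is at most 2 C theta, too small for [excess] to be near M. *)
Lemma excess_le0 lam : (exists p, supp mu p) -> 0 < lam -> lam * (4 * d%:R) <= s + 1 - d%:R ->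
  forall m u x, regular mu m u x -> excess mu s c lam u x <= 0.
Proof.
move=> ex lam0 lamle m u x reg; rewrite leNgt; apply/negP => ex0.
have [B B0 hB] := regular_bound ex.
have dens0 u' x' : 0 <= u' -> 0 <= lam * (u' * (density mu s u' x' * density mu s u' x')).
  by move=> u'0; rewrite !mulr_ge0// ?density_ge0// ltW.
pose W := [set z : R | exists m' u' x', regular mu m' u' x' /\ z = excess mu s c lam u' x'].
have ubW : ubound W B.
  move=> _ [m' [u' [x' [reg' ->]]]]; have [_ u'0 _] := reg'.
  by rewrite /excess lerBlDr (le_trans (hB _ _ _ reg'))// lerDl dens0.
have hW : has_sup W by split; [exists (excess mu s c lam u x), m, u, x|exists B].
have inW m' u' x' : regular mu m' u' x' -> excess mu s c lam u' x' <= sup W.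
  by move=> reg'; apply: sup_upper_bound => //; exists m', u', x'.
set M := sup W in inW.
have M0 : 0 < M by apply: lt_le_trans ex0 _; exact: inW reg.
have [C C0 hC] := field_bound_off mu_nice s_gt0 Lam_ge0 s_ltd bal.
have [C1 C10 hmax] := near_max mu_nice s_gt0 s_ltd s_gtd1 d_gt0 c lam0 lamle ex.
have A0 : 0 <= 4 * (d%:R * C ^+ 2) by nonneg.
have [theta th0 /andP[th1 thA]] := small_factor M0 A0 ltr01.
pose K := theta `^ (- s) * (C1 + 1) / theta.
have K0 : 0 <= K by rewrite /K mulr_ge0// ?mulr_ge0 ?powR_ge0 ?addr_ge0// invr_ge0 ltW.
have b0 : 0 < Num.min 1 M by rewrite lt_min ltr01.
have four0 : 0 < 4 :> R by [].
(* Starting from 4, [small_factor] yields K e <= 1, that is theta^-s (C1 + 1) e <= theta. *)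
have [e e0 /andP[eb eK]] := small_factor four0 K0 b0.
move: eb; rewrite le_min => /andP[e1 eM].
have e20 : 0 < e ^+ 2 / 64 by rewrite divr_gt0// exprn_gt0.
have [_ [m0 [u0 [x0 [reg0 ->]]]] hx0] := sup_adherent e20 hW.
have [r [u1 [x1 [p [reg1 Sp [xp ur] h01 hq]]]]] := hmax m0 u0 x0 e M reg0 e0 inW hx0.
have [_ hf] := hC r u1 x1 p reg1 Sp xp ur.
have [r0 u10 _] := reg1.
set P := r * density mu s u1 x1 in hq hf.
have P0 : 0 <= P by rewrite mulr_ge0 ?density_ge0// ltW.
clearbody P.
have Pe := sqr_le_scale P0 C10 e0 hq.
pose T := theta `^ (- s) * P.
have T0 : 0 <= T by rewrite mulr_ge0 ?powR_ge0.
have Tth : T <= theta.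
  apply: (@le_trans _ _ (theta `^ (- s) * ((C1 + 1) * e))).
    by rewrite /T; apply: ler_wpM2l Pe; exact: powR_ge0.
  move: eK; rewrite /K mulrAC ler_pdivrMr// => h; rewrite mulrA; apply: (le_trans h).
  by rewrite divff// mul1r.
apply: (@supremum_contradiction M (4 * (d%:R * C ^+ 2)) e theta T) => //.
have -> : 4 * (d%:R * C ^+ 2) / 4 = d%:R * C ^+ 2 by rewrite mulrC mulKf.
apply: (le_trans (ltW hx0)); apply: (le_trans h01).
rewrite /excess lerBlDr; apply: (@le_trans _ _ (d%:R * C ^+ 2 * (theta + T) ^+ 2)); last by rewrite lerDl dens0.
have -> : d%:R * C ^+ 2 * (theta + T) ^+ 2 = \sum_(j < d) (C * (theta + T)) ^+ 2.
  by rewrite sumr_const card_ord exprMn -mulrA mulr_natl.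
apply: ler_sum => j _; rewrite -expr2 -(real_normK (num_real _)).
by apply: ler_sqr_ge0 => //; exact: hf.
Qed.

Lemma field_vanishes m u x j : (exists p, supp mu p) -> regular mu m u x -> field mu s c u j x = 0.
Proof.
move=> ex reg; have [_ u0 _] := reg.
have dr : 0 < 4 * d%:R :> R by rewrite mulr_gt0// ltr0n.
pose l0 := (s + 1 - d%:R) / (4 * d%:R).
have l00 : 0 < l0 by rewrite divr_gt0// subr_gt0.
have sum0 : \sum_j field mu s c u j x * field mu s c u j x <= 0.
  apply: (@le0_of_linear _ _ (u * (density mu s u x * density mu s u x)) l0 l00) => lam lam0 laml.
  have lamle : lam * (4 * d%:R) <= s + 1 - d%:R by rewrite -ler_pdivlMr.
  by have := excess_le0 ex lam0 lamle reg; rewrite /excess subr_le0 mulrC.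
have : field mu s c u j x * field mu s c u j x <= 0.
  apply: le_trans sum0; rewrite (bigD1 j)//= lerDl; apply: sumr_ge0 => k _.
  by rewrite -expr2 sqr_ge0.
by rewrite -expr2 => h; apply/eqP; rewrite -sqrf_eq0 eq_le h sqr_ge0.
Qed.

Lemma density_ode t x : (exists p, supp mu p) -> 0 < t ->
  is_derive t 1 (fun u => density mu s u x) (- ((s + 1 - d%:R) / 2) * density mu s t x / t).
Proof.
move=> ex t0; pose m := Num.sqrt t.
have m0 : 0 < m by rewrite sqrtr_gt0.
have m2 : m ^+ 2 = t by rewrite sqr_sqrtr// ltW.
have regt x' : regular mu m t x' by rewrite -m2; exact: regular_sqr.
have reg := regt x.
have div0 i : field_d1 mu s (delta_mx ord0 i) 0 i t x = 0.
  have xi1 : enorm (delta_mx ord0 i : 'rV[R]_d) <= 1 by rewrite enorm_delta.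
  have [jf _] := field_is_jet mu_nice s_gt0 c i reg xi1 (or_introl erefl).
  have fz h : field mu s c (t + h * 0) i (x + h *: delta_mx ord0 i) = 0.
    by rewrite mulr0 addr0; exact: field_vanishes ex (regt _).
  (* The field vanishes along the whole line, so 0 is a maximum and the first-order coefficient is
     0. *)
  have [|||d0 _] := jet_max ltr01 jf; last exact: d0.
  - by move=> h _; rewrite mulr0 addr0 ltW.
  - by rewrite fz (field_vanishes _ ex reg).
  - by move=> h _; rewrite !fz.
have := field_divergence mu_nice s_gt0 reg.
rewrite big1 => [hd|i _]; last exact: div0.
have -> : - ((s + 1 - d%:R) / 2) * density mu s t x / t = density_d1 mu s 0 1 t x.
  have tn : t != 0 by rewrite gt_eqF.
  apply: (mulIf tn); rewrite divfK//; move: hd; rewrite -(mulrA 2) => /esym/eqP; rewrite subr_eq0 => /eqP hd.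
  by rewrite (mulrC _ t); apply: (@mulfI _ 2); rewrite ?pnatr_eq0// -hd; field.
have xi1 : enorm (0 : 'rV[R]_d) <= 1 by rewrite enorm0.
have [_ jq] := field_is_jet mu_nice s_gt0 c (Ordinal d_gt0) reg xi1 (or_intror erefl).
apply: (@jet_derive R _ _ _ (density_d2 mu s 0 1 t x)) erefl.
have [K [r [K0 r0 h]]] := jq; exists K, (Num.min r t); split => //; first by rewrite lt_min r0.
move=> z _; rewrite le_min => /andP[zr zt].
have := h z; rewrite mulr1 scaler0 addr0; apply => //.
by move: zt; rewrite ler_norml => /andP[]; lra.
Qed.

Lemma support_empty p : supp mu p -> False.
Proof.
move=> Sp; have ex : exists p, supp mu p by exists p.
pose b := s + 1 - d%:R; pose phi u := density mu s u p.
have b0 : 0 < b by rewrite subr_gt0.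
have b1 : b < 1 by rewrite /b; move: s_ltd; lra.
pose C0 := 2 `^ (s + 2) * Lam.
have C00 : 0 <= C0 by rewrite /C0; nonneg.
have phi1 : 0 < phi 1.
  have h1 := ball_le_density mu_nice s_gt0 p ltr01.
  rewrite mulr1 powR1 mulr1 mul1r expr1n -/(phi 1) in h1.
  have m0 : 0 < fine (mu (eball p 2)).
    by apply: fine_gt0; rewrite (Sp _ (ltr0n _ 2))/=; apply: le_lt_trans (mu_nice p (ltr0n _ 2)) _; rewrite ltry.
  have : 0 < 5 `^ ((s + 1) / 2) * phi 1 by apply: lt_le_trans h1.
  by rewrite pmulr_rgt0// powR_gt0.
(* The derivative of u^(b/2) q is zero by [density_ode]. *)
have const t : 1 <= t -> t `^ (b / 2) * phi t = phi 1.
  move=> t1; have [|z /andP[z1 zt]] := @mean_value R (fun u => u `^ (b / 2) * phi u)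
     (fun u => u `^ (b / 2) * (- (b / 2) * phi u / u) + phi u * (b / 2 * u `^ (b / 2 - 1))) 1 t t1.
    move=> z /andP[z1 _]; have z0 : 0 < z by lra.
    have d1 := density_ode p ex z0.
    have d2 : is_derive z 1 (fun u : R => u `^ (b / 2)) (b / 2 * z `^ (b / 2 - 1)) by exact: is_derive1_powR.
    exact: (@is_deriveM R R^o (fun u => u `^ (b / 2)) phi z 1 _ _ d2 d1).
  have z0 : 0 < z by lra.
  have -> : z `^ (b / 2 - 1) = z `^ (b / 2) / z.
    by rewrite powRD ?(gt_eqF z0) ?implybT// powR_inv1// ltW.
  rewrite (_ : z `^ (b / 2) * _ + _ = 0); last by field; rewrite gt_eqF.
  by rewrite mul0r powR1 mul1r => /eqP; rewrite subr_eq0 => /eqP.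
(* Constancy at t^2 reads t^b phi(t^2) = phi(1), so t phi(t^2) <= C0 becomes t^(1-b) phi(1) <= C0.
   The choice t^(1-b) = q violates this. *)
pose q := (C0 + 1) / phi 1 + 1.
have q1 : 1 <= q by rewrite /q lerDr divr_ge0 ?ltW//; lra.
pose t := q `^ (1 - b)^-1.
have b10 : 0 < 1 - b by rewrite subr_gt0.
have tq : t `^ (1 - b) = q by rewrite /t -powRrM mulVf ?gt_eqF// powRr1//; lra.
have t1 : 1 <= t.
  by rewrite -(powRr0 q) /t; apply: ler_powR => //; rewrite invr_ge0 ltW.
have t0 : 0 < t by lra.
have t21 : 1 <= t ^+ 2 by exact: exprn_ege1.
have e1 := const _ t21.
rewrite powR_sqr ?(ltW t0)// (_ : 2 * (b / 2) = b) in e1; last by field.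
have e2 := density_le mu_nice s_gt0 p t0; rewrite -/(phi _) -/C0 in e2.
have : q * phi 1 <= C0.
  rewrite -tq -e1 mulrA -powRD ?(gt_eqF t0) ?implybT// subrK powRr1//; exact: ltW.
by rewrite /q mulrDl divfK ?gt_eqF// mul1r -addrA leNgt ltrDl addr_gt0.
Qed.

End Codimension.

Lemma reflectionless_no_ball (R : realType) (d : nat) (s Lam : R)
  (mu : {sigma_finite_measure set (@Rdm R d) -> \bar R}) (y0 : 'rV[R]_d) (r : R) :
  0 < s < d%:R -> 0 <= Lam -> nice s Lam mu -> reflectionless s mu -> 0 < r ->
  ~ (eball y0 r `<=` supp mu).
Proof.
move=> /andP[s0 sd] L0 nic refl r0 BS.
have Sy0 : supp mu y0 by apply: BS; rewrite /eball/= subrr enorm0.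
have [c bal] := reflectionless_balanced nic s0 L0 refl (ex_intro _ _ Sy0).
have [ds|ds] := ltP (d%:R : R) (s + 1).
  exact: (support_empty nic s0 L0 sd ds bal Sy0).
have r40 : 0 < r / 4 by exact: divr_gt0.
by apply: (support_no_ball nic s0 L0 ds bal (y0 := y0) r40); rewrite mulrC divfK.
Qed.

Theorem theorem1p4 (R : realType) (d : nat) (s : R)
  (mu : {measure set Rd R d -> \bar R}) :
  (2 <= d)%N -> 0 < s < d%:R ->
  locally_finite mu -> reflectionless s mu ->
  nowhere_dense (supp mu).
Proof.
move=> _ sd lf refl; have [[Lam [L0 [nic _]]] _] := refl.
rewrite /nowhere_dense -(closure_id (supp mu)).1; last exact: closed_supp.
apply/seteqP; split => // y0 /= /nbhs_eball[r r0 BS].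
(* The hypotheses are transported to the sigma-finite alias, which is equal to mu as a measure. *)
move: BS nic refl; rewrite -(sigma_finite_copyE lf) => BS nic refl.
exact: (reflectionless_no_ball sd (ltW L0) nic refl r0 BS).
Qed.
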